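(* Let $(q_n),(r_n)$ be complex sequences vanishing faster than any negative power of $|n|$ as $n\to\pm\infty$ with $1-q_nr_n\neq0$ and $1+q_nr_{n+1}\ne0$ for all $n$, and let $u_n,v_n,p_n,s_n,D_\infty,E_\infty$ be as in the context. Let $z_j$ ($0<|z_j|<1$) be a common pole of multiplicity $m_j$ of $T^{(q,r)}$, $T_{\rm r}^{(u,v)}$, $T_{\rm r}^{(p,s)}$, and let $\bar z_j$ ($|\bar z_j|>1$) be a common pole of multiplicity $\bar m_j$ of $\bar T^{(q,r)}$, $\bar T_{\rm r}^{(u,v)}$, $\bar T_{\rm r}^{(p,s)}$. With $\sigma(z):=1/(1-z^{-2})$, the dependency constants satisfy, for $0\le k\le m_j-1$, $$D_\infty\gamma_{jk}^{(q,r)}=\gamma_{jk}^{(p,s)},\qquad D_\infty\gamma_{jk}^{(q,r)}=\sum_{l=0}^k\binom kl\frac{d^l\sigma(z_j)}{dz^l}\,\gamma^{(u,v)}_{j(k-l)},$$ and, for $0\le k\le\bar m_j-1$, $$\bar\gamma_{jk}^{(p,s)}=E_\infty\bar\gamma_{jk}^{(q,r)},\qquad \bar\gamma_{jk}^{(u,v)}=E_\infty\sum_{l=0}^k\binom kl\frac{d^l\sigma(\bar z_j)}{dz^l}\,\bar\gamma^{(q,r)}_{j(k-l)}.$$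
   Context: System (Q): $\begin{bmatrix}\alpha_n\\ \beta_n\end{bmatrix}=\begin{bmatrix} z & (z-z^{-1})q_n\\ z r_n & z^{-1}+(z-z^{-1})q_nr_n\end{bmatrix}\begin{bmatrix}\alpha_{n+1}\\ \beta_{n+1}\end{bmatrix}$; system (U) with potentials $(a,b)$: $\begin{bmatrix}\xi_n\\ \eta_n\end{bmatrix}=\begin{bmatrix} z & z a_n\\ z^{-1}b_n & z^{-1}\end{bmatrix}\begin{bmatrix}\xi_{n+1}\\ \eta_{n+1}\end{bmatrix}$. $D_n=\prod_{j\le n}(1-q_jr_j)$, $E_n=\prod_{j\le n}(1+q_jr_{j+1})$, $D_\infty,E_\infty$ the full products; $u_n=q_nE_{n-1}/D_n$, $v_n=(-r_n+r_{n+1}-q_nr_nr_{n+1})D_{n-1}/E_n$, $p_n=(q_n-q_{n+1}-q_nq_{n+1}r_{n+1})E_{n-1}/D_{n+1}$, $s_n=r_{n+1}D_n/E_n$. Superscripts $(q,r)$, $(u,v)$, $(p,s)$ refer to (Q) and to (U) with potentials $(u,v)$, $(p,s)$. For $|z|=1$ the Jost solutions (overbars not complex conjugation) are $\psi_n=\begin{bmatrix}o(1)\\ z^n[1+o(1)]\end{bmatrix}$, $\bar\psi_n=\begin{bmatrix}z^{-n}[1+o(1)]\\ o(1)\end{bmatrix}$ as $n\to+\infty$, and $\phi_n=\begin{bmatrix}z^{-n}[1+o(1)]\\ o(1)\end{bmatrix}$, $\bar\phi_n=\begin{bmatrix}o(1)\\ z^{n}[1+o(1)]\end{bmatrix}$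 as $n\to-\infty$; $\psi_n,\phi_n$ extend analytically in $z$ to $0<|z|<1$ and $\bar\psi_n,\bar\phi_n$ to $|z|>1$. Right transmission coefficients: first component of $\phi_n$ $=(1/T_{\rm r})z^{-n}[1+o(1)]$ and second component of $\bar\phi_n$ $=(1/\bar T_{\rm r})z^n[1+o(1)]$ as $n\to+\infty$ (for (Q), $T^{(q,r)}:=T_{\rm r}$, $\bar T^{(q,r)}:=\bar T_{\rm r}$), extended meromorphically to $|z|<1$, resp. $|z|>1$. Dependency constants: at a pole $z_j$ of multiplicity $m_j$, for each of the three systems there are unique constants $\gamma_{j0},\dots,\gamma_{j(m_j-1)}$ with $\frac{d^k\phi_n(z_j)}{dz^k}=\sum_{l=0}^k\binom kl\gamma_{j(k-l)}\frac{d^l\psi_n(z_j)}{dz^l}$ for all $n\in\mathbb Z$ and $0\le k\le m_j-1$; analogously $\bar\gamma_{jk}$ are defined at $\bar z_j$ by $\frac{d^k\bar\phi_n(\bar z_j)}{dz^k}=\sum_{l=0}^k\binom kl\bar\gamma_{j(k-l)}\frac{d^l\bar\psi_n(\bar z_j)}{dz^l}$, $0\le k\le\bar m_j-1$. *)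

(* Defs.v *)
(* Complex numbers are R[i] for an
   arbitrary R : realType, viewed as a numFieldType (so that derive1 /
   derivable are genuine complex derivatives). *)
From HB Require Import structures.
From mathcomp Require Import all_boot all_order all_algebra.
From mathcomp Require Import complex.
From mathcomp Require Import all_classical all_reals topology normedtype sequences derive.
Set Implicit Arguments. Unset Strict Implicit. Unset Printing Implicit Defensive.
Import Order.TTheory GRing.Theory Num.Theory.
Import numFieldNormedType.Exports.
Local Open Scope classical_set_scope.
Local Open Scope ring_scope.

Definition Cx (R : realType) : numFieldType := R[i].

Section Defs.
Variable R : realType.
Local Notation C := (Cx R).

Definition to_pinfty (x : int -> C) (l : C) : Prop :=
  (fun n : nat => x n%:Z) @ \oo --> l.
Definition to_minfty (x : int -> C) (l : C) : Prop :=
  (fun n : nat => x (- n%:Z)) @ \oo --> l.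

Definition rapid_decay (q : int -> C) : Prop :=
  forall k : nat, to_pinfty (fun n => `|n|%:R ^+ k * `|q n|) 0 /\
                  to_minfty (fun n => `|n|%:R ^+ k * `|q n|) 0.

Definition is_Dseq (q r : int -> C) (D : int -> C) : Prop :=
  forall n : int, (fun M : nat => \prod_(i < M) (1 - q (n - i%:Z) * r (n - i%:Z)))
                    @ \oo --> D n.
Definition is_Eseq (q r : int -> C) (E : int -> C) : Prop :=
  forall n : int, (fun M : nat => \prod_(i < M) (1 + q (n - i%:Z) * r (n - i%:Z + 1)))
                    @ \oo --> E n.

Definition u_of (q r D E : int -> C) (n : int) : C := q n * E (n - 1) / D n.
Definition v_of (q r D E : int -> C) (n : int) : C :=
  (- r n + r (n + 1) - q n * r n * r (n + 1)) * D (n - 1) / E n.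
Definition p_of (q r D E : int -> C) (n : int) : C :=
  (q n - q (n + 1) - q n * q (n + 1) * r (n + 1)) * E (n - 1) / D (n + 1).
Definition s_of (q r D E : int -> C) (n : int) : C := r (n + 1) * D n / E n.

(* A system:  Y_n = S z n Y_{n+1}  (given by the 2x2 coefficient matrix). *)
Definition system := C -> int -> C -> C -> C * C.

Definition sysQ (q r : int -> C) : system := fun z n a b =>
  (z * a + (z - z^-1) * q n * b,
   z * r n * a + (z^-1 + (z - z^-1) * q n * r n) * b).

Definition sysU (a b : int -> C) : system := fun z n x y =>
  (z * x + z * a n * y, z^-1 * b n * x + z^-1 * y).

Definition solves (S : system) (z : C) (Y : int -> C * C) : Prop :=
  forall n : int, Y n = S z n (Y (n + 1)).1 (Y (n + 1)).2.

Definition inner : set C := [set z | 0 < `|z| < 1].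
Definition inner_cl : set C := [set z | 0 < `|z| <= 1].
Definition outer : set C := [set z | 1 < `|z|].
Definition outer_cl : set C := [set z | 1 <= `|z|].

Definition analytic_ext (A Acl : set C) (f : C -> C) : Prop :=
  (forall z, A z -> derivable f z 1) /\ {within Acl, continuous f}.

Definition is_jost (S : system) (psi psib phi phib : C -> int -> C * C) : Prop :=
  [/\ (forall z, inner_cl z -> solves S z (psi z) /\ solves S z (phi z)),
      (forall z, outer_cl z -> solves S z (psib z) /\ solves S z (phib z)),
      (forall n : int,
         [/\ analytic_ext inner inner_cl (fun z => (psi z n).1),
             analytic_ext inner inner_cl (fun z => (psi z n).2),
             analytic_ext inner inner_cl (fun z => (phi z n).1) &
             analytic_ext inner inner_cl (fun z => (phi z n).2)]),
      (forall n : int,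
         [/\ analytic_ext outer outer_cl (fun z => (psib z n).1),
             analytic_ext outer outer_cl (fun z => (psib z n).2),
             analytic_ext outer outer_cl (fun z => (phib z n).1) &
             analytic_ext outer outer_cl (fun z => (phib z n).2)]) &
      (forall z : C, `|z| = 1 ->
         [/\ to_pinfty (fun n => (psi z n).1) 0,
             to_pinfty (fun n => (psi z n).2 * z ^ (- n)) 1,
             to_pinfty (fun n => (psib z n).1 * z ^ n) 1 &
             to_pinfty (fun n => (psib z n).2) 0] /\
         [/\ to_minfty (fun n => (phi z n).1 * z ^ n) 1,
             to_minfty (fun n => (phi z n).2) 0,
             to_minfty (fun n => (phib z n).1) 0 &
             to_minfty (fun n => (phib z n).2 * z ^ (- n)) 1])].

Definition inv_transmission (phi : C -> int -> C * C) (a : C -> C) : Prop :=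
  (forall z : C, `|z| = 1 -> to_pinfty (fun n => (phi z n).1 * z ^ n) (a z))
  /\ analytic_ext inner inner_cl a.

Definition inv_transmission_bar (phib : C -> int -> C * C) (ab : C -> C) : Prop :=
  (forall z : C, `|z| = 1 -> to_pinfty (fun n => (phib z n).2 * z ^ (- n)) (ab z))
  /\ analytic_ext outer outer_cl ab.

Definition pole_of_order (f : C -> C) (z0 : C) (m : nat) : Prop :=
  (0 < m)%N /\
  exists g : C -> C,
    [/\ \forall w \near z0, derivable g w 1,
        g z0 != 0 &
        \forall w \near z0, w != z0 -> f w = g w / (w - z0) ^+ m].

(* dependency constants gam_0..gam_{m-1} at z0 between Y (= phi or phib)
   and X (= psi or psib):
   d^k Y_n(z0) = sum_{l=0}^k binom k l gam_{k-l} d^l X_n(z0). *)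
Definition dep_consts (Y X : C -> int -> C * C) (z0 : C) (m : nat)
    (gam : nat -> C) : Prop :=
  forall (n : int) (k : nat), (k < m)%N ->
    derive1n k (fun w => (Y w n).1) z0 =
      \sum_(l < k.+1) 'C(k, l)%:R * gam (k - l)%N * derive1n l (fun w => (X w n).1) z0
    /\
    derive1n k (fun w => (Y w n).2) z0 =
      \sum_(l < k.+1) 'C(k, l)%:R * gam (k - l)%N * derive1n l (fun w => (X w n).2) z0.

Definition sigma (z : C) : C := (1 - (z ^+ 2)^-1)^-1.

End Defs.

(* Main.v *)
(* With N(x), L(x) the unipotent upper and lower triangular matrices and
   Z = diag(z, 1/z), system (Q) has the coefficient matrix
   L(r_n) N(-q_n) Z N(q_n), and (U) with potentials (a, b) is Z times the
   matrix with rows (1, a) and (b, 1).  Hence diag(E_(n-1), D_n) N(q_n) L(-r_n)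
   maps solutions of (Q) to solutions of (U) with (p, s), and conjugating by
   diag(1 - z^-2, 1) first shows that diag(E_(n-1), D_(n-1)) times the matrix
   with rows (1, 0) and (-r_n, 1 - z^-2) does so for (u, v).  On |z| = 1 a
   Wronskian argument identifies the image of each Jost solution with a multiple
   of the corresponding Jost solution of (U), by one of the factors 1, D_oo, E_oo,
   possibly times 1/sigma.  A function analytic in the punctured disc (or outside
   the disc) that vanishes on the unit circle is zero, so these identities persist
   at the poles.  Truncated Taylor expansions turn the dependency relations into
   congruences of polynomials modulo X^m, and the dependency constants are compared
   by cancelling the jet of a Jost solution of (U).  That solution is nonzero at the
   pole because the Jost solution of (Q) is: inside the disc, the latter is the limit
   of the solutions for truncated potentials, which are uniformly close to z^n. *)
Require Import Defs.
From HB Require Import structures.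
From mathcomp Require Import all_boot all_order all_algebra.
From mathcomp Require Import complex ring lra zify.
From mathcomp Require Import all_classical all_reals topology normedtype sequences derive.
From mathcomp Require Import exp trigo.
Import Order.TTheory GRing.Theory Num.Theory.
Import numFieldNormedType.Exports.
Local Open Scope classical_set_scope.
Local Open Scope ring_scope.
Set Implicit Arguments. Unset Strict Implicit. Unset Printing Implicit Defensive.

(** * Norm and topology of the complex numbers *)

Section ComplexNorm.
Variable R : realType.
Local Notation C := (Cx R).

(** Two obstacles shape the proof. [is_jost] prescribes asymptotics only on $|z|=1$; inside the
    punctured disc just analyticity is known, without any control of growth at 0. So every fact must
    be carried inwards from the circle, by a Cauchy estimate that tolerates an essential singularity
    at 0; the exterior is reduced to the disc by inversion. In particular $\psi_n(z_j)$ might a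
    priori vanish for all $n$, and the dependency relations would then say nothing about the
    constants. Secondly, higher derivatives at the poles only make sense once the derivative of a
    complex differentiable function is known to be differentiable again; this is why Goursat's lemma
    and Cauchy's formula are developed here, in annuli centred at 0, the only regions that occur. *)

Definition toC (x : R) : C := (x%:C)%C.
Definition iC : C := ('i)%C.
(** The norm of [Cx R] takes its values in [Cx R] itself; with a real-valued copy, estimates become
    linear arithmetic over [R]. *)
Definition nrm (z : C) : R := Normc.normc z.

Lemma toCD x y : toC (x + y) = toC x + toC y. Proof. exact: rmorphD. Qed.
Lemma toCN x : toC (- x) = - toC x. Proof. exact: rmorphN. Qed.
Lemma toCB x y : toC (x - y) = toC x - toC y. Proof. exact: rmorphB. Qed.
Lemma toCM x y : toC (x * y) = toC x * toC y. Proof. exact: rmorphM. Qed.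
Lemma toC0 : toC 0 = 0. Proof. exact: rmorph0. Qed.
Lemma toC1 : toC 1 = 1. Proof. exact: rmorph1. Qed.
Lemma toCn n : toC n%:R = n%:R. Proof. exact: rmorph_nat. Qed.
Lemma iC2 : iC * iC = -1. Proof. by rewrite -expr2; exact: sqr_i. Qed.
Lemma toC_eq0 x : (toC x == 0) = (x == 0). Proof. exact: fmorph_eq0. Qed.

Lemma normE (z : C) : `|z| = toC (nrm z). Proof. by case: z. Qed.
Lemma nrm_ge0 z : 0 <= nrm z.
Proof. by rewrite -ler0c; have := normr_ge0 z; rewrite normE. Qed.
Lemma nrmM x y : nrm (x * y) = nrm x * nrm y. Proof. exact: Normc.normcM. Qed.
Lemma nrmV x : nrm x^-1 = (nrm x)^-1. Proof. exact: Normc.normcV. Qed.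
Lemma nrm_triangle x y : nrm (x + y) <= nrm x + nrm y.
Proof. exact: le_normcD. Qed.
Lemma nrmN x : nrm (- x) = nrm x. Proof. exact: normcN. Qed.
Lemma nrm_triangleB x y : nrm (x - y) <= nrm x + nrm y.
Proof. by rewrite -(nrmN y); exact: nrm_triangle. Qed.
Lemma nrm_distC x y : nrm (x - y) = nrm (y - x).
Proof. by rewrite -nrmN opprB. Qed.
Lemma nrm0 : nrm 0 = 0. Proof. exact: Normc.normc0. Qed.
Lemma nrm1 : nrm 1 = 1. Proof. exact: Normc.normc1. Qed.
Lemma nrm_eq0 x : (nrm x == 0) = (x == 0).
Proof.
by apply/eqP/eqP => [|->]; [exact: Normc.eq0_normc|exact: nrm0].
Qed.
Lemma nrm_gt0 x : (0 < nrm x) = (x != 0).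
Proof. by rewrite lt_def nrm_ge0 nrm_eq0 andbT. Qed.
Lemma nrm_toC x : nrm (toC x) = `|x|.
Proof. by rewrite /nrm /toC /= expr0n addr0 sqrtr_sqr. Qed.
Lemma nrm_iC : nrm iC = 1.
Proof. by rewrite /nrm /iC /= expr0n add0r expr1n sqrtr1. Qed.
Lemma nrmX x n : nrm (x ^+ n) = nrm x ^+ n.
Proof. by elim: n => [|n IH]; rewrite ?expr0 ?nrm1// !exprS nrmM IH. Qed.
Lemma nrm_nat n : nrm n%:R = n%:R.
Proof. by rewrite -toCn nrm_toC ger0_norm. Qed.
Lemma nrm_sum n (F : 'I_n -> C) : nrm (\sum_(i < n) F i) <= \sum_(i < n) nrm (F i).
Proof.
elim/big_ind2: _ => [|x1 x2 y1 y2 h1 h2|//]; first by rewrite nrm0.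
exact: le_trans (nrm_triangle _ _) (lerD h1 h2).
Qed.
Lemma lecE' x y : (toC x <= toC y) = (x <= y). Proof. exact: lecR. Qed.
Lemma ltcE' x y : (toC x < toC y) = (x < y). Proof. exact: ltcR. Qed.
Lemma pos_toC (e : C) : 0 < e -> exists2 x : R, 0 < x & e = toC x.
Proof.
move=> e0; have : e \is Num.real by exact: gtr0_real.
by move/complex_realP => [k ek]; exists k; rewrite // -ltcE' toC0 -[toC k]ek.
Qed.

Lemma cvg_nrmP (f : nat -> C) (l : C) : (f @ \oo --> l) <->
  forall e : R, 0 < e -> exists N : nat, forall n, (N <= n)%N -> nrm (f n - l) <= e.
Proof.
split=> [/cvgrPdist_le h e e0|h].
  have /h[N _ hN] : 0 < toC e by rewrite -toC0 ltcE'.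
  by exists N => n Nn; have := hN n Nn; rewrite /= normE lecE' nrm_distC.
apply/cvgrPdist_le => e /pos_toC[x x0 ->]; have [N hN] := h _ x0.
by exists N => // n /hN; rewrite /= normE lecE' nrm_distC.
Qed.

Lemma nbhs_nrmP (P : set C) (z : C) : nbhs z P <->
  exists2 d : R, 0 < d & forall w, nrm (w - z) < d -> P w.
Proof.
split=> [/nbhs_ballP[e/= /pos_toC[x x0 ->]] h|[d d0 h]].
  by exists x => // w hw; apply: h; rewrite -ball_normE /= normE ltcE' nrm_distC.
apply/nbhs_ballP; exists (toC d); first by rewrite /= -toC0 ltcE'.
by move=> w; rewrite -ball_normE /= normE ltcE' nrm_distC => /h.
Qed.

Lemma continuous_nrmP (f : C -> C) (z : C) : f x @[x --> z] --> f z <->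
  forall e : R, 0 < e -> exists2 d : R, 0 < d &
    forall w, nrm (w - z) < d -> nrm (f w - f z) <= e.
Proof.
split=> [/(@cvgrPdist_le _ _ _ (nbhs z) _ f (f z)) h e e0|h].
  have /h/nbhs_nrmP[d d0 hd] : 0 < toC e by rewrite -toC0 ltcE'.
  by exists d => // w /hd; rewrite /= normE lecE' nrm_distC.
apply/(@cvgrPdist_le _ _ _ (nbhs z) _ f (f z)) => e /pos_toC[x x0 ->]; have [d d0 hd] := h _ x0.
by apply/nbhs_nrmP; exists d => // w /hd; rewrite normE lecE' nrm_distC.
Qed.

(** Multiplied by the increment, the estimate is trivial at [h = 0], so no punctured neighbourhood
    remains. *)
Lemma is_derive_nrmP (f : C -> C) (z l : C) : is_derive z 1 f l <->
  forall e : R, 0 < e -> exists2 d : R, 0 < d &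
    forall h, nrm h < d -> nrm (f (z + h) - f z - l * h) <= e * nrm h.
Proof.
have key : (h^-1 *: (f (h *: 1 + z) - f z) @[h --> (0:C)^'] --> l) <->
  forall e : R, 0 < e -> exists2 d : R, 0 < d &
    forall h, nrm h < d -> nrm (f (z + h) - f z - l * h) <= e * nrm h.
  have E h : h != 0 -> nrm (l - h^-1 *: (f (h *: 1 + z) - f z)) * nrm h =
       nrm (f (z + h) - f z - l * h).
    move=> h0; rewrite nrm_distC -nrmM; congr nrm.
    rewrite /GRing.scale /= mulr1 (addrC h); field.
    exact: h0.
  split=> [/cvgrPdist_le h e e0|h].
    have /h : 0 < toC e by rewrite -toC0 ltcE'.
    move/nbhs_nrmP => [d d0 hd]; exists d => // k kd.
    have [->|k0] := eqVneq k 0; first by rewrite mulr0 subr0 addr0 subrr nrm0 mulr0.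
    rewrite -E// ler_wpM2r ?nrm_ge0//.
    have := hd k; rewrite subr0 => /(_ kd k0) /=.
    by rewrite normE lecE'.
  apply/cvgrPdist_le => e /pos_toC[x x0 ->]; have [d d0 hd] := h _ x0.
  apply/nbhs_nrmP; exists d => // k; rewrite subr0 => kd k0.
  rewrite normE lecE' -(ler_pM2r (_ : 0 < nrm k)) ?nrm_gt0// E//.
  exact: hd.
rewrite -key; split => [[h <-]|h]; first exact: h.
have d : derivable f z 1 by apply/cvg_ex; exists l.
by split=> //; apply: cvg_lim h.
Qed.

End ComplexNorm.

Arguments nrm : simpl never.

(** * Goursat's lemma *)

Section RectangleInduction.
Variable R : realType.

Lemma nested_intervals (a b : nat -> R) :
  (forall n, a n <= a n.+1) -> (forall n, b n.+1 <= b n) -> (forall n, a n <= b n) ->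
  exists x, forall n, a n <= x <= b n.
Proof.
move=> ha hb hab.
have am : {homo a : m n / (m <= n)%N >-> m <= n}.
  by apply: homo_leq => //; exact: le_trans.
have bm m n : (m <= n)%N -> b n <= b m.
  move=> mn; rewrite -lerN2; apply: (@homo_leq _ (fun n => - b n) <=%R) => //.
    by move=> x y z; exact: le_trans.
  by move=> k; rewrite lerN2.
have ab m n : a m <= b n.
  case/orP: (leq_total m n) => h.
    exact: le_trans (am _ _ h) (hab _).
  exact: le_trans (hab _) (bm _ _ h).
exists (sup (range a)) => n; apply/andP; split.
  apply: ub_le_sup; last by exists n.
  by exists (b 0%N) => _ [m _ <-].
by apply: ge_sup; [exists (a 0%N), 0%N|move=> _ [m _ <-]].
Qed.

Lemma exists_half_pow (x d : R) : 0 < d -> exists n : nat, x / 2 ^+ n < d.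
Proof.
move=> d0; have [x0|x0] := leP x 0.
  by exists 0%N; rewrite expr0 divr1; exact: le_lt_trans x0 d0.
exists (Num.Def.archi_bound (x / d)).
have h := archi_boundP (ltW (divr_gt0 x0 d0)).
rewrite ltr_pdivrMr ?exprn_gt0// mulrC -ltr_pdivrMr//.
by apply: lt_le_trans h _; rewrite -natrX ler_nat ltnW// ltn_expl.
Qed.

(* Cousin's lemma for dyadic quadrisection. *)
Lemma rect_ind (P : R -> R -> R -> R -> Prop) :
  (forall a b c d, a <= b -> c <= d ->
     P a ((a + b) / 2) c ((c + d) / 2) -> P ((a + b) / 2) b c ((c + d) / 2) ->
     P a ((a + b) / 2) ((c + d) / 2) d -> P ((a + b) / 2) b ((c + d) / 2) d ->
     P a b c d) ->
  forall a b c d, a <= b -> c <= d ->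
  (forall x y, a <= x <= b -> c <= y <= d -> exists2 e : R, 0 < e &
     forall a' b' c' d', a <= a' -> b' <= b -> c <= c' -> d' <= d ->
       a' <= x <= b' -> c' <= y <= d' -> b' - a' < e -> d' - c' < e -> P a' b' c' d') ->
  P a b c d.
Proof.
move=> split a b c d ab cd loc; apply: contrapT => nP.
pose bad (t : R * R * R * R) := let: (a, b, c, d) := t in
  [/\ a <= b, c <= d & ~ P a b c d].
pose half (t t' : R * R * R * R) := let: (a, b, c, d) := t in
  let: (a', b', c', d') := t' in
  [/\ a <= a', b' <= b, b' - a' = (b - a) / 2 &
   [/\ c <= c', d' <= d & d' - c' = (d - c) / 2]].
(* Stated for every [t], so that [choice] yields a total function to iterate; the zero quadruple is
   a dummy value for rectangles that are not bad. *)
have step (t : R * R * R * R) : exists t', bad t -> bad t' /\ half t t'.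
  case: t => [[[a1 b1] c1] d1].
  have [[h1 h2 h3]|] := pselect (bad (a1, b1, c1, d1)); last by exists (0, 0, 0, 0).
  set m := (a1 + b1) / 2; set n := (c1 + d1) / 2.
  have [p1|p1] := pselect (P a1 m c1 n); last first.
    by exists (a1, m, c1, n) => _; split; split=> //; rewrite /m /n; [lra..|split; lra].
  have [p2|p2] := pselect (P m b1 c1 n); last first.
    by exists (m, b1, c1, n) => _; split; split=> //; rewrite /m /n; [lra..|split; lra].
  have [p3|p3] := pselect (P a1 m n d1); last first.
    by exists (a1, m, n, d1) => _; split; split=> //; rewrite /m /n; [lra..|split; lra].
  have [p4|p4] := pselect (P m b1 n d1); last first.
    by exists (m, b1, n, d1) => _; split; split=> //; rewrite /m /n; [lra..|split; lra].
  by case: h3; apply: split.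
have /choice[f hf] := step.
pose t n := iter n f (a, b, c, d).
have bt n : bad (t n) by elim: n => [//|n IH]; exact: (hf _ IH).1.
have ht n : half (t n) (t n.+1) by exact: (hf _ (bt n)).2.
pose ta n := (t n).1.1.1; pose tb n := (t n).1.1.2.
pose tc n := (t n).1.2; pose td n := (t n).2.
have tE n : t n = (ta n, tb n, tc n, td n).
  by rewrite /ta /tb /tc /td; case: (t n) => [[[]]].
have H n := ht n; have B n := bt n.
have {}B n : [/\ ta n <= tb n, tc n <= td n & ~ P (ta n) (tb n) (tc n) (td n)].
  by have := B n; rewrite tE.
have {}H n : [/\ ta n <= ta n.+1, tb n.+1 <= tb n, tb n.+1 - ta n.+1 = (tb n - ta n) / 2 &
   [/\ tc n <= tc n.+1, td n.+1 <= td n & td n.+1 - tc n.+1 = (td n - tc n) / 2]].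
  by have := H n; rewrite (tE n) (tE n.+1).
have [x hx] : exists x, forall n, ta n <= x <= tb n.
  by apply: nested_intervals => n; [case: (H n)|case: (H n)|case: (B n)].
have [y hy] : exists x, forall n, tc n <= x <= td n.
  apply: nested_intervals => n; [|by case: (H n) => _ _ _ []|by case: (B n)].
  by case: (H n) => _ _ _ [].
have L n : [/\ a <= ta n, tb n <= b, c <= tc n & td n <= d].
  elim: n => [//|n [h1 h2 h3 h4]]; have [k1 k2 _ [k3 k4 _]] := H n.
  by split; [exact: le_trans k1|exact: le_trans h2|exact: le_trans k3|exact: le_trans h4].
have W n : tb n - ta n = (b - a) / 2 ^+ n /\ td n - tc n = (d - c) / 2 ^+ n.
  elim: n => [|n [h1 h2]]; first by rewrite expr0 !divr1.
  have [_ _ -> [_ _ ->]] := H n; rewrite h1 h2 exprS invfM.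
  by split; ring.
have [||e e0 he] := loc x y; [exact: (hx 0%N)|exact: (hy 0%N)|].
have [n1 hn1] := exists_half_pow (b - a) e0.
have [n2 hn2] := exists_half_pow (d - c) e0.
pose n := maxn n1 n2.
have mono (z : R) k : 0 <= z -> (k <= n)%N -> z / 2 ^+ n <= z / 2 ^+ k.
  move=> z0 kn; rewrite ler_wpM2l// lef_pV2 ?posrE ?exprn_gt0//.
  by rewrite ler_eXn2l// ltr1n.
have [w1 w2] := W n; have [l1 l2 l3 l4] := L n.
have [_ _ ] := B n; apply; apply: he => //.
  by rewrite w1; apply: le_lt_trans hn1; apply: mono; rewrite ?subr_ge0// leq_maxl.
by rewrite w2; apply: le_lt_trans hn2; apply: mono; rewrite ?subr_ge0// leq_maxr.
Qed.

End RectangleInduction.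

Section Goursat.
Variable R : realType.
Local Notation C := (Cx R).

(* Dyadic sums rather than integrals: halving the interval shifts [p] by one, so
   [loop_sum_split] below is an exact identity. *)
Definition riemann (p : nat) (k : R -> C) (a b : R) : C :=
  toC ((b - a) / 2 ^+ p) * \sum_(j < 2 ^ p) k (a + j%:R * ((b - a) / 2 ^+ p)).

Lemma riemann_split p k a b : riemann p.+1 k a b =
  riemann p k a ((a + b) / 2) + riemann p k ((a + b) / 2) b.
Proof.
have p0 : (2 ^+ p : R) != 0 by rewrite expf_neq0 ?pnatr_eq0.
have E1 : (b - a) / 2 ^+ p.+1 = ((a + b) / 2 - a) / 2 ^+ p :> R.
  by rewrite exprS; field.
have E2 : (b - a) / 2 ^+ p.+1 = (b - (a + b) / 2) / 2 ^+ p :> R.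
  by rewrite exprS; field.
rewrite /riemann -E1 -E2 expnS mul2n -addnn big_split_ord /= mulrDr.
congr (_ + toC _ * _); apply: eq_bigr => j _; congr k.
by rewrite E2 natrD natrX; field.
Qed.

Lemma sample_itv (p j : nat) (a b : R) : a <= b -> (j < 2 ^ p)%N ->
  a <= a + j%:R * ((b - a) / 2 ^+ p) <= b.
Proof.
move=> ab jp; have p0 : 0 < 2 ^+ p :> R by rewrite exprn_gt0.
have hw : (b - a) / 2 ^+ p * 2 ^+ p = b - a by rewrite divfK// gt_eqF.
have w0 : 0 <= (b - a) / 2 ^+ p by rewrite divr_ge0 ?subr_ge0// ltW.
have j1 : (j%:R : R) <= 2 ^+ p by rewrite -natrX ler_nat ltnW.
have := ler_wpM2r w0 j1; have : 0 <= j%:R * ((b - a) / 2 ^+ p) by rewrite mulr_ge0.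
by move: hw; set w := _ / _; lra.
Qed.

Lemma eq_riemann p (k1 k2 : R -> C) a b : a <= b ->
  (forall t, a <= t <= b -> k1 t = k2 t) -> riemann p k1 a b = riemann p k2 a b.
Proof.
by move=> ab h; congr (_ * _); apply: eq_bigr => j _; apply: h; exact: sample_itv.
Qed.

Lemma riemann_le p (k : R -> C) a b M : a <= b ->
  (forall t, a <= t <= b -> nrm (k t) <= M) -> nrm (riemann p k a b) <= (b - a) * M.
Proof.
move=> ab h.
have p0 : 0 < 2 ^+ p :> R by rewrite exprn_gt0.
have w0 : 0 <= (b - a) / 2 ^+ p by rewrite divr_ge0 ?subr_ge0// ltW.
rewrite /riemann nrmM nrm_toC ger0_norm//.
apply: le_trans (_ : (b - a) / 2 ^+ p * (\sum_(j < 2 ^ p) M) <= _); last first.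
  by rewrite sumr_const card_ord -[M *+ _]mulr_natl natrX mulrA divfK// gt_eqF.
rewrite ler_wpM2l//; apply: le_trans (nrm_sum _) _.
by apply: ler_sum => j _; apply: h; exact: sample_itv.
Qed.

Lemma riemannB p k1 k2 a b : riemann p (fun t => k1 t - k2 t) a b =
  riemann p k1 a b - riemann p k2 a b.
Proof. by rewrite /riemann -mulrBr -sumrB. Qed.

Lemma riemannZ p c k a b : riemann p (fun t => c * k t) a b = c * riemann p k a b.
Proof. by rewrite /riemann mulrCA -mulr_sumr. Qed.

Lemma riemann_cst p c a b : riemann p (fun=> c) a b = toC (b - a) * c.
Proof.
rewrite /riemann sumr_const card_ord -[c *+ _]mulr_natl mulrA -toCn -toCM natrX.
by rewrite divfK// gt_eqF// exprn_gt0.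
Qed.

Definition pt (x y : R) : C := toC x + iC R * toC y.

(** Approximates the counterclockwise contour integral around the rectangle $[a,b]\times[c,d]$;
    [iC R] is the factor of $dz$ on the vertical sides. *)
Definition loop_sum p (g : C -> C) a b c d : C :=
  riemann p (fun x => g (pt x c)) a b + iC R * riemann p (fun y => g (pt b y)) c d
  - riemann p (fun x => g (pt x d)) a b - iC R * riemann p (fun y => g (pt a y)) c d.

Lemma loop_sum_split p g a b c d : loop_sum p.+1 g a b c d =
  loop_sum p g a ((a + b) / 2) c ((c + d) / 2) +
  loop_sum p g ((a + b) / 2) b c ((c + d) / 2) +
  loop_sum p g a ((a + b) / 2) ((c + d) / 2) d +
  loop_sum p g ((a + b) / 2) b ((c + d) / 2) d.
Proof. by rewrite /loop_sum !riemann_split; ring. Qed.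

(** On opposite sides the integrands differ by a constant, and sums of constants are exact. The loop
    sum therefore vanishes for each [p], not only in the limit. *)
Lemma loop_sum_affine p al be a b c d : loop_sum p (fun z => al + be * z) a b c d = 0.
Proof.
have h1 : riemann p (fun x => al + be * pt x c) a b
    - riemann p (fun x => al + be * pt x d) a b = be * iC R * toC (c - d) * toC (b - a).
  rewrite -riemannB [RHS]mulrC -(riemann_cst p); congr riemann.
  by apply/funext => x; rewrite /pt toCB; ring.
have h2 : riemann p (fun x => al + be * pt b x) c d
    - riemann p (fun x => al + be * pt a x) c d = be * toC (b - a) * toC (d - c).
  rewrite -riemannB [RHS]mulrC -(riemann_cst p); congr riemann.
  by apply/funext => x; rewrite /pt toCB; ring.
have E (x1 x2 x3 x4 : C) : x1 + iC R * x2 - x3 - iC R * x4 =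
  (x1 - x3) + iC R * (x2 - x4) by ring.
by rewrite /loop_sum E h1 h2 !toCB; ring.
Qed.

Lemma loop_sum_le p g a b c d M : a <= b -> c <= d ->
  (forall x y, a <= x <= b -> c <= y <= d -> nrm (g (pt x y)) <= M) ->
  nrm (loop_sum p g a b c d) <= ((b - a) + (d - c)) * 2 * M.
Proof.
move=> ab cd h; rewrite /loop_sum.
have r1 t : a <= t <= b -> nrm (g (pt t c)) <= M by move=> ?; apply: h; rewrite // lexx.
have r2 t : a <= t <= b -> nrm (g (pt t d)) <= M by move=> ?; apply: h; rewrite // lexx andbT.
have r3 t : c <= t <= d -> nrm (g (pt b t)) <= M by move=> ?; apply: h; rewrite // lexx andbT.
have r4 t : c <= t <= d -> nrm (g (pt a t)) <= M by move=> ?; apply: h; rewrite // lexx.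
have {}r1 := riemann_le p ab r1; have {}r2 := riemann_le p ab r2.
have {}r3 := riemann_le p cd r3; have {}r4 := riemann_le p cd r4.
apply: le_trans (nrm_triangleB _ _) _; rewrite nrmM nrm_iC mul1r.
set u := (X in nrm X + _); suff : nrm u <= (b - a) * M + (d - c) * M + (b - a) * M by lra.
apply: le_trans (nrm_triangleB _ _) _; rewrite lerD//.
by apply: le_trans (nrm_triangle _ _) _; rewrite nrmM nrm_iC mul1r lerD.
Qed.

(** The bound is quadratic in the half-perimeter $S$ because quartering replaces $S$ by $S/2$, so
    four bounds $e(S/2)^2$ add up to $eS^2$. Locally it comes from the tangent map: the remainder is
    at most $(e/2)S$ on a contour of length $2S$. *)
Lemma goursat g a b c d : a <= b -> c <= d ->
  (forall x y, a <= x <= b -> c <= y <= d -> derivable g (pt x y) 1) ->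
  (fun p => loop_sum p g a b c d) @ \oo --> (0 : C).
Proof.
move=> ab cd dg; apply/cvg_nrmP => e0 e00.
(* The summand 1 keeps the denominator positive for a degenerate rectangle. *)
pose e := e0 / (1 + (b - a + (d - c)) ^+ 2).
have S0 : 0 < 1 + (b - a + (d - c)) ^+ 2 by rewrite ltr_pwDl ?sqr_ge0.
have e_gt0 : 0 < e by rewrite divr_gt0.
suff [N hN] : exists N : nat, forall p, (N <= p)%N ->
    nrm (loop_sum p g a b c d) <= e * (b - a + (d - c)) ^+ 2.
  exists N => p /hN h; rewrite subr0; apply: le_trans h _.
  rewrite /e mulrAC ler_pdivrMr// ler_wpM2l ?(ltW e00)// lerDr; exact: ler01.
apply: (@rect_ind R (fun a b c d => exists N : nat, forall p, (N <= p)%N ->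
    nrm (loop_sum p g a b c d) <= e * (b - a + (d - c)) ^+ 2)) => //.
  move=> a1 b1 c1 d1 _ _ [N1 h1] [N2 h2] [N3 h3] [N4 h4].
  (* The successor appears because a loop sum of level [p.+1] splits into four of level [p]. *)
  exists (maxn (maxn N1 N2) (maxn N3 N4)).+1 => -[//|p].
  rewrite ltnS !geq_max => /andP[/andP[/h1 {}h1 /h2 {}h2] /andP[/h3 {}h3 /h4 {}h4]].
  rewrite loop_sum_split.
  apply: le_trans (nrm_triangle _ _) _.
  apply: le_trans (lerD (nrm_triangle _ _) (lexx _)) _.
  apply: le_trans (lerD (lerD (nrm_triangle _ _) (lexx _)) (lexx _)) _.
  by apply: le_trans (lerD (lerD (lerD h1 h2) h3) h4) _; lra.
move=> x y hx hy.
have [l dl] : exists l, is_derive (pt x y) 1 g l.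
  by exists ('D_1 g (pt x y)); apply: derivableP; exact: dg.
have /is_derive_nrmP/(_ (e / 2)) := dl; rewrite divr_gt0// => -[]// dl0 dl00 hd.
exists (dl0 / 2); first by rewrite divr_gt0.
move=> a' b' c' d' _ _ _ _ hxa hya w1 w2; exists 0%N => p _.
have -> : loop_sum p g a' b' c' d' =
    loop_sum p (fun z => g z - ((g (pt x y) - l * pt x y) + l * z)) a' b' c' d'.
  have /eqP := loop_sum_affine p (g (pt x y) - l * pt x y) l a' b' c' d'.
  rewrite /loop_sum !riemannB => /eqP h.
  by rewrite -[LHS](subr0) -{}h; ring.
have ab' : a' <= b' by case/andP: hxa; exact: le_trans.
have cd' : c' <= d' by case/andP: hya; exact: le_trans.
apply: le_trans (@loop_sum_le _ _ _ _ _ _ (e / 2 * (b' - a' + (d' - c'))) _ _ _) _ => //;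
  last first.
  by rewrite expr2; lra.
move=> s t hs ht.
have n1 : nrm (pt s t - pt x y) <= b' - a' + (d' - c').
  have -> : pt s t - pt x y = toC (s - x) + iC R * toC (t - y).
    by rewrite /pt !toCB; ring.
  apply: le_trans (nrm_triangle _ _) _; rewrite nrmM nrm_iC mul1r !nrm_toC.
  by apply: lerD; rewrite ler_norml; lra.
have := hd (pt s t - pt x y).
rewrite (addrC (pt x y)) subrK => /(_ _).
have -> : g (pt s t) - g (pt x y) - l * (pt s t - pt x y) =
  g (pt s t) - (g (pt x y) - l * pt x y + l * pt s t) by ring.
move=> /(_ _)/le_trans; apply; first by lra.
by rewrite ler_wpM2l// ltW// divr_gt0.
Qed.

End Goursat.

(** * Circle means *)

Section ComplexExponential.
Variable R : realType.
Local Notation C := (Cx R).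

Lemma is_derive_realP (f : R -> R) (x l : R) : is_derive x 1 f l ->
  forall e : R, 0 < e -> exists2 d : R, 0 < d &
    forall h, `|h| < d -> `|f (x + h) - f x - l * h| <= e * `|h|.
Proof.
move=> df e e0.
have : h^-1 *: (f (h *: 1 + x) - f x) @[h --> (0:R)^'] --> l.
  by have [d <-] := df; exact: d.
move/cvgrPdist_le => /(_ _ e0)/nbhs_ballP[d /= d0 hd]; exists d => // h hh.
have [->|h0] := eqVneq h 0; first by rewrite addr0 subrr mulr0 subr0 normr0 mulr0.
have := hd h; rewrite /ball/= sub0r normrN => /(_ hh h0).
rewrite -(ler_pM2r (_ : 0 < `|h|)) ?normr_gt0// -normrM distrC; congr (Num.Def.normr _ <= _).
by rewrite /GRing.scale /= mulr1 (addrC h); field.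
Qed.

Lemma Re_le_nrm (z : C) : `|complex.Re z| <= nrm z.
Proof.
by case: z => x y; rewrite /nrm /= -sqrtr_sqr ler_wsqrtr// lerDl sqr_ge0.
Qed.

Lemma Im_le_nrm (z : C) : `|complex.Im z| <= nrm z.
Proof.
by case: z => x y; rewrite /nrm /= -sqrtr_sqr ler_wsqrtr// lerDr sqr_ge0.
Qed.

Lemma complex_pt (z : C) : z = pt (complex.Re z) (complex.Im z).
Proof. exact: complexE. Qed.

Lemma Re_pt (x y : R) : complex.Re (pt x y) = x.
Proof. by rewrite /pt /toC /iC /=; rewrite !mul0r mul1r subr0 addr0. Qed.

Lemma Im_pt (x y : R) : complex.Im (pt x y) = y.
Proof. by rewrite /pt /toC /iC /=; rewrite mul0r mul1r !add0r. Qed.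

Lemma nrm_pt_le (x y : R) : nrm (pt x y) <= `|x| + `|y|.
Proof.
by apply: le_trans (nrm_triangle _ _) _; rewrite nrmM nrm_iC mul1r !nrm_toC.
Qed.

Lemma ptB (x y x' y' : R) : pt x y - pt x' y' = pt (x - x') (y - y').
Proof. by rewrite /pt !toCB; ring. Qed.

Definition cexp (z : C) : C :=
  toC (expR (complex.Re z)) * pt (cos (complex.Im z)) (sin (complex.Im z)).

Lemma cexp_ptE (x y : R) : cexp (pt x y) = toC (expR x) * pt (cos y) (sin y).
Proof. by rewrite /cexp Re_pt Im_pt. Qed.

Lemma nrm_pt_cos_sin (y : R) : nrm (pt (cos y) (sin y)) = 1.
Proof.
have -> : nrm (pt (cos y) (sin y)) = Num.sqrt
    (complex.Re (pt (cos y) (sin y)) ^+ 2 + complex.Im (pt (cos y) (sin y)) ^+ 2).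
  by case: (pt _ _).
by rewrite Re_pt Im_pt cos2Dsin2 sqrtr1.
Qed.

Lemma nrm_cexp_pt (x y : R) : nrm (cexp (pt x y)) = expR x.
Proof.
by rewrite cexp_ptE nrmM nrm_pt_cos_sin mulr1 nrm_toC ger0_norm ?expR_ge0.
Qed.

Lemma cexpD (z w : C) : cexp (z + w) = cexp z * cexp w.
Proof.
rewrite (complex_pt z) (complex_pt w).
move: (complex.Re z) (complex.Im z) (complex.Re w) (complex.Im w) => a b c d.
have -> : pt a b + pt c d = pt (a + c) (b + d) by rewrite /pt !toCD; ring.
rewrite !cexp_ptE expRD cosD sinD /pt !toCD toCN !toCM.
have i2 := @iC2 R.
transitivity (toC (expR a) * toC (expR c) * (toC (cos b) * toC (cos d) +
  iC R * iC R * (toC (sin b) * toC (sin d)) +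
  iC R * (toC (sin b) * toC (cos d) + toC (cos b) * toC (sin d)))).
  by rewrite i2; ring.
by ring.
Qed.

(** The functional equation reduces the claim to the point 0, where the first-order expansions of
    the real exponential, cosine and sine are combined. *)
Lemma is_derive_cexp (z : C) : is_derive z 1 cexp (cexp z).
Proof.
apply/is_derive_nrmP => e0 e00.
set N := nrm (cexp z).
have N0 : 0 <= N := nrm_ge0 _.
pose e := e0 / (1 + N).
have e_gt0 : 0 < e by rewrite divr_gt0 ?ltr_pwDl.
suff [d d0 hd] : exists2 d, 0 < d & forall h, nrm h < d -> nrm (cexp h - 1 - h) <= e * nrm h.
  exists d => // h /hd hh.
  have -> : cexp (z + h) - cexp z - cexp z * h = cexp z * (cexp h - 1 - h).
    by rewrite cexpD; ring.
  rewrite nrmM; apply: le_trans (ler_wpM2l N0 hh) _.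
  rewrite mulrA ler_wpM2r ?nrm_ge0// /e mulrCA ger_pMr// ler_pdivrMr ?ltr_pwDl//.
  by rewrite mul1r lerDr.
(* The three error terms below add up to at most [5 * m * nrm h]; [m <= 8^-1] makes the factor
   [2 * m * |t| + |t|] at most [2 * nrm h]. *)
pose m := Num.min e 1 / 8.
have mine : Num.min e 1 <= e by rewrite ge_min lexx.
have min1 : Num.min e 1 <= 1 by rewrite ge_min lexx orbT.
have m1 : m <= e / 8 by rewrite /m; lra.
have m2 : m <= 8^-1 by rewrite /m; lra.
have m0 : 0 < m by rewrite divr_gt0// lt_min e_gt0 ltr01.
have [d1 d10 h1] := is_derive_realP (is_derive_expR 0) m0.
have [d2 d20 h2] := is_derive_realP (is_derive_cos 0) m0.
have [d3 d30 h3] := is_derive_realP (is_derive_sin 0) m0.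
exists (Num.min (Num.min d1 d2) (Num.min d3 m)).
  by rewrite !lt_min d10 d20 d30 m0.
move=> h; rewrite !lt_min => /andP[/andP[n1 n2] /andP[n3 n4]].
have rs := Re_le_nrm h; have it := Im_le_nrm h.
rewrite [in X in nrm X](complex_pt h).
move: (complex.Re h) (complex.Im h) rs it => s t rs it.
have := h1 s (le_lt_trans rs n1); rewrite !add0r expR0 mul1r => {}h1.
have := h2 t (le_lt_trans it n2); rewrite !add0r cos0 sin0 oppr0 mul0r subr0 => {}h2.
have := h3 t (le_lt_trans it n3); rewrite !add0r cos0 sin0 subr0 mul1r => {}h3.
have u1 : nrm (pt (cos t - 1) (sin t - t)) <= 2 * m * `|t|.
  by apply: le_trans (nrm_pt_le _ _) _; lra.
have u2 : nrm (pt (cos t - 1) (sin t)) <= 2 * m * `|t| + `|t|.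
  have -> : pt (cos t - 1) (sin t) = pt (cos t - 1) (sin t - t) + pt 0 t.
    by rewrite /pt !toCB toC0; ring.
  apply: le_trans (nrm_triangle _ _) _; rewrite lerD//.
  by apply: le_trans (nrm_pt_le _ _) _; rewrite normr0 add0r.
have -> : cexp (pt s t) - 1 - pt s t =
  toC (expR s - 1 - s) * pt (cos t) (sin t) + toC s * pt (cos t - 1) (sin t)
   + pt (cos t - 1) (sin t - t).
  by rewrite cexp_ptE /pt !toCB !toC1; ring.
apply: le_trans (nrm_triangle _ _) _.
apply: le_trans (lerD (nrm_triangle _ _) (lexx _)) _.
rewrite !nrmM nrm_pt_cos_sin mulr1 !nrm_toC.
have s0 := normr_ge0 s; have t0 := normr_ge0 t.
have sm : `|s| <= m by apply: le_trans rs (ltW n4).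
have p1 : `|s| * nrm (pt (cos t - 1) (sin t)) <= m * (2 * nrm h).
  apply: ler_pM => //; first exact: nrm_ge0.
  apply: le_trans u2 _; have : m * `|t| <= 8^-1 * `|t| by rewrite ler_wpM2r.
  lra.
have p2 : m * `|s| <= m * nrm h by rewrite ler_wpM2l// ltW.
have p3 : m * `|t| <= m * nrm h by rewrite ler_wpM2l// ltW.
have p5 : 0 <= e * nrm h by rewrite mulr_ge0 ?nrm_ge0// ltW.
have p4 : m * nrm h <= e / 8 * nrm h by rewrite ler_wpM2r ?nrm_ge0.
lra.
Qed.

End ComplexExponential.

Section CircleMeans.
Variable R : realType.
Local Notation C := (Cx R).
Implicit Types F G : C -> C.

Lemma derivable_cont (f : C -> C) (z : C) : derivable f z 1 -> f x @[x --> z] --> f z.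
Proof. by move/derivable1_diffP/differentiable_continuous. Qed.

Lemma derivable_comp (f g : C -> C) (z : C) :
  derivable f z 1 -> derivable g (f z) 1 -> derivable (g \o f) z 1.
Proof.
move=> /derivable1_diffP df /derivable1_diffP dg.
by have /derivable1_diffP := @differentiable_comp C C C C f g z df dg.
Qed.

(** Completeness is inherited from [R] through real and imaginary parts. *)
Lemma nrm_cauchy_cvg (f : nat -> C) :
  (forall e : R, 0 < e -> exists N, forall p q : nat, (N <= p)%N -> (N <= q)%N ->
     nrm (f p - f q) <= e) -> exists l : C, f @ \oo --> l.
Proof.
move=> hf.
have key (g : C -> R) : (forall z w, `|g z - g w| <= nrm (z - w)) ->
    exists l : R, (fun n => g (f n)) @ \oo --> l.
  move=> hg; apply/cvg_ex; apply: cauchy_cvg; apply: cauchy_exP => e e0.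
  have [|N hN] := hf (e / 2); first by rewrite divr_gt0.
  exists (g (f N)); exists N => // n /= Nn.
  rewrite /ball /=; apply: le_lt_trans (hg _ _) _.
  by apply: le_lt_trans (hN _ _ (leqnn N) Nn) _; rewrite ltr_pdivrMr// ltr_pMr// ltr1n.
have reB (z w : C) : `|complex.Re z - complex.Re w| <= nrm (z - w).
  by apply: le_trans (Re_le_nrm _); case: z; case: w.
have imB (z w : C) : `|complex.Im z - complex.Im w| <= nrm (z - w).
  by apply: le_trans (Im_le_nrm _); case: z; case: w.
have [a ha] := key _ reB; have [b hb] := key _ imB.
exists (pt a b); apply/cvg_nrmP => e e0.
have e2 : 0 < e / 2 by rewrite divr_gt0.
have /cvgrPdist_le/(_ _ e2)[N1 _ h1] := ha.
have /cvgrPdist_le/(_ _ e2)[N2 _ h2] := hb.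
exists (maxn N1 N2) => n; rewrite geq_max => /andP[n1 n2].
rewrite [f n]complex_pt ptB; apply: le_trans (nrm_pt_le _ _) _.
have /= := h1 n n1; have /= := h2 n n2.
rewrite ![`|_ - complex.Re _|]distrC ![`|_ - complex.Im _|]distrC.
by lra.
Qed.

Definition twopi : R := pi *+ 2.

Lemma twopi_gt0 : 0 < twopi. Proof. by rewrite mulrn_wgt0// pi_gt0. Qed.

(** Approximates $\frac1{2\pi i}\oint F(z)\,dz/z$ over the circle of radius $e^s$. With the
    logarithm of the radius as parameter, an annulus is the image of a rectangle under [cexp], and
    [goursat] applies to the composite of [F] and [cexp]. *)
Definition circle_mean p (F : C -> C) (s : R) : C :=
  toC twopi^-1 * riemann p (fun t => F (cexp (pt s t))) 0 twopi.

Lemma circle_mean_le p F s M : (forall z, nrm z = expR s -> nrm (F z) <= M) ->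
  nrm (circle_mean p F s) <= M.
Proof.
move=> h; rewrite /circle_mean nrmM nrm_toC gtr0_norm ?invr_gt0 ?twopi_gt0//.
rewrite mulrC ler_pdivrMr ?twopi_gt0// mulrC -[X in _ <= X * _]subr0.
apply: riemann_le => [|t _]; first exact: ltW twopi_gt0.
by apply: h; rewrite nrm_cexp_pt.
Qed.

Lemma eq_circle_mean p F G s : (forall z, nrm z = expR s -> F z = G z) ->
  circle_mean p F s = circle_mean p G s.
Proof.
move=> h; congr (_ * _); apply: eq_riemann => [|t _]; first exact: ltW twopi_gt0.
by apply: h; rewrite nrm_cexp_pt.
Qed.

Lemma circle_meanB p F G s : circle_mean p (fun z => F z - G z) s =
  circle_mean p F s - circle_mean p G s.
Proof. by rewrite /circle_mean riemannB mulrBr. Qed.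

Lemma circle_meanZ p c F s : circle_mean p (fun z => c * F z) s =
  c * circle_mean p F s.
Proof. by rewrite /circle_mean riemannZ mulrCA. Qed.

Lemma circle_mean_cst p c s : circle_mean p (fun=> c) s = c.
Proof.
rewrite /circle_mean riemann_cst subr0 mulrA -toCM mulVf ?toC1 ?mul1r//.
by rewrite gt_eqF// twopi_gt0.
Qed.

Lemma circle_mean_goursat F s1 s2 : s1 <= s2 ->
  (forall z, expR s1 <= nrm z <= expR s2 -> derivable F z 1) ->
  (fun p => circle_mean p F s2 - circle_mean p F s1) @ \oo --> (0 : C).
Proof.
move=> s12 dF.
have dg x y : s1 <= x <= s2 -> 0 <= y <= twopi ->
    derivable (fun z : C => F (cexp z)) (pt x y) 1.
  move=> /andP[h1 h2] _; apply: (@derivable_comp (@cexp R) F).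
    by have [] := is_derive_cexp (pt x y).
  by apply: dF; rewrite nrm_cexp_pt !ler_expR h1.
have -> : (fun p => circle_mean p F s2 - circle_mean p F s1) = (fun p =>
    (- iC R * toC twopi^-1) * loop_sum p (fun z => F (cexp z)) s1 s2 0 twopi).
  apply/funext => p; rewrite /loop_sum /circle_mean.
  (* By periodicity the two horizontal sides carry identical sums, which cancel; only the two
     circles are left. *)
  have -> : (fun x => F (cexp (pt x twopi))) = (fun x => F (cexp (pt x 0))).
    apply/funext => x; rewrite !cexp_ptE.
    by rewrite /twopi cos2pi sin2pi cos0 sin0.
  set A := riemann _ _ s1 s2; set B := riemann _ _ _ _; set D := riemann _ _ _ _.
  move: (toC _) A B D => T A B D.
  transitivity (- (iC R * iC R) * T * (B - D)); last by ring.
  by rewrite iC2; ring.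
rewrite -(mulr0 (- iC R * toC twopi^-1)).
apply: cvgM; first exact: cvg_cst.
exact: (goursat s12 (ltW twopi_gt0) dg).
Qed.

(** The estimate is uniform in [p], so it can be combined with limits in [p]. *)
Lemma circle_mean_near F s : (forall z, nrm z = expR s -> F x @[x --> z] --> F z) ->
  forall e : R, 0 < e -> exists2 d : R, 0 < d & forall s', `|s' - s| <= d ->
  forall p, nrm (circle_mean p F s' - circle_mean p F s) <= e.
Proof.
move=> cF e e0.
have dexp z : (cexp x : C) @[x --> z] --> (cexp z : C).
  by apply: derivable_cont; have [] := is_derive_cexp z.
suff : exists2 d : R, 0 < d & forall s', `|s' - s| <= d -> forall t, 0 <= t <= twopi ->
    nrm (F (cexp (pt s' t)) - F (cexp (pt s t))) <= e.
  move=> [d d0 hd]; exists d => // s' /hd h p.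
  rewrite /circle_mean -mulrBr -riemannB nrmM nrm_toC gtr0_norm ?invr_gt0 ?twopi_gt0//.
  rewrite mulrC ler_pdivrMr ?twopi_gt0// mulrC -[X in _ <= X * _]subr0.
  by apply: riemann_le => //; exact: ltW twopi_gt0.
(* The rectangle induction with a degenerate first side is compactness of the interval of angles. *)
apply: (@rect_ind R (fun _ _ c d => exists2 dl : R, 0 < dl & forall s', `|s' - s| <= dl ->
  forall t, c <= t <= d -> nrm (F (cexp (pt s' t)) - F (cexp (pt s t))) <= e)
  _ 0 0 0 twopi) => //.
- move=> a b c d _ cd [d1 d10 h1] _ [d2 d20 h2] _.
  exists (Num.min d1 d2); first by rewrite lt_min d10.
  move=> s'; rewrite le_min => /andP[/h1 {}h1 /h2 {}h2] t /andP[t1 t2].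
  have [tm|tm] := leP t ((c + d) / 2); first by apply: h1; rewrite t1.
  by apply: h2; rewrite t2 ltW.
- exact: ltW twopi_gt0.
move=> x0 y _ _.
have cg : F (cexp x) @[x --> pt s y] --> F (cexp (pt s y)).
  by apply: cvg_comp (dexp _) _; apply: cF; rewrite nrm_cexp_pt.
have e2 : 0 < e / 2 by rewrite divr_gt0.
have [d d0 hd] := (continuous_nrmP (fun x => F (cexp x)) (pt s y)).1 cg _ e2.
exists (d / 2); first by rewrite divr_gt0.
move=> _ _ c' d' _ _ _ _ _ hy _ w; exists (d / 4); first by rewrite divr_gt0.
move=> s' hs' t ht.
have ty : `|t - y| < d / 2 by rewrite ltr_norml; lra.
have h1 : nrm (F (cexp (pt s' t)) - F (cexp (pt s y))) <= e / 2.
  apply: hd; rewrite ptB; apply: le_lt_trans (nrm_pt_le _ _) _; lra.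
have h2 : nrm (F (cexp (pt s t)) - F (cexp (pt s y))) <= e / 2.
  apply: hd; rewrite ptB subrr; apply: le_lt_trans (nrm_pt_le _ _) _.
  by rewrite normr0; lra.
have -> : F (cexp (pt s' t)) - F (cexp (pt s t)) =
  (F (cexp (pt s' t)) - F (cexp (pt s y))) - (F (cexp (pt s t)) - F (cexp (pt s y))) by ring.
by apply: le_trans (nrm_triangleB _ _) _; lra.
Qed.

Lemma circle_mean_cvg F s : (forall z, nrm z = expR s -> F x @[x --> z] --> F z) ->
  exists l : C, (fun p => circle_mean p F s) @ \oo --> l.
Proof.
move=> cF.
pose k t := F (cexp (pt s t)).
suff [l hl] : exists l : C, (fun p => riemann p k 0 twopi) @ \oo --> l.
  by exists (toC twopi^-1 * l); apply: cvgM hl; exact: cvg_cst.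
apply: nrm_cauchy_cvg => e0 e00.
pose e := e0 / twopi.
have e_gt0 : 0 < e by rewrite divr_gt0 ?twopi_gt0.
have -> : e0 = e * (twopi - 0) by rewrite subr0 divfK// gt_eqF// twopi_gt0.
apply: (@rect_ind R (fun _ _ c d => exists N, forall p q : nat, (N <= p)%N -> (N <= q)%N ->
   nrm (riemann p k c d - riemann q k c d) <= e * (d - c)) _ 0 0 0 twopi) => //.
- move=> a b c d _ cd [N1 h1] _ [N2 h2] _; exists (maxn N1 N2).+1 => -[|p] -[|q]//.
  rewrite !ltnS !geq_max => /andP[p1 p2] /andP[q1 q2].
  rewrite !riemann_split opprD addrACA; apply: le_trans (nrm_triangle _ _) _.
  by have := h1 _ _ p1 q1; have := h2 _ _ p2 q2; lra.
- exact: ltW twopi_gt0.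
move=> x0 y _ _.
have ck : F (cexp x) @[x --> pt s y] --> F (cexp (pt s y)).
  apply: cvg_comp (_ : cexp x @[x --> pt s y] --> cexp (pt s y)) _.
    by apply: derivable_cont; have [] := is_derive_cexp (pt s y).
  by apply: cF; rewrite nrm_cexp_pt.
have e2 : 0 < e / 2 by rewrite divr_gt0.
have [d d0 hd] := (continuous_nrmP (fun x => F (cexp x)) (pt s y)).1 ck _ e2.
exists d => // _ _ c' d' _ _ _ _ _ hy _ w; exists 0%N => p q _ _.
have cd : c' <= d' by case/andP: hy; exact: le_trans.
(* On a short interval every level is compared with the sum of the constant [k y], which does not
   depend on the level. *)
have key n : nrm (riemann n k c' d' - riemann n (fun=> k y) c' d') <= (d' - c') * (e / 2).
  rewrite -riemannB; apply: riemann_le => // t ht; apply: hd.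
  rewrite ptB subrr; apply: le_lt_trans (nrm_pt_le _ _) _; rewrite normr0 add0r.
  by rewrite ltr_norml; lra.
have := key q; have := key p; rewrite !riemann_cst.
move: (toC _ * _) (riemann p k c' d') (riemann q k c' d') => z z1 z2 hz1 hz2.
have -> : z1 - z2 = (z1 - z) - (z2 - z) by ring.
by apply: le_trans (nrm_triangleB _ _) _; lra.
Qed.

(* One circle may be exceptional: continuity of the means in the radius crosses it. *)
Lemma circle_mean_goursat_exc F s1 s2 s0 : s1 <= s2 ->
  (forall z, expR s1 <= nrm z <= expR s2 -> F x @[x --> z] --> F z) ->
  (forall z, expR s1 <= nrm z <= expR s2 -> nrm z != expR s0 -> derivable F z 1) ->
  (fun p => circle_mean p F s2 - circle_mean p F s1) @ \oo --> (0 : C).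
Proof.
move=> s12 cF dF.
have [s01|s10] := ltP s0 s1.
  apply: (circle_mean_goursat s12) => z hz; apply: (dF z hz).
  rewrite gt_eqF//; case/andP: hz => hz _; apply: lt_le_trans hz.
  by rewrite ltr_expR.
have [s20|s02] := ltP s2 s0.
  apply: (circle_mean_goursat s12) => z hz; apply: (dF z hz).
  rewrite lt_eqF//; case/andP: hz => _ hz; apply: le_lt_trans hz _.
  by rewrite ltr_expR.
have c0 z : nrm z = expR s0 -> F x @[x --> z] --> F z.
  by move=> hz; apply: cF; rewrite hz !ler_expR s10.
have near0 := circle_mean_near c0.
apply/cvg_nrmP => e e0.
have e4 : 0 < e / 4 by rewrite divr_gt0.
have [d d0 hd] := near0 _ e4.
have right : exists N, forall p, (N <= p)%N ->
    nrm (circle_mean p F s2 - circle_mean p F s0) <= e / 2.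
  have [s20|s20] := eqVneq s2 s0.
    by exists 0%N => p _; rewrite s20 subrr nrm0 divr_ge0// ltW.
  have {}s20 : s0 < s2 by rewrite lt_def s20.
  pose s := Num.min s2 (s0 + d).
  have ss2 : s <= s2 by rewrite ge_min lexx.
  have s0s : s0 < s by rewrite lt_min s20 ltrDl.
  have sd : `|s - s0| <= d.
    by rewrite ger0_norm ?subr_ge0 ?(ltW s0s)// lerBlDl ge_min lexx orbT.
  have /cvg_nrmP/(_ _ e4)[N hN] :
      (fun p => circle_mean p F s2 - circle_mean p F s) @ \oo --> (0 : C).
    apply: (circle_mean_goursat ss2) => z hz.
    case/andP: hz => h1 h2; apply: dF.
      by rewrite h2 andbT; apply: le_trans h1; rewrite ler_expR ltW// (le_lt_trans s10).
    by rewrite gt_eqF//; apply: lt_le_trans h1; rewrite ltr_expR.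
  exists N => p /hN; have := hd _ sd p; rewrite subr0.
  move: (circle_mean p F s2) (circle_mean p F s) (circle_mean p F s0) => x y z h1 h2.
  have -> : x - z = (x - y) + (y - z) by ring.
  by apply: le_trans (nrm_triangle _ _) _; lra.
have left : exists N, forall p, (N <= p)%N ->
    nrm (circle_mean p F s0 - circle_mean p F s1) <= e / 2.
  have [s1e|s1e] := eqVneq s1 s0.
    by exists 0%N => p _; rewrite s1e subrr nrm0 divr_ge0// ltW.
  have {}s1e : s1 < s0 by rewrite lt_neqAle s1e.
  pose s := Num.max s1 (s0 - d).
  have ss2 : s1 <= s by rewrite le_max lexx.
  have s0s : s < s0 by rewrite gt_max s1e ltrBlDr ltrDl.
  have sd : `|s - s0| <= d.
    by rewrite distrC ger0_norm ?subr_ge0 ?(ltW s0s)// lerBlDr -lerBlDl le_max lexx orbT.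
  have /cvg_nrmP/(_ _ e4)[N hN] :
      (fun p => circle_mean p F s - circle_mean p F s1) @ \oo --> (0 : C).
    apply: (circle_mean_goursat ss2) => z hz.
    case/andP: hz => h1 h2; apply: dF.
      by rewrite h1; apply: le_trans h2 _; rewrite ler_expR ltW// (lt_le_trans s0s).
    by rewrite lt_eqF//; apply: le_lt_trans h2 _; rewrite ltr_expR.
  exists N => p /hN; have := hd _ sd p; rewrite subr0.
  move: (circle_mean p F s0) (circle_mean p F s) (circle_mean p F s1) => x y z h1 h2.
  have -> : x - z = (y - z) - (y - x) by ring.
  by apply: le_trans (nrm_triangleB _ _) _; lra.
case: right => N1 h1; case: left => N2 h2; exists (maxn N1 N2) => p.
rewrite geq_max => /andP[/h1 {}h1 /h2 {}h2]; rewrite subr0.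
move: (circle_mean p F s2) (circle_mean p F s1) (circle_mean p F s0) h1 h2 => x y z h1 h2.
have -> : x - y = (x - z) + (z - y) by ring.
by apply: le_trans (nrm_triangle _ _) _; lra.
Qed.

End CircleMeans.

(** * Differentiation rules in pointwise form *)

Section Calculus.
Variable R : realType.
Local Notation C := (Cx R).
Implicit Types (f g : C -> C) (z w l df dg : C).

Lemma is_derive_add f g z df dg : is_derive z 1 f df -> is_derive z 1 g dg ->
  is_derive z 1 (fun x => f x + g x) (df + dg).
Proof. by move=> hf hg; have := is_deriveD hf hg. Qed.

Lemma is_derive_sub f g z df dg : is_derive z 1 f df -> is_derive z 1 g dg ->
  is_derive z 1 (fun x => f x - g x) (df - dg).
Proof. by move=> hf hg; have := is_deriveB hf hg. Qed.

Lemma is_derive_mul f g z df dg : is_derive z 1 f df -> is_derive z 1 g dg ->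
  is_derive z 1 (fun x => f x * g x) (f z * dg + g z * df).
Proof. by move=> hf hg; have := is_deriveM hf hg. Qed.

Lemma is_derive_cst_fun l z : is_derive z 1 (fun=> l) 0.
Proof. exact: is_derive_cst. Qed.

Lemma is_derive_idfun z : is_derive z 1 (fun x : C => x) 1.
Proof. exact: is_derive_id. Qed.

Lemma is_derive_inv f z df : f z != 0 -> is_derive z 1 f df ->
  is_derive z 1 (fun x => (f x)^-1) (- (f z) ^- 2 * df).
Proof.
move=> fz [h <-]; split; first exact: (derivableV fz h).
by rewrite (deriveV fz h).
Qed.

Lemma derivable_is f z : derivable f z 1 -> is_derive z 1 f (derive1 f z).
Proof. by move=> h; rewrite derive1E; exact: derivableP. Qed.

Lemma is_derivable f z l : is_derive z 1 f l -> derivable f z 1.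
Proof. by case. Qed.

Lemma is_derive1E f z l : is_derive z 1 f l -> derive1 f z = l.
Proof. by case=> _ <-; rewrite derive1E. Qed.

Lemma derivable_sub f g z : derivable f z 1 -> derivable g z 1 ->
  derivable (fun x => f x - g x) z 1.
Proof.
by move=> /derivable_is hf /derivable_is hg; exact: is_derivable (is_derive_sub hf hg).
Qed.

Lemma derivable_add f g z : derivable f z 1 -> derivable g z 1 ->
  derivable (fun x => f x + g x) z 1.
Proof.
by move=> /derivable_is hf /derivable_is hg; exact: is_derivable (is_derive_add hf hg).
Qed.

Lemma derivable_mul f g z : derivable f z 1 -> derivable g z 1 ->
  derivable (fun x => f x * g x) z 1.
Proof.
by move=> /derivable_is hf /derivable_is hg; exact: is_derivable (is_derive_mul hf hg).
Qed.

Lemma derivable_div f g z : g z != 0 -> derivable f z 1 -> derivable g z 1 ->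
  derivable (fun x => f x / g x) z 1.
Proof.
move=> g0 hf /derivable_is hg.
exact: (derivable_mul hf (is_derivable (is_derive_inv g0 hg))).
Qed.

Lemma derivable_cstf l z : derivable (fun=> l) z 1.
Proof. exact: is_derivable (is_derive_cst_fun l z). Qed.

Lemma derivable_idf z : derivable (fun x : C => x) z 1.
Proof. exact: is_derivable (is_derive_idfun z). Qed.

Lemma derivable_exp n z : derivable (fun x : C => x ^+ n) z 1.
Proof.
elim: n => [|n IH]; first exact: derivable_cstf.
under eq_fun do rewrite exprS.
exact: (derivable_mul (@derivable_idf z) IH).
Qed.

Lemma derivable_sub_id w z : derivable (fun x : C => x - w) z 1.
Proof. exact: (derivable_sub (@derivable_idf z) (@derivable_cstf w z)). Qed.

Lemma derivable_local f g z (d : R) : 0 < d ->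
  (forall x, nrm (x - z) < d -> f x = g x) -> derivable f z 1 -> derivable g z 1.
Proof.
move=> d0 h; apply: near_eq_derivable.
by apply/nbhs_nrmP; exists d.
Qed.

Lemma derive1_local f g z (d : R) : 0 < d ->
  (forall x, nrm (x - z) < d -> f x = g x) -> derive1 f z = derive1 g z.
Proof.
move=> d0 h; rewrite !derive1E; apply: near_eq_derive.
by apply/nbhs_nrmP; exists d.
Qed.

Lemma cont_mul f g z : f x @[x --> z] --> f z -> g x @[x --> z] --> g z ->
  f x * g x @[x --> z] --> f z * g z.
Proof. by move=> hf hg; exact: (cvgM hf hg). Qed.

Lemma nrm_sub_le (x y : C) : `|nrm x - nrm y| <= nrm (x - y).
Proof.
rewrite ler_norml; have := nrm_triangle (x - y) y; have := nrm_triangle (y - x) x.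
by rewrite !subrK (nrm_distC y); lra.
Qed.

Lemma nrm_subr_ge (x y : C) : nrm x - nrm y <= nrm (x - y).
Proof. by have := nrm_sub_le x y; rewrite ler_norml => /andP[_]. Qed.

End Calculus.

(** * Cauchy's formula *)

Section CauchyFormula.
Variable R : realType.
Local Notation C := (Cx R).
Implicit Types (F G : C -> C) (z w l : C) (s : R).

Lemma cauchy_kernel_derivable w z k : z != w -> derivable (fun z : C => z / (z - w) ^+ k) z 1.
Proof.
move=> zw; apply: derivable_div.
- by rewrite expf_neq0// subr_eq0.
- exact: (@derivable_idf R z).
- exact: (derivable_comp (@derivable_sub_id R w z) (@derivable_exp R k (z - w))).
Qed.

(** The circle can be pushed outwards without changing the limit, to a radius at which [z / (z - w)]
    is uniformly close to 1. *)
Lemma cauchy_kernel_out w s : nrm w < expR s ->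
  (fun p => circle_mean p (fun z => z / (z - w)) s) @ \oo --> (1 : C).
Proof.
move=> ws; apply/cvg_nrmP => e e0.
have e2 : 0 < e / 2 by rewrite divr_gt0.
have w0 := nrm_ge0 w.
(* As [s + |s| >= 0], this exceeds both [s] and the size that makes $|w|/(|z|-|w|)$ at most
   $e/2$. *)
pose S := s + (nrm w + nrm w / (e / 2)) + `|s|.
have wd : 0 <= nrm w / (e / 2) by rewrite divr_ge0// ltW.
have sS : s <= S by rewrite /S; have := normr_ge0 s; lra.
have S1 : 1 + (nrm w + nrm w / (e / 2)) <= expR S.
  apply: le_trans (expR_ge1Dx _); rewrite lerD2l /S.
  by have := ler_norm (- s); rewrite normrN; lra.
have hN : (fun p => circle_mean p (fun z => z / (z - w)) S -
    circle_mean p (fun z => z / (z - w)) s) @ \oo --> (0 : C).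
  apply: (circle_mean_goursat sS) => z /andP[hz _].
  apply: (@cauchy_kernel_derivable w z 1); apply: contraTneq ws => <-.
  by rewrite -leNgt.
have {hN}/cvg_nrmP/(_ _ e2)[N hN] := hN; exists N => p /hN; rewrite subr0.
have : nrm (circle_mean p (fun z => z / (z - w)) S - 1) <= e / 2.
  rewrite -(circle_mean_cst p 1 S) -circle_meanB.
  apply: circle_mean_le => z zS.
  have wz : 0 < nrm z - nrm w by rewrite zS; lra.
  have wz' := nrm_subr_ge z w.
  have zw : z - w != 0 by rewrite -nrm_gt0; lra.
  have -> : z / (z - w) - 1 = w / (z - w) by field.
  rewrite nrmM nrmV ler_pdivrMr; last by lra.
  have : nrm w = (e / 2) * (nrm w / (e / 2)) by rewrite mulrC divfK// gt_eqF.
  move=> ->; rewrite ler_wpM2l ?(ltW e2)//; lra.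
move: (circle_mean _ _ S) (circle_mean _ _ s) => x y h1 h2.
have -> : y - 1 = (x - 1) - (x - y) by ring.
by apply: le_trans (nrm_triangleB _ _) _; lra.
Qed.

(** Here the circle is shrunk towards 0, where the kernel [z / (z - w)] is small. *)
Lemma cauchy_kernel_in w s : expR s < nrm w ->
  (fun p => circle_mean p (fun z => z / (z - w)) s) @ \oo --> (0 : C).
Proof.
move=> ws; apply/cvg_nrmP => e e0.
have e2 : 0 < e / 2 by rewrite divr_gt0.
have w0 : 0 < nrm w by apply: lt_trans ws; exact: expR_gt0.
have e20 : 0 < 1 + e / 2 by lra.
(* The radius at which $\eta/(|w|-\eta)$ equals $e/2$. *)
pose eta := nrm w * (e / 2) / (1 + e / 2).
have eta0 : 0 < eta by rewrite /eta divr_gt0 // mulr_gt0.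
have etaE : eta * (1 + e / 2) = nrm w * (e / 2) by rewrite /eta divfK// gt_eqF.
pose S := Num.min s (ln eta).
have sS : S <= s by rewrite ge_min lexx.
have S1 : expR S <= eta.
  by rewrite -[leRHS]lnK ?posrE// ler_expR ge_min lexx orbT.
have hN : (fun p => circle_mean p (fun z => z / (z - w)) s -
    circle_mean p (fun z => z / (z - w)) S) @ \oo --> (0 : C).
  apply: (circle_mean_goursat sS) => z /andP[_ hz].
  apply: (@cauchy_kernel_derivable w z 1); apply: contraTneq ws => <-.
  by rewrite -leNgt.
have {hN}/cvg_nrmP/(_ _ e2)[N hN] := hN; exists N => p /hN; rewrite !subr0.
have : nrm (circle_mean p (fun z => z / (z - w)) S) <= e / 2.
  apply: circle_mean_le => z zS.
  have Sw : expR S < nrm w by apply: le_lt_trans ws; rewrite ler_expR.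
  have wz' := nrm_subr_ge w z.
  rewrite nrmM nrmV nrm_distC zS ler_pdivrMr; last by rewrite zS in wz'; lra.
  apply: le_trans (_ : e / 2 * (nrm w - expR S) <= _); last first.
    by rewrite ler_wpM2l ?(ltW e2)// -zS.
  have : e / 2 * expR S <= e / 2 * eta by rewrite ler_wpM2l ?(ltW e2).
  lra.
move: (circle_mean _ _ S) (circle_mean _ _ s) => x y h1 h2.
have -> : y = (y - x) + x by ring.
by apply: le_trans (nrm_triangle _ _) _; lra.
Qed.

Lemma cvg_affine (a b c : nat -> C) (x : C) : a @ \oo --> (0 : C) ->
  b @ \oo --> (1 : C) -> c @ \oo --> (0 : C) ->
  (fun p => a p + x * (b p - c p)) @ \oo --> x.
Proof.
move=> ha hb hc; have xE : 0 + x * (1 - 0) = x by ring.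
have h1 : (fun p => b p - c p) @ \oo --> (1 - 0 : C) by exact: (cvgB hb hc).
have h2 : (fun p => x * (b p - c p)) @ \oo --> (x * (1 - 0) : C).
  by apply: cvgM h1; exact: cvg_cst.
have h3 : (fun p => a p + x * (b p - c p)) @ \oo --> (0 + x * (1 - 0) : C).
  exact: (cvgD ha h2).
by rewrite xE in h3.
Qed.

(** The function $H(z)=z(F(z)-F(w))/(z-w)$, completed by $wF'(w)$, is continuous at [w] and
    differentiable elsewhere, so its means on both circles agree in the limit, the circle through
    [w] being the exceptional one. Expanding $H$ leaves $F(w)$ times the difference of the two
    kernel means, which tends to 1. *)
Lemma cauchy_formula F s1 s2 w : expR s1 < nrm w < expR s2 ->
  (forall z, expR s1 <= nrm z <= expR s2 -> derivable F z 1) ->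
  (fun p => circle_mean p (fun z => z / (z - w) * F z) s2 -
            circle_mean p (fun z => z / (z - w) * F z) s1) @ \oo --> F w.
Proof.
move=> /andP[w1 w2] dF.
have w0 : 0 < nrm w by apply: lt_trans w1; exact: expR_gt0.
have s12 : s1 <= s2 by rewrite -ler_expR ltW// (lt_trans w1).
have dw : derivable F w 1 by apply: dF; rewrite !ltW.
pose l := derive1 F w.
pose G z := if z == w then l else (F z - F w) / (z - w).
pose H z := z * G z.
have GE z : z != w -> G z = (F z - F w) / (z - w) by rewrite /G => /negbTE ->.
have dH z : expR s1 <= nrm z <= expR s2 -> z != w -> derivable H z 1.
  move=> hz zw; apply: (derivable_mul (@derivable_idf _ z)).
  apply: (@derivable_local _ (fun z => (F z - F w) / (z - w)) _ _ (nrm (z - w))).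
  - by rewrite nrm_gt0 subr_eq0.
  - move=> x hx; rewrite GE//; apply: contraTneq hx => ->.
    by rewrite nrm_distC ltxx.
  - apply: derivable_div; first by rewrite subr_eq0.
      exact: (derivable_sub (dF z hz) (@derivable_cstf _ (F w) z)).
    exact: (@derivable_sub_id R w z).
have cG : G x @[x --> w] --> G w.
  apply/continuous_nrmP => e e0.
  have [d d0 hd] := (is_derive_nrmP F w l).1 (derivable_is dw) _ e0.
  exists d => // z zd; have [->|zw] := eqVneq z w; first by rewrite subrr nrm0 ltW.
  have zw0 : 0 < nrm (z - w) by rewrite nrm_gt0 subr_eq0.
  rewrite GE// /G eqxx -(ler_pM2r zw0) -nrmM.
  have := hd _ zd; rewrite (addrC w) subrK; congr (_ <= _); congr nrm.
  by field; rewrite subr_eq0.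
have cH z : expR s1 <= nrm z <= expR s2 -> H x @[x --> z] --> H z.
  move=> hz; have [->|zw] := eqVneq z w; last exact: (derivable_cont (dH z hz zw)).
  have ci : (x : C) @[x --> w] --> (w : C) by exact: cvg_id.
  exact: (@cont_mul R (fun x => x) G w ci cG).
have hH : (fun p => circle_mean p H s2 - circle_mean p H s1) @ \oo --> (0 : C).
  apply: (@circle_mean_goursat_exc R H s1 s2 (ln (nrm w)) s12 cH) => z hz zw.
  by apply: (dH z hz); apply: contraNneq zw => ->; rewrite lnK ?posrE.
have HE s p : expR s != nrm w -> circle_mean p H s =
   circle_mean p (fun z => z / (z - w) * F z) s - F w * circle_mean p (fun z => z / (z - w)) s.
  move=> sw; rewrite -circle_meanZ -circle_meanB; apply: eq_circle_mean => z zs.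
  have zw : z != w by apply: contraNneq sw => <-; rewrite zs.
  by rewrite /H GE//; field; rewrite subr_eq0.
have h2 := cauchy_kernel_out w2; have h1 := cauchy_kernel_in w1.
have -> : (fun p => circle_mean p (fun z => z / (z - w) * F z) s2 -
            circle_mean p (fun z => z / (z - w) * F z) s1) =
  (fun p => (circle_mean p H s2 - circle_mean p H s1) +
    F w * (circle_mean p (fun z => z / (z - w)) s2 - circle_mean p (fun z => z / (z - w)) s1)).
  apply/funext => p; rewrite (HE s2) ?gt_eqF// (HE s1) ?lt_eqF//.
  move: (circle_mean _ _ s2) (circle_mean _ _ s1) (circle_mean _ _ s2) (circle_mean _ _ s1) (F w).
  by move=> x y x' y' c; ring.
exact: (@cvg_affine _ _ _ (F w) hH h2 h1).
Qed.

End CauchyFormula.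

(** * Cauchy integrals and differentiability of derivatives *)

Section Smoothness.
Variable R : realType.
Local Notation C := (Cx R).
Implicit Types (F : C -> C) (z w a h : C) (s d : R).

Lemma limitB (u v : nat -> C) (a b : C) : u @ \oo --> a -> v @ \oo --> b ->
  (fun p => u p - v p) @ \oo --> a - b.
Proof. by move=> ha hb; exact: (cvgB ha hb). Qed.

Lemma limitZ (u : nat -> C) (a c : C) : u @ \oo --> a ->
  (fun p => c * u p) @ \oo --> c * a.
Proof. by move=> ha; apply: cvgM ha; exact: cvg_cst. Qed.

Lemma limit_le (u : nat -> C) (l : C) (M : R) : u @ \oo --> l ->
  (forall p, nrm (u p) <= M) -> nrm l <= M.
Proof.
move=> ul uM; apply/ler_addgt0Pr => e e0.
have [N hN] := (cvg_nrmP u l).1 ul e e0.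
have := hN N (leqnn N); have := uM N; have := nrm_triangleB (u N) (u N - l).
by rewrite subKr; lra.
Qed.

Lemma circle_mean_le_param p F s M :
  (forall t, 0 <= t <= twopi R -> nrm (F (cexp (pt s t))) <= M) ->
  nrm (circle_mean p F s) <= M.
Proof.
move=> h; rewrite /circle_mean nrmM nrm_toC gtr0_norm ?invr_gt0 ?twopi_gt0//.
rewrite mulrC ler_pdivrMr ?twopi_gt0// mulrC -[X in _ <= X * _]subr0.
by apply: riemann_le => //; exact: ltW (twopi_gt0 R).
Qed.

Lemma circle_bounded F s : (forall z, nrm z = expR s -> F x @[x --> z] --> F z) ->
  exists M : R, forall t, 0 <= t <= twopi R -> nrm (F (cexp (pt s t))) <= M.
Proof.
move=> cF.
apply: (@rect_ind R (fun _ _ c d => exists M, forall t, c <= t <= d ->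
   nrm (F (cexp (pt s t))) <= M) _ 0 0 0 (twopi R)) => //.
- move=> _ _ c d _ cd [M1 h1] _ [M2 h2] _; exists (Num.max M1 M2) => t /andP[t1 t2].
  have [tm|tm] := leP t ((c + d) / 2); rewrite le_max.
    by apply/orP; left; apply: h1; rewrite t1.
  by apply/orP; right; apply: h2; rewrite t2 ltW.
- exact: ltW (twopi_gt0 R).
move=> x0 y _ _.
have dexp : (cexp x : C) @[x --> pt s y] --> (cexp (pt s y) : C).
  by apply: derivable_cont; have [] := is_derive_cexp (pt s y).
have cg : F (cexp x) @[x --> pt s y] --> F (cexp (pt s y)).
  by apply: cvg_comp dexp _; apply: cF; rewrite nrm_cexp_pt.
have [d d0 hd] := (continuous_nrmP (fun x => F (cexp x)) (pt s y)).1 cg 1 ltr01.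
exists d => // _ _ c' d' _ _ _ _ _ hy _ w; exists (1 + nrm (F (cexp (pt s y)))) => t ht.
have /hd : nrm (pt s t - pt s y) < d.
  rewrite ptB subrr; apply: le_lt_trans (nrm_pt_le _ _) _.
  by rewrite normr0 add0r ltr_norml; lra.
have := nrm_triangle (F (cexp (pt s t)) - F (cexp (pt s y))) (F (cexp (pt s y))).
by rewrite subrK; lra.
Qed.

(** This is $\frac1{2\pi i}\oint F(z)(z-w)^{-k}\,dz$; the factor [z] offsets the $dz/z$ built into
    [circle_mean]. *)
Definition cauchy_int k F s w : C :=
  lim ((fun p => circle_mean p (fun z => z / (z - w) ^+ k * F z) s) @ \oo).

Lemma cauchy_int_cvg k F s w : (forall z, nrm z = expR s -> F x @[x --> z] --> F z) ->
  nrm w != expR s ->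
  (fun p => circle_mean p (fun z => z / (z - w) ^+ k * F z) s) @ \oo --> cauchy_int k F s w.
Proof.
move=> cF ws.
have [l hl] : exists l : C,
    (fun p => circle_mean p (fun z => z / (z - w) ^+ k * F z) s) @ \oo --> l.
  apply: circle_mean_cvg => z zs.
  have zw : z != w by apply: contraNneq ws => <-; rewrite zs.
  apply: (@cont_mul R (fun z => z / (z - w) ^+ k) F z _ (cF z zs)).
  by apply: derivable_cont; exact: cauchy_kernel_derivable.
by rewrite /cauchy_int (cvg_lim _ hl).
Qed.

(** A Taylor estimate for $(a-h)^{-k}$, uniform for [a] away from 0, which justifies differentiation
    under the mean. The exponents 1 and 2 suffice: they represent $F'$ and differentiate it once
    more, after which the argument starts again with $F'$ in place of $F$. *)
Definition kernel_taylor k := forall d : R, 0 < d -> exists2 B : R, 0 <= B &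
  forall a h, 2 * d <= nrm a -> nrm h < d ->
  nrm ((a - h) ^- k - a ^- k - k%:R * h / a ^+ k.+1) <= B * nrm h ^+ 2.

Lemma nrm_inv_le a d : 0 < d -> d <= nrm a -> nrm a^-1 <= d^-1.
Proof.
by move=> d0 da; rewrite nrmV lef_pV2 ?posrE//; exact: lt_le_trans da.
Qed.

Lemma kernel_taylor1 : kernel_taylor 1.
Proof.
move=> d d0; have di : 0 < d^-1 by rewrite invr_gt0.
exists (d^-1 ^+ 3) => [|a h ha hh]; first by rewrite exprn_ge0// ltW.
have h2 : d <= nrm (a - h) by have := nrm_subr_ge a h; lra.
have h1 : d <= nrm a by lra.
have a0 : a != 0 by rewrite -nrm_gt0; lra.
have b0 : a - h != 0 by rewrite -nrm_gt0; lra.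
have -> : (a - h) ^- 1 - a ^- 1 - 1%:R * h / a ^+ 2 = (a^-1 * a^-1 * (a - h)^-1) * h ^+ 2.
  by field; rewrite b0 a0.
rewrite nrmM nrmX ler_wpM2r ?exprn_ge0 ?nrm_ge0//.
have := nrm_inv_le d0 h1; have := nrm_inv_le d0 h2 => k2 k1.
rewrite !nrmM !exprS expr0 mulr1 mulrA.
by rewrite ler_pM ?mulr_ge0 ?nrm_ge0// ler_pM ?nrm_ge0.
Qed.

Lemma kernel_taylor2 : kernel_taylor 2.
Proof.
move=> d d0; have di : 0 < d^-1 by rewrite invr_gt0.
exists (3 * d^-1 ^+ 4) => [|a h ha hh]; first by rewrite mulr_ge0// exprn_ge0// ltW.
have h2 : d <= nrm (a - h) by have := nrm_subr_ge a h; lra.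
have h1 : d <= nrm a by lra.
have a0 : a != 0 by rewrite -nrm_gt0; lra.
have b0 : a - h != 0 by rewrite -nrm_gt0; lra.
have -> : (a - h) ^- 2 - a ^- 2 - 2%:R * h / a ^+ 3 =
   ((a^-1 * a^-1) * ((a - h)^-1 * (a - h)^-1) +
    2%:R * ((a^-1 * a^-1) * (a^-1 * (a - h)^-1))) * h ^+ 2.
  by field; rewrite b0 a0.
rewrite nrmM nrmX ler_wpM2r ?exprn_ge0 ?nrm_ge0//.
have := nrm_inv_le d0 h1; have := nrm_inv_le d0 h2 => k2 k1.
have p1 x y : nrm x <= d^-1 -> nrm y <= d^-1 -> nrm (x * y : C) <= d^-1 ^+ 2.
  by move=> hx hy; rewrite nrmM expr2 ler_pM ?nrm_ge0.
have p2 x y : nrm x <= d^-1 ^+ 2 -> nrm y <= d^-1 ^+ 2 -> nrm (x * y : C) <= d^-1 ^+ 4.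
  by move=> hx hy; rewrite nrmM (exprD _ 2 2) ler_pM ?nrm_ge0.
apply: le_trans (nrm_triangle _ _) _.
have q1 := p2 _ _ (p1 _ _ k1 k1) (p1 _ _ k2 k2).
have q2 := p2 _ _ (p1 _ _ k1 k1) (p1 _ _ k1 k2).
by rewrite [X in _ + X <= _]nrmM nrm_nat; lra.
Qed.

Lemma is_derive_cauchy_int k F s w : kernel_taylor k ->
  (forall z, nrm z = expR s -> F x @[x --> z] --> F z) -> nrm w != expR s ->
  is_derive w 1 (cauchy_int k F s) (k%:R * cauchy_int k.+1 F s w).
Proof.
move=> tk cF ws; apply/is_derive_nrmP => e e0.
have [M hM] := circle_bounded cF.
have M0 : 0 <= M.
  by apply: le_trans (nrm_ge0 _) (hM 0 _); rewrite lexx ltW ?twopi_gt0.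
(* Half the distance from [w] to the circle: on the circle [nrm (z - w)] is at least [2 * d], as
   [kernel_taylor] requires. *)
pose d := `|nrm w - expR s| / 2.
have d0 : 0 < d by rewrite divr_gt0// normr_gt0 subr_eq0.
have dE : `|nrm w - expR s| = 2 * d by rewrite /d; lra.
have [B B0 hB] := tk d d0.
(* The remainder is at most [Q * nrm h ^+ 2]; increments below [e / (1 + Q)] turn this into
   [e * nrm h]. *)
pose Q := expR s * B * M.
have Q0 : 0 <= Q by rewrite !mulr_ge0 ?expR_ge0.
exists (Num.min d (e / (1 + Q))).
  by rewrite lt_min d0 divr_gt0// ltr_pwDl.
move=> h; rewrite lt_min => /andP[hd he].
have wh : nrm (w + h) != expR s.
  apply: contraTneq hd => hE; rewrite -leNgt.
  have := nrm_sub_le w (w + h); rewrite hE dE opprD addNKr nrmN; lra.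
have l1 := @cauchy_int_cvg k F s (w + h) cF wh.
have l2 := @cauchy_int_cvg k F s w cF ws.
have l3 := @cauchy_int_cvg k.+1 F s w cF ws.
have l4 : (fun p => k%:R * h * circle_mean p (fun z => z / (z - w) ^+ k.+1 * F z) s) @ \oo
   --> k%:R * h * cauchy_int k.+1 F s w.
  exact: (@limitZ _ _ (k%:R * h) l3).
pose u p := circle_mean p (fun z => z / (z - (w + h)) ^+ k * F z) s -
  circle_mean p (fun z => z / (z - w) ^+ k * F z) s -
  k%:R * h * circle_mean p (fun z => z / (z - w) ^+ k.+1 * F z) s.
have l5 : u @ \oo --> cauchy_int k F s (w + h) - cauchy_int k F s w -
    k%:R * h * cauchy_int k.+1 F s w.
  exact: (limitB (limitB l1 l2) l4).
have bd : nrm (cauchy_int k F s (w + h) - cauchy_int k F s w -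
    k%:R * h * cauchy_int k.+1 F s w) <= Q * nrm h ^+ 2.
  apply: (limit_le l5) => p.
  rewrite /u -circle_meanZ -!circle_meanB.
  apply: circle_mean_le_param => t ht.
  have zs := nrm_cexp_pt s t; have := hM t ht.
  move: (cexp _) zs => z zs Fz.
  have zw : 2 * d <= nrm (z - w) by rewrite -dE -zs distrC; exact: nrm_sub_le.
  have -> : z / (z - (w + h)) ^+ k * F z - z / (z - w) ^+ k * F z -
     k%:R * h * (z / (z - w) ^+ k.+1 * F z) = z * (((z - w - h) ^- k - (z - w) ^- k -
     k%:R * h / (z - w) ^+ k.+1) * F z).
    by rewrite opprD addrA; ring.
  have := hB _ _ zw hd; move: (_ - _ : C) => K hK.
  rewrite !nrmM zs.
  have -> : Q * nrm h ^+ 2 = expR s * (B * nrm h ^+ 2 * M) by rewrite /Q; ring.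
  by rewrite ler_wpM2l ?expR_ge0// ler_pM ?nrm_ge0.
rewrite mulrAC; apply: le_trans bd _.
rewrite expr2 mulrA ler_wpM2r ?nrm_ge0//.
have Q1 : 0 < 1 + Q by rewrite ltr_pwDl.
have := ltW he; rewrite ler_pdivlMr// => he'.
by have := nrm_ge0 h; lra.
Qed.

(** In the open annulus [F] is the difference [G 1] of two Cauchy integrals, so its derivative is
    [G 2], which can be differentiated again. *)
Lemma derivable_derive1 F s1 s2 w : expR s1 < nrm w < expR s2 ->
  (forall z, expR s1 <= nrm z <= expR s2 -> derivable F z 1) -> derivable (derive1 F) w 1.
Proof.
move=> /andP[w1 w2] dF.
have s12 : expR s1 <= expR s2 by rewrite ltW// (lt_trans w1).
have c1 z : nrm z = expR s1 -> F x @[x --> z] --> F z.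
  by move=> hz; apply: derivable_cont; apply: dF; rewrite hz lexx.
have c2 z : nrm z = expR s2 -> F x @[x --> z] --> F z.
  by move=> hz; apply: derivable_cont; apply: dF; rewrite hz lexx andbT.
pose d := Num.min (nrm w - expR s1) (expR s2 - nrm w).
have d0 : 0 < d by rewrite lt_min !subr_gt0 w1.
have dw x : nrm (x - w) < d -> expR s1 < nrm x < expR s2.
  rewrite lt_min => /andP[h1 h2]; have := nrm_sub_le x w; rewrite ler_norml => /andP[h3 h4].
  by apply/andP; lra.
pose G k x := cauchy_int k F s2 x - cauchy_int k F s1 x.
have FE x : expR s1 < nrm x < expR s2 -> F x = G 1%N x.
  move=> hx; have := cauchy_formula hx dF; case/andP: hx => h1 h2.
  have l1 := @cauchy_int_cvg 1 F s1 x c1 (negbT (gt_eqF h1)).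
  have l2 := @cauchy_int_cvg 1 F s2 x c2 (negbT (lt_eqF h2)).
  by move=> hF; apply: (cvg_unique _ hF (limitB l2 l1)).
have dG k x : kernel_taylor k -> expR s1 < nrm x < expR s2 ->
    is_derive x 1 (G k) (k%:R * G k.+1 x).
  move=> tk /andP[h1 h2]; rewrite mulrBr; apply: is_derive_sub.
    by apply: is_derive_cauchy_int => //; rewrite lt_eqF.
  by apply: is_derive_cauchy_int => //; rewrite gt_eqF.
have dFE x : expR s1 < nrm x < expR s2 -> derive1 F x = G 2%N x.
  move=> hx.
  have [e e0 he] : exists2 e, 0 < e & forall y, nrm (y - x) < e -> expR s1 < nrm y < expR s2.
    case/andP: hx => h1 h2; exists (Num.min (nrm x - expR s1) (expR s2 - nrm x)).
      by rewrite lt_min !subr_gt0 h1.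
    move=> y; rewrite lt_min => /andP[k1 k2]; have := nrm_sub_le y x.
    by rewrite ler_norml => /andP[h3 h4]; apply/andP; lra.
  rewrite (@derive1_local R F (G 1%N) x e e0) => [|y /he /FE//].
  by rewrite (is_derive1E (dG _ _ kernel_taylor1 hx)) mul1r.
apply: (@derivable_local R (G 2%N) (derive1 F) w d d0) => [x /dw /dFE//|].
by apply: (is_derivable (dG _ _ kernel_taylor2 _)); rewrite w1.
Qed.

(** The hypothesis on [A] holds for [inner] and for [outer], both open and invariant under rotation,
    so one argument serves the disc and the exterior. *)
Lemma derivable_derive1n (A : set C) F :
  (forall w, A w -> exists s1 s2, expR s1 < nrm w < expR s2 /\
     forall z, expR s1 <= nrm z <= expR s2 -> A z) ->
  (forall z, A z -> derivable F z 1) ->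
  forall k z, A z -> derivable (derive1n k F) z 1.
Proof.
move=> hA dF; elim=> [|k IH] z Az; first exact: dF.
have [s1 [s2 [hz sub]]] := hA z Az.
rewrite derive1nS; apply: (derivable_derive1 hz) => x /sub Ax; exact: IH.
Qed.

End Smoothness.

(** * Uniqueness and approximation from the unit circle *)

Section PuncturedDisc.
Variable R : realType.
Local Notation C := (Cx R).
Implicit Types (f F : C -> C) (z w : C) (s d : R).

Lemma innerP z : inner z <-> 0 < nrm z < 1.
Proof. by rewrite /inner /= normE -toC0 -toC1 !ltcE'. Qed.

Lemma inner_clP z : inner_cl z <-> 0 < nrm z <= 1.
Proof. by rewrite /inner_cl /= normE -toC0 -toC1 ltcE' lecE'. Qed.

Lemma outerP z : outer z <-> 1 < nrm z.
Proof. by rewrite /outer /= normE -toC1 ltcE'. Qed.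

Lemma outer_clP z : outer_cl z <-> 1 <= nrm z.
Proof. by rewrite /outer_cl /= normE -toC1 lecE'. Qed.

Lemma within_nrmP (A : set C) f : {within A, continuous f} <->
  forall z, A z -> forall e : R, 0 < e -> exists2 d : R, 0 < d &
    forall w, A w -> nrm (w - z) < d -> nrm (f w - f z) <= e.
Proof.
split=> [/subspace_continuousP h z Az e e0|h].
  have /(@cvgrPdist_le _ _ _ (within A (nbhs z)) _ f (f z))/(_ (toC e)) := h z Az.
  rewrite -toC0 ltcE' => /(_ e0) /nbhs_nrmP[d d0 hd].
  by exists d => // w Aw wd; have := hd w wd Aw; rewrite /= normE lecE' nrm_distC.
apply/subspace_continuousP => z Az.
apply/(@cvgrPdist_le _ _ _ (within A (nbhs z)) _ f (f z)) => e /pos_toC[x x0 ->].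
have [d d0 hd] := h z Az x x0.
by apply/nbhs_nrmP; exists d => // w wd Aw; rewrite /= normE lecE' nrm_distC; exact: hd.
Qed.

Lemma inner_annulus w : inner w -> exists s1 s2, expR s1 < nrm w < expR s2 /\
  forall z, expR s1 <= nrm z <= expR s2 -> inner z.
Proof.
move=> /innerP/andP[w0 w1]; exists (ln (nrm w / 2)), (ln ((nrm w + 1) / 2)).
rewrite !lnK ?posrE; [|lra..]; split; first by lra.
by move=> z hz; apply/innerP; lra.
Qed.

Lemma outer_annulus w : outer w -> exists s1 s2, expR s1 < nrm w < expR s2 /\
  forall z, expR s1 <= nrm z <= expR s2 -> outer z.
Proof.
move=> /outerP w1; exists (ln ((nrm w + 1) / 2)), (ln (nrm w + 1)).
rewrite !lnK ?posrE; [|lra..]; split; first by lra.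
by move=> z hz; apply/outerP; lra.
Qed.

(* Continuous across the unit circle, so that circle means can be taken on it. *)
Definition radial_ext f z : C := f (if nrm z <= 1 then z else z / toC (nrm z)).

Lemma radial_ext_cont f z : {within inner_cl (R := R), continuous f} -> nrm z = 1 ->
  radial_ext f x @[x --> z] --> radial_ext f z.
Proof.
move=> /within_nrmP cf z1; apply/continuous_nrmP => e e0.
have zi : inner_cl z by apply/inner_clP; rewrite z1 ltr01 lexx.
have [d d0 hd] := cf z zi e e0.
have d2 : 0 < Num.min (d / 2) (1 / 2) by rewrite lt_min !divr_gt0.
exists (Num.min (d / 2) (1 / 2)) => // w; rewrite lt_min => /andP[h1 h2].
have := nrm_sub_le w z; rewrite z1 ler_norml => /andP[h3 h4].
rewrite /radial_ext z1 lexx.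
have [w1|w1] := leP (nrm w) 1.
  by apply: hd; [apply/inner_clP; lra|lra].
have w0 : nrm w != 0 by rewrite gt_eqF//; lra.
have w'1 : nrm (w / toC (nrm w)) = 1.
  by rewrite nrmM nrmV nrm_toC ger0_norm ?nrm_ge0// divff.
apply: hd; first by apply/inner_clP; rewrite w'1 ltr01 lexx.
(* Projection to the circle moves [w] by [nrm w - 1], which is below [d / 2]; hence the halved
   radius. *)
have -> : w / toC (nrm w) - z = (w - z) + w * toC (1 - nrm w) / toC (nrm w).
  by rewrite toCB toC1; field; rewrite toC_eq0.
apply: le_lt_trans (nrm_triangle _ _) _.
rewrite mulrAC nrmM w'1 mul1r nrm_toC ltr0_norm ?subr_lt0//; lra.
Qed.

(** Cauchy's formula for [z ^+ k * f z]. The two circles contribute separately: the unit circle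
    without any power, the inner one with [expR s1 ^+ k], negligible against [nrm w ^+ k] for large
    [k]. *)
Lemma inner_cauchy_bound f w s1 (k : nat) (eta M : R) :
  analytic_ext (@inner R) (@inner_cl R) f -> inner w -> expR s1 < nrm w ->
  (forall z, nrm z = 1 -> nrm (f z) <= eta) ->
  (forall t, 0 <= t <= twopi R -> nrm (f (cexp (pt s1 t))) <= M) ->
  nrm w ^+ k * nrm (f w) <=
    (1 - nrm w)^-1 * eta + expR s1 / (nrm w - expR s1) * (expR s1 ^+ k * M).
Proof.
move=> [df cf] /innerP/andP[w0 w1] sw heta hM.
apply/ler_addgt0Pr => e e0.
have e2 : 0 < e / 2 by rewrite divr_gt0.
pose F z := z ^+ k * radial_ext f z.
pose Phi z := z / (z - w) * F z.
have extE z : nrm z <= 1 -> radial_ext f z = f z by rewrite /radial_ext => ->.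
have cPhi z : nrm z = expR 0 -> Phi x @[x --> z] --> Phi z.
  rewrite expR0 => z1; apply: (@cont_mul R (fun z => z / (z - w)) F z).
    apply: derivable_cont; apply: (@cauchy_kernel_derivable R w z 1).
    by apply: contraTneq w1 => <-; rewrite z1 ltxx.
  apply: (@cont_mul R (fun z => z ^+ k) (radial_ext f) z).
    exact: (derivable_cont (@derivable_exp R k z)).
  exact: radial_ext_cont.
have [d d0 hd] := circle_mean_near cPhi e2.
(* [f] is only continuous on the unit circle, so the formula is applied on a slightly smaller circle
   that still encloses [w], and [circle_mean_near] carries it to radius 1. *)
pose s := Num.max (ln (nrm w) / 2) (- d).
have lw : ln (nrm w) < 0 by rewrite ln_lt0// w0.
have s0 : s < 0 by rewrite gt_max; apply/andP; lra.
have sd : `|s - 0| <= d.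
  by rewrite subr0 ltr0_norm// lerNl le_max lexx orbT.
have ws : nrm w < expR s.
  rewrite -[ltLHS]lnK ?posrE// ltr_expR lt_max; apply/orP; left; lra.
have es1 : expR s < 1 by rewrite -expR0 ltr_expR.
have dF z : expR s1 <= nrm z <= expR s -> derivable F z 1.
  move=> hz; have z1 : nrm z < 1 by lra.
  have z0 : inner z by apply/innerP; rewrite z1 andbT; have := expR_gt0 s1; lra.
  apply: (derivable_mul (@derivable_exp R k z)).
  apply: (@derivable_local R f (radial_ext f) z (1 - nrm z)) (df z z0) => [|x hx].
    by rewrite subr_gt0.
  have := nrm_sub_le x z; rewrite ler_norml => /andP[_ hh].
  by rewrite extE//; lra.
have /cauchy_formula/(_ dF)/cvg_nrmP/(_ _ e2)[N hN] : expR s1 < nrm w < expR s by rewrite sw.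
have := hN N (leqnn N); have := hd _ sd N.
have b0 : nrm (circle_mean N Phi 0) <= (1 - nrm w)^-1 * eta.
  apply: circle_mean_le => z; rewrite expR0 => z1.
  have zw := nrm_subr_ge z w; rewrite z1 in zw.
  rewrite /Phi !nrmM nrmX z1 expr1n !mul1r.
  apply: ler_pM; rewrite ?nrm_ge0 ?extE ?z1 ?heta//.
  by apply: nrm_inv_le => //; rewrite subr_gt0.
have b1 : nrm (circle_mean N Phi s1) <= expR s1 / (nrm w - expR s1) * (expR s1 ^+ k * M).
  apply: circle_mean_le_param => t ht.
  have zs := nrm_cexp_pt s1 t; have := hM t ht; move: (cexp _) zs => z zs fz.
  have zw := nrm_subr_ge w z; rewrite zs nrm_distC in zw.
  have z1 : nrm z <= 1 by rewrite zs; lra.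
  rewrite /Phi /F 3!nrmM nrmX zs extE//.
  apply: ler_pM; rewrite ?mulr_ge0 ?nrm_ge0 ?exprn_ge0 ?expR_ge0//.
    by rewrite ler_wpM2l ?expR_ge0//; apply: nrm_inv_le => //; rewrite subr_gt0.
  by rewrite ler_wpM2l ?exprn_ge0 ?expR_ge0.
have -> : F w = w ^+ k * f w by rewrite /F extE// ltW.
rewrite -nrmX -nrmM -/Phi.
move: (circle_mean N Phi 0) (circle_mean N Phi s1) b0 b1 => a b b0 b1.
change (circle_mean N (fun z => z / (z - w) * F z)) with (circle_mean N Phi).
change (fun z => z / (z - w) * F z) with Phi.
move: (circle_mean N Phi s) => x h1 h2.
have -> : w ^+ k * f w = (x - a) + a - b - (x - b - w ^+ k * f w) by ring.
apply: le_trans (nrm_triangleB _ _) _.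
apply: le_trans (lerD (nrm_triangleB _ _) (lexx _)) _.
apply: le_trans (lerD (lerD (nrm_triangle _ _) (lexx _)) (lexx _)) _.
lra.
Qed.

(* Multiplying by [w ^+ k] and letting [k] grow removes the contribution of the
   inner circle, so the possible singularity at 0 does not matter. *)
Lemma inner_approx f (g : nat -> C -> C) (c : C) (B : R) :
  analytic_ext (@inner R) (@inner_cl R) f ->
  (forall N, analytic_ext (@inner R) (@inner_cl R) (g N)) ->
  (forall N z, inner_cl z -> nrm (g N z - c) <= B) ->
  (forall e : R, 0 < e -> exists N, forall z, nrm z = 1 -> nrm (f z - g N z) <= e) ->
  forall w, inner w -> nrm (f w - c) <= B.
Proof.
move=> af ag gB fg w iw; apply/ler_addgt0Pr => e e0.
have /innerP/andP[w0 w1] := iw.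
(* With half the radius of [w], the kernel bound [expR s1 / (nrm w - expR s1)] is exactly 1 and the
   powers contribute $2^{-k}$. *)
pose s1 := ln (nrm w / 2).
have s1E : expR s1 = nrm w / 2 by rewrite lnK// posrE divr_gt0.
have sw : expR s1 < nrm w by rewrite s1E; lra.
have [M0 hM0] : exists M, forall t, 0 <= t <= twopi R -> nrm (f (cexp (pt s1 t))) <= M.
  apply: circle_bounded => z zs; apply: derivable_cont; apply: af.1.
  by apply/innerP; rewrite zs s1E; lra.
(* A bound on the inner circle that is independent of [N], because all [g N] stay within [B] of [c].
   Hence [k] can be fixed before [N]. *)
pose M := M0 + B + nrm c.
have hM N t : 0 <= t <= twopi R -> nrm (f (cexp (pt s1 t)) - g N (cexp (pt s1 t))) <= M.
  move=> ht; have h1 := hM0 t ht.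
  have : nrm (g N (cexp (pt s1 t)) - c) <= B.
    by apply: gB; apply/inner_clP; rewrite nrm_cexp_pt s1E; lra.
  move: h1; rewrite /M; move: (f _) (g _ _) => x y h1 h2.
  have -> : x - y = x - (y - c) - c by ring.
  apply: le_trans (nrm_triangleB _ _) _.
  by apply: le_trans (lerD (nrm_triangleB _ _) (lexx _)) _; lra.
have M_ge0 : 0 <= M.
  by apply: le_trans (nrm_ge0 _) (hM 0%N 0 _); rewrite lexx ltW ?twopi_gt0.
have e2 : 0 < e / 2 by rewrite divr_gt0.
have [k hk] := exists_half_pow M e2.
(* Chosen so that the unit circle contributes [e / 2] after division by [nrm w ^+ k]; the inner
   circle contributes the other half by the choice of [k]. *)
pose eta := e / 2 * nrm w ^+ k * (1 - nrm w).
have eta0 : 0 < eta by rewrite /eta !mulr_gt0 ?exprn_gt0 ?divr_gt0//; lra.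
have [N hN] := fg eta eta0.
have ad : analytic_ext (@inner R) (@inner_cl R) (fun z => f z - g N z).
  split; first by move=> z iz; exact: (derivable_sub (af.1 z iz) ((ag N).1 z iz)).
  apply/within_nrmP => z iz e1 e10.
  have e12 : 0 < e1 / 2 by rewrite divr_gt0.
  have [d1 d10 h1] := (within_nrmP _ _).1 af.2 z iz _ e12.
  have [d2 d20 h2] := (within_nrmP _ _).1 (ag N).2 z iz _ e12.
  exists (Num.min d1 d2); first by rewrite lt_min d10.
  move=> x ix; rewrite lt_min => /andP[/(h1 x ix) {}h1 /(h2 x ix) {}h2].
  move: h1 h2; move: (f x) (f z) (g N x) (g N z) => a b a' b' h1 h2.
  have -> : a - a' - (b - b') = (a - b) - (a' - b') by ring.
  by apply: le_trans (nrm_triangleB _ _) _; lra.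
have := @inner_cauchy_bound _ w s1 k eta M ad iw sw hN (hM N).
have -> : (1 - nrm w)^-1 * eta = e / 2 * nrm w ^+ k.
  by rewrite mulrC /eta mulfK//; lra.
have -> : expR s1 / (nrm w - expR s1) = 1.
  by rewrite s1E; field; lra.
rewrite mul1r s1E expr_div_n => hb.
have wk : 0 < nrm w ^+ k by rewrite exprn_gt0.
have hb2 : nrm (f w - g N w) <= e.
  rewrite -(ler_pM2l wk); apply: le_trans hb _.
  have -> : nrm w ^+ k / 2 ^+ k * M = nrm w ^+ k * (M / 2 ^+ k) by rewrite mulrAC mulrA.
  have : nrm w ^+ k * (M / 2 ^+ k) <= nrm w ^+ k * (e / 2) by rewrite ler_pM2l// ltW.
  lra.
have -> : f w - c = (f w - g N w) + (g N w - c) by ring.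
apply: le_trans (nrm_triangle _ _) _; rewrite addrC lerD//.
by apply: gB; apply/inner_clP; lra.
Qed.

Lemma analytic_ext_inv f : analytic_ext (@outer R) (@outer_cl R) f ->
  analytic_ext (@inner R) (@inner_cl R) (fun z => f z^-1).
Proof.
move=> [df /within_nrmP cf].
have di z : z != 0 -> derivable (fun x : C => x^-1) z 1.
  move=> z0; exact: (is_derivable (is_derive_inv z0 (is_derive_idfun z))).
split=> [z /innerP/andP[z0 z1]|].
  have zn0 : z != 0 by rewrite -nrm_gt0.
  apply: (@derivable_comp R (fun x => x^-1) f z (di z zn0)); apply: df.
  by apply/outerP; rewrite nrmV invf_gt1.
apply/within_nrmP => z /inner_clP/andP[z0 z1] e e0.
have zn0 : z != 0 by rewrite -nrm_gt0.
have oz : outer_cl z^-1 by apply/outer_clP; rewrite nrmV invf_ge1.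
have [d d0 hd] := cf _ oz e e0.
have d2 : 0 < d / 2 by rewrite divr_gt0.
have [d' d'0 hd'] := (continuous_nrmP (fun x : C => x^-1) z).1 (derivable_cont (di z zn0)) _ d2.
exists d' => // w /inner_clP/andP[w0 w1] /hd' hw.
apply: hd; first by apply/outer_clP; rewrite nrmV invf_ge1.
by apply: le_lt_trans hw _; lra.
Qed.

Lemma analytic_ext_cst (A Acl : set C) (c : C) : analytic_ext A Acl (fun=> c).
Proof.
split; first by move=> z _; exact: (@derivable_cstf R c z).
by apply/within_nrmP => z _ e e0; exists 1 => // x _ _; rewrite subrr nrm0 ltW.
Qed.

Lemma inner_zero f : analytic_ext (@inner R) (@inner_cl R) f ->
  (forall z, nrm z = 1 -> f z = 0) -> forall w, inner w -> f w = 0.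
Proof.
move=> af f0 w iw.
have h1 (N : nat) z : inner_cl z -> nrm (0 - 0 : C) <= 0 by rewrite subrr nrm0.
have h2 (e : R) : 0 < e -> exists N : nat, forall z, nrm z = 1 -> nrm (f z - 0) <= e.
  by move=> e0; exists 0%N => z /f0 ->; rewrite subrr nrm0 ltW.
have h := @inner_approx f (fun _ _ => 0) 0 0 af (fun _ => analytic_ext_cst _ _ 0) h1 h2 w iw.
by apply/eqP; rewrite -nrm_eq0 eq_le nrm_ge0 andbT; rewrite subr0 in h.
Qed.

Lemma outer_zero f : analytic_ext (@outer R) (@outer_cl R) f ->
  (forall z, nrm z = 1 -> f z = 0) -> forall w, outer w -> f w = 0.
Proof.
move=> /analytic_ext_inv af f0 w /outerP ow.
rewrite -[w]invrK; apply: (inner_zero af) => [z z1|].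
  by apply: f0; rewrite nrmV z1 invr1.
apply/innerP; rewrite nrmV invf_lt1 ?ow ?invr_gt0 ?andbT; lra.
Qed.

End PuncturedDisc.

(** * Jets *)

Section TruncatedSeries.
Variable K : fieldType.
Implicit Types p q t : {poly K}.

Definition eqm (m : nat) p q := forall k, (k < m)%N -> p`_k = q`_k.

Lemma eqm_sym m p q : eqm m p q -> eqm m q p.
Proof. by move=> h k /h. Qed.

Lemma eqm_trans m q p r : eqm m p q -> eqm m q r -> eqm m p r.
Proof. by move=> h1 h2 k km; rewrite h1// h2. Qed.

Lemma eqm_add m p q p' q' : eqm m p p' -> eqm m q q' -> eqm m (p + q) (p' + q').
Proof. by move=> h1 h2 k km; rewrite !coefD h1// h2. Qed.

Lemma eqm_mul m p q p' q' : eqm m p p' -> eqm m q q' -> eqm m (p * q) (p' * q').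
Proof.
move=> h1 h2 k km; rewrite !coefM; apply: eq_bigr => i _.
by rewrite h1 ?h2//; [exact: leq_ltn_trans (leq_subr _ _) km|
  apply: leq_ltn_trans km; rewrite -ltnS].
Qed.

(** A nonzero constant term makes [t] invertible as a power series; the coefficients of [p] and [q]
    are compared in increasing order. *)
Lemma eqm_cancel m p q t : t`_0 != 0 -> eqm m (p * t) (q * t) -> eqm m p q.
Proof.
move=> t0 h; elim/ltn_ind => k IH km.
have := h k km; rewrite !coefMr !big_ord_recl /= subn0.
rewrite (eq_bigr (fun i : 'I_k => q`_(k - lift ord0 i) * t`_(lift ord0 i))); last first.
  move=> i _; have ik : (k - lift ord0 i < k)%N.
    by rewrite lift0 ltn_subrL /= (leq_ltn_trans _ (ltn_ord i)).
  by rewrite (IH _ ik (ltn_trans ik km)).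
by move/addIr/(mulIf t0).
Qed.

(** The truncated exponential generating function: division by factorials turns the binomial sums of
    the Leibniz rule and of the dependency relations into products. *)
Definition egf (m : nat) (a : nat -> K) : {poly K} := \poly_(i < m) (a i / (i`!)%:R).

Lemma eq_egf m a b : (forall k, (k < m)%N -> a k = b k) -> egf m a = egf m b.
Proof.
by move=> h; apply/polyP => k; rewrite !coef_poly; case: ltnP => // /h ->.
Qed.

End TruncatedSeries.

Section Egf.
Variable K : numFieldType.

Lemma fact_neq0 k : (k`!)%:R != 0 :> K.
Proof. by rewrite pnatr_eq0 -lt0n fact_gt0. Qed.

Lemma coef_egf m (a : nat -> K) k : (k < m)%N -> a k = (egf m a)`_k * (k`!)%:R.
Proof. by move=> km; rewrite coef_poly km divfK// fact_neq0. Qed.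

Lemma coef_egfM m (a b : nat -> K) k : (k < m)%N ->
  \sum_(l < k.+1) 'C(k, l)%:R * a (k - l)%N * b l =
  (egf m a * egf m b)`_k * (k`!)%:R.
Proof.
move=> km; rewrite coefMr mulr_suml; apply: eq_bigr => l _.
have lk : (l <= k)%N by rewrite -ltnS.
rewrite !coef_poly (leq_ltn_trans lk km) (leq_ltn_trans (leq_subr _ _) km).
rewrite -(bin_fact lk) !natrM.
by field; rewrite !fact_neq0.
Qed.

Lemma eqm_egf m (a b : nat -> K) : eqm m (egf m a) (egf m b) ->
  forall k, (k < m)%N -> a k = b k.
Proof. by move=> h k km; rewrite (coef_egf _ km) h// -coef_egf. Qed.

End Egf.

Section Jets.
Variable R : realType.
Local Notation C := (Cx R).
Variable A : set C.
Hypothesis hA : forall w, A w -> exists s1 s2, expR s1 < nrm w < expR s2 /\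
     forall z, expR s1 <= nrm z <= expR s2 -> A z.
Implicit Types (f g : C -> C) (z : C).

Definition holo f := forall z, A z -> derivable f z 1.

Lemma A_open z : A z -> exists2 d : R, 0 < d & forall w, nrm (w - z) < d -> A w.
Proof.
move=> /hA[s1 [s2 [/andP[h1 h2] sub]]].
exists (Num.min (nrm z - expR s1) (expR s2 - nrm z)); first by rewrite lt_min !subr_gt0 h1.
move=> w; rewrite lt_min => /andP[k1 k2]; apply: sub.
by have := nrm_sub_le w z; rewrite ler_norml => /andP[h3 h4]; apply/andP; lra.
Qed.

Lemma holo_derive1n f k : holo f -> holo (derive1n k f).
Proof. by move=> hf z Az; exact: (derivable_derive1n hA hf). Qed.

Lemma holo_mul f g : holo f -> holo g -> holo (fun z => f z * g z).
Proof. by move=> hf hg z Az; exact: (derivable_mul (hf z Az) (hg z Az)). Qed.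

Lemma derive1n_eq f g k z : (forall w, A w -> f w = g w) -> A z ->
  derive1n k f z = derive1n k g z.
Proof.
move=> fg; elim: k z => [|k IH] z Az; first exact: fg.
have [d d0 hd] := A_open Az.
by rewrite !derive1nS; apply: (derive1_local d0) => x /hd; exact: IH.
Qed.

Lemma derive1n_derive1 f k : derive1n k.+1 f = derive1n k (derive1 f).
Proof. by rewrite /derive1n iterSr. Qed.

Lemma derive1nD f g k z : holo f -> holo g -> A z ->
  derive1n k (fun w => f w + g w) z = derive1n k f z + derive1n k g z.
Proof.
move=> hf hg; elim: k z => [//|k IH] z Az.
have [d d0 hd] := A_open Az; rewrite !derive1nS.
rewrite (derive1_local d0 (g := fun w => derive1n k f w + derive1n k g w)); last first.
  by move=> x /hd; exact: IH.
apply: is_derive1E; apply: is_derive_add; apply: derivable_is.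
  exact: (holo_derive1n hf Az).
exact: (holo_derive1n hg Az).
Qed.

Definition jet m f z : {poly C} := egf m (fun k => derive1n k f z).

Lemma jet_eq m f g z : (forall w, A w -> f w = g w) -> A z -> jet m f z = jet m g z.
Proof. by move=> fg Az; apply: eq_egf => k _; exact: derive1n_eq. Qed.

Lemma jetD m f g z : holo f -> holo g -> A z ->
  jet m (fun w => f w + g w) z = jet m f z + jet m g z.
Proof.
move=> hf hg Az; apply/polyP => k; rewrite coefD !coef_poly; case: ltnP; rewrite ?addr0//.
by rewrite derive1nD// mulrDl.
Qed.

Lemma jet_derive m f z : jet m (derive1 f) z = (jet m.+1 f z)^`().
Proof.
apply/polyP => k; rewrite coef_deriv !coef_poly ltnS; case: ltnP => km; last by rewrite mul0rn.
rewrite derive1n_derive1 -[_ / _ *+ _]mulr_natr factS natrM.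
have n0 : k.+1%:R != 0 :> C by rewrite pnatr_eq0.
move: n0 (fact_neq0 C k); move: (k.+1%:R : C) ((k`!)%:R : C) => n f' n0 f0.
by field; rewrite f0 n0.
Qed.

Lemma jet_le m m' f z : (m <= m')%N -> eqm m (jet m f z) (jet m' f z).
Proof. by move=> mm k km; rewrite !coef_poly km (leq_trans km mm). Qed.

(** The Leibniz rule without binomial manipulations: $(fg)'=fg'+gf'$ matches [derivM] for
    polynomials, and the jet of $f'$ is the formal derivative of the jet of $f$ of one order more.
    The order [m] varies in the induction for this reason. *)
Lemma derive1nM f g k z : holo f -> holo g -> A z -> forall m, (k < m)%N ->
  derive1n k (fun w => f w * g w) z = (jet m f z * jet m g z)`_k * (k`!)%:R.
Proof.
move=> hf hg Az; elim: k f g hf hg => [|k IH] f g hf hg [//|m] km.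
  by rewrite coefM big_ord_recl big_ord0 addr0 subnn !coef_poly !fact0 !divr1 mulr1.
rewrite derive1n_derive1.
have dE w : A w -> derive1 (fun w => f w * g w) w = f w * derive1 g w + g w * derive1 f w.
  move=> Aw; apply: is_derive1E.
  exact: (is_derive_mul (derivable_is (hf w Aw)) (derivable_is (hg w Aw))).
apply: etrans (derive1n_eq k dE Az) _.
have := @holo_derive1n f 1 hf; have := @holo_derive1n g 1 hg.
have := jet_derive m f z; have := jet_derive m g z.
rewrite /derive1n /=; move: (derive1 f) (derive1 g) => f' g' J1 J2 hg' hf' {dE}.
apply: etrans (derive1nD k (holo_mul hf hg') (holo_mul hg hf') Az) _.
apply: etrans (congr2 +%R (IH f g' hf hg' m km) (IH g f' hg hf' m km)) _.
rewrite -mulrDl J1 J2 -coefD.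
have E : eqm m (jet m f z * (jet m.+1 g z)^`() + jet m g z * (jet m.+1 f z)^`())
    (jet m.+1 f z * jet m.+1 g z)^`().
  rewrite derivM addrC (mulrC _^`()).
  by apply: eqm_add; apply: eqm_mul => //; apply: jet_le.
by rewrite (E k km) coef_deriv -[_ *+ k.+1]mulr_natr factS natrM mulrA.
Qed.

Lemma jetM m f g z : holo f -> holo g -> A z ->
  eqm m (jet m (fun w => f w * g w) z) (jet m f z * jet m g z).
Proof.
move=> hf hg Az k km; rewrite {1}/jet {1}/egf coef_poly km (derive1nM hf hg Az km).
by rewrite mulfK// fact_neq0.
Qed.

Lemma derive1n_cst c k z : derive1n k (fun=> c : C) z = if k == 0%N then c else 0.
Proof.
case: k => [//|k] /=.
elim: k c => [|k IH] c; first exact: (is_derive1E (is_derive_cst_fun c z)).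
rewrite derive1n_derive1; have -> : derive1 (fun=> c : C) = (fun=> 0 : C).
  by apply/funext => w; exact: (is_derive1E (is_derive_cst_fun c w)).
exact: IH.
Qed.

Lemma jet_cst m c z : eqm m (jet m (fun=> c) z) c%:P.
Proof.
move=> k km; rewrite coef_poly km derive1n_cst coefC.
by case: eqP => [->|_]; rewrite ?divr1 ?mul0r.
Qed.

(* [dep_consts] says that the jets satisfy [Y = gam * X]. *)
Lemma dep_eqm m z (Y X : C -> int -> C * C) gam : dep_consts Y X z m gam -> forall n,
  eqm m (jet m (fun w => (Y w n).1) z) (egf m gam * jet m (fun w => (X w n).1) z) /\
  eqm m (jet m (fun w => (Y w n).2) z) (egf m gam * jet m (fun w => (X w n).2) z).
Proof.
move=> h n; split=> k km; have [h1 h2] := h n k km;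
  apply: (mulIf (fact_neq0 C k)); rewrite -coef_egf// -coef_egfM//.
Qed.

(** At the level of jets modulo $X^m$, the chain is $\alpha\,G_U X=\alpha
    Y=g_1y_1+g_2y_2=G_Q(g_1x_1+g_2x_2)=G_Q\,\beta X$, and the jet of $X$ cancels because its
    constant term $X(z_0)$ is nonzero. *)
Lemma dep_transfer m z0 (al be g1 g2 y1 y2 x1 x2 Y X : C -> C) (GQ GU : {poly C}) :
  (0 < m)%N -> A z0 ->
  holo al -> holo be -> holo g1 -> holo g2 -> holo y1 -> holo y2 -> holo x1 -> holo x2 ->
  holo Y -> holo X ->
  (forall z, A z -> al z * Y z = g1 z * y1 z + g2 z * y2 z) ->
  (forall z, A z -> be z * X z = g1 z * x1 z + g2 z * x2 z) ->
  eqm m (jet m y1 z0) (GQ * jet m x1 z0) -> eqm m (jet m y2 z0) (GQ * jet m x2 z0) ->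
  eqm m (jet m Y z0) (GU * jet m X z0) -> X z0 != 0 ->
  eqm m (jet m al z0 * GU) (GQ * jet m be z0).
Proof.
move=> m0 Az hal hbe hg1 hg2 hy1 hy2 hx1 hx2 hY hX eY eX e1 e2 eU X0.
apply: (@eqm_cancel _ m _ _ (jet m X z0)).
  by rewrite coef_poly m0 /= divr1.
rewrite -!mulrA.
have s1 : eqm m (jet m al z0 * (GU * jet m X z0)) (jet m (fun z => al z * Y z) z0).
  apply: eqm_trans (eqm_mul _ (eqm_sym eU)) _; first by [].
  exact: eqm_sym (jetM hal hY Az).
have s2 : eqm m (GQ * (jet m be z0 * jet m X z0)) (GQ * jet m (fun z => be z * X z) z0).
  apply: eqm_mul; first by [].
  exact: eqm_sym (jetM hbe hX Az).
apply: eqm_trans s1 _; apply: eqm_sym; apply: eqm_trans s2 _.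
rewrite (jet_eq m eY Az) (jet_eq m eX Az).
rewrite (jetD m (holo_mul hg1 hy1) (holo_mul hg2 hy2) Az).
rewrite (jetD m (holo_mul hg1 hx1) (holo_mul hg2 hx2) Az) mulrDr.
have key g y x : holo g -> holo y -> holo x -> eqm m (jet m y z0) (GQ * jet m x z0) ->
    eqm m (GQ * jet m (fun z => g z * x z) z0) (jet m (fun z => g z * y z) z0).
  move=> hg hy hx e.
  apply: (@eqm_trans _ m (GQ * (jet m g z0 * jet m x z0))).
    by apply: eqm_mul; [|exact: jetM].
  rewrite mulrCA; apply: (@eqm_trans _ m (jet m g z0 * jet m y z0)).
    by apply: eqm_mul; [|exact: eqm_sym].
  exact: eqm_sym (jetM hg hy Az).
by apply: eqm_add; [exact: (key _ _ _ hg1 hy1 hx1 e1)|exact: (key _ _ _ hg2 hy2 hx2 e2)].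
Qed.

End Jets.

(** * Infinite products *)

Section Decay.
Variable R : realType.
Local Notation C := (Cx R).

Definition rinv (n : nat) : R := n%:R^-1.

(** For positive [n] this is $1/(n(n+1))$; in the form of a difference, its sums telescope. *)
Definition wt (n : nat) : R := rinv n - rinv n.+1.

Lemma wt_ge0 n : (0 < n)%N -> 0 <= wt n.
Proof. by move=> n0; rewrite /wt /rinv subr_ge0 lef_pV2 ?posrE ?ltr0n// ler_nat. Qed.

Lemma inv_nat_le m n : (0 < m)%N -> (m <= n)%N -> rinv n <= rinv m.
Proof. by move=> m0 mn; rewrite /rinv lef_pV2 ?posrE ?ltr0n ?(leq_trans m0)// ler_nat. Qed.

Lemma inv_nat_ge0 n : 0 <= rinv n.
Proof. by rewrite /rinv invr_ge0. Qed.

Lemma wt_le1 n : (0 < n)%N -> wt n <= 1.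
Proof.
move=> n0; have := @inv_nat_le 1 n isT n0; rewrite {2}/rinv invr1 /wt.
by have := inv_nat_ge0 n.+1; lra.
Qed.

Lemma exists_inv_le (e : R) : 0 < e -> exists2 n : nat, (0 < n)%N &
  forall m, (n <= m)%N -> rinv m <= e.
Proof.
move=> e0; have h := archi_boundP (ltW (divr_gt0 ltr01 e0)).
exists (Num.Def.archi_bound (1 / e)).+1 => // m hm.
have m0 : (0 < m)%N by exact: leq_trans hm.
rewrite /rinv -[_^-1]mul1r ler_pdivrMr ?ltr0n// mulrC -ler_pdivrMr//.
by apply: le_trans (ltW h) _; rewrite ler_nat ltnW.
Qed.

Lemma wt_decay (f : nat -> C) : (fun n : nat => n%:R ^+ 2 * `|f n|) @ \oo --> (0 : C) ->
  exists2 n0 : nat, (0 < n0)%N & forall n, (n0 <= n)%N -> nrm (f n) <= wt n.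
Proof.
(* The bound $n^2|f_n|\le 1/2$ is enough, since $n(n+1)\le 2n^2$. *)
move=> /cvg_nrmP/(_ 2^-1)[|N hN]; first by rewrite invr_gt0.
exists N.+1 => // n Nn; have n0 : (0 < n)%N by exact: leq_trans Nn.
have := hN n (ltnW Nn); rewrite subr0 nrmM nrmX nrm_nat normE nrm_toC ger0_norm ?nrm_ge0// => h.
have r0 : 0 < n%:R :> R by rewrite ltr0n.
have r1 : 1 <= n%:R :> R by rewrite ler1n.
have -> : wt n = (n%:R * (n%:R + 1))^-1.
  by rewrite /wt /rinv -natr1; field; lra.
rewrite -[leRHS]mul1r ler_pdivlMr ?mulr_gt0//; last lra.
have h3 : n%:R * nrm (f n) <= n%:R ^+ 2 * nrm (f n).
  by rewrite expr2 -mulrA ler_peMl// mulr_ge0 ?nrm_ge0.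
have -> : nrm (f n) * (n%:R * (n%:R + 1)) = n%:R ^+ 2 * nrm (f n) + n%:R * nrm (f n) by ring.
lra.
Qed.

Lemma rapid_decay_wt (q : int -> C) : rapid_decay q ->
  exists2 n0 : nat, (0 < n0)%N & forall n, (n0 <= n)%N ->
    nrm (q n%:Z) <= wt n /\ nrm (q (- n%:Z)) <= wt n.
Proof.
move=> hq; have [h1 h2] := hq 2%N.
have [n1 n10 k1] := @wt_decay (fun n => q n%:Z) h1.
have [n2 n20 k2] : exists2 n0 : nat, (0 < n0)%N &
    forall n, (n0 <= n)%N -> nrm (q (- n%:Z)) <= wt n.
  apply: (@wt_decay (fun n => q (- n%:Z))).
  move: h2; rewrite /to_minfty.
  by under eq_fun do rewrite abszN.
exists (maxn n1 n2); first by rewrite leq_max n10.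
by move=> n; rewrite geq_max => /andP[/k1 ? /k2 ?].
Qed.

(** For [m >= 2] the inductive bound keeps the partial products below 2 in modulus; each new factor
    then costs at most twice its weight, and the weights telescope. *)
Lemma prod_near1 (a : nat -> C) (m : nat) : (2 <= m)%N ->
  (forall i, nrm (a i - 1) <= wt (m + i)) ->
  forall M, nrm (\prod_(i < M) a i - 1) <= 2 * (rinv m - rinv (m + M)).
Proof.
move=> m2 ha; elim=> [|M IH]; first by rewrite big_ord0 addn0 !subrr nrm0 mulr0.
have m0 : (0 < m)%N by exact: leq_trans m2.
rewrite big_ord_recr /=; set P := \prod_(i < M) a i in IH *.
have -> : P * a M - 1 = P * (a M - 1) + (P - 1) by ring.
apply: le_trans (nrm_triangle _ _) _; rewrite nrmM.
have P2 : nrm P <= 2.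
  have := nrm_triangle (P - 1) 1; rewrite subrK nrm1.
  have := @inv_nat_le 2 m isT m2; rewrite {2}/rinv; have := inv_nat_ge0 (m + M); lra.
have := ler_pM (nrm_ge0 _) (nrm_ge0 _) P2 (ha M); rewrite addnS /wt; lra.
Qed.

Lemma limit_dist_le (u : nat -> C) (l c : C) (M : R) : u @ \oo --> l ->
  (forall p, nrm (u p - c) <= M) -> nrm (l - c) <= M.
Proof.
move=> ul uM; apply/ler_addgt0Pr => e e0.
have [N hN] := (cvg_nrmP u l).1 ul e e0.
have := hN N (leqnn N); have := uM N; have := nrm_triangleB (u N - c) (u N - l).
have -> : u N - c - (u N - l) = l - c by ring.
by lra.
Qed.

End Decay.

Section InfiniteProducts.
Variable R : realType.
Local Notation C := (Cx R).
Variables (c P : int -> C) (n0 : nat).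
Hypothesis c0 : forall n, c n != 0.
Hypothesis cpos : forall n, (n0 <= n)%N -> nrm (c n%:Z - 1) <= wt R n.
Hypothesis cneg : forall n, (n0 <= n)%N -> nrm (c (- n%:Z) - 1) <= wt R n.
Hypothesis hP : forall n : int, (fun M : nat => \prod_(i < M) c (n - i%:Z)) @ \oo --> P n.

Lemma infprod_rec n : P n = c n * P (n - 1).
Proof.
have h1 := @limitZ R _ _ (c n) (@hP (n - 1)).
have h2 := @hP n.
have h3 : (fun M : nat => \prod_(i < M.+1) c (n - i%:Z)) @ \oo --> P n.
  apply/cvg_nrmP => e e0; have [N hN] := (cvg_nrmP _ _).1 h2 e e0.
  by exists N => M NM; apply: hN; exact: leqW.
have E : (fun M : nat => \prod_(i < M.+1) c (n - i%:Z)) =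
    (fun M => c n * \prod_(i < M) c (n - 1 - i%:Z)).
  apply/funext => M; rewrite big_ord_recl subr0; congr (_ * _).
  apply: eq_bigr => i _; congr c; rewrite lift0 -addn1 PoszD; ring.
rewrite E in h3; exact: (cvg_unique _ h3 h1).
Qed.

Lemma infprod_near1 m : (2 <= m)%N -> (n0 <= m)%N -> nrm (P (- m%:Z) - 1) <= 2 * rinv R m.
Proof.
move=> m2 m0.
apply: (limit_dist_le (@hP (- m%:Z))) => M.
apply: le_trans (prod_near1 (a := fun i => c (- m%:Z - i%:Z)) m2 _ M) _ => [i|].
  have -> : - m%:Z - i%:Z = - (m + i)%N%:Z by rewrite PoszD opprD.
  by apply: cneg; rewrite (leq_trans m0)// leq_addr.
by have := inv_nat_ge0 R (m + M); lra.
Qed.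

Lemma infprod_minfty : to_minfty P 1.
Proof.
apply/cvg_nrmP => e e0; have e2 : 0 < e / 2 by rewrite divr_gt0.
have [N N0 hN] := exists_inv_le e2.
exists (maxn (maxn 2 n0) N) => m; rewrite !geq_max => /andP[/andP[m2 m0] /hN h].
by apply: le_trans (infprod_near1 m2 m0) _; lra.
Qed.

(** Far to the left [P] lies within 1/2 of 1 (from index -4 on), and the recursion climbs from there
    to [n] through nonzero factors. *)
Lemma infprod_neq0 n : P n != 0.
Proof.
pose m := maxn 4 (maxn n0 `|n|%N).
have m4 : (4 <= m)%N by rewrite leq_max leqnn.
have mn0 : (n0 <= m)%N by rewrite leq_max leq_max leqnn orbT.
have mn : (`|n| <= m)%N by rewrite leq_max leq_max leqnn !orbT.
have Pm : P (- m%:Z) != 0.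
  have h1 := infprod_near1 (leq_trans (isT : (2 <= 4)%N) m4) mn0.
  have := @inv_nat_le R 4 m isT m4; rewrite {2}/rinv => h2.
  by apply: contraTneq h1 => ->; rewrite sub0r nrmN nrm1 -ltNge; lra.
have Pk k : P (- m%:Z + k%:Z) != 0.
  elim: k => [|k IH]; first by rewrite addr0.
  rewrite infprod_rec mulf_neq0//.
  by have -> : - m%:Z + k.+1%:Z - 1 = - m%:Z + k%:Z :> int by rewrite -addn1 PoszD; ring.
have h : 0 <= m%:Z + n by move: mn; case: (n) => k /=; lia.
by have := Pk (absz (m%:Z + n)); rewrite gez0_abs// addKr.
Qed.

(** Nonvanishing of each [P n] does not pass to the limit; the products of the factors from [m] on
    stay above 1/2 in modulus, which bounds [P] away from 0. *)
Lemma infprod_lim_neq0 Pinf : to_pinfty P Pinf -> Pinf != 0.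
Proof.
move=> hinf.
pose m := maxn 4 n0.
have m4 : (4 <= m)%N by rewrite leq_max leqnn.
have mn0 : (n0 <= m)%N by rewrite leq_max leqnn orbT.
have PM M : P (m%:Z - 1 + M%:Z) = P (m%:Z - 1) * \prod_(i < M) c (m + i)%N%:Z.
  elim: M => [|M IH]; first by rewrite big_ord0 mulr1 addr0.
  rewrite infprod_rec big_ord_recr /= mulrA -{1}mulrC.
  have -> : m%:Z - 1 + M.+1%:Z - 1 = m%:Z - 1 + M%:Z :> int by rewrite -addn1 PoszD; ring.
  have -> : m%:Z - 1 + M.+1%:Z = (m + M)%N%:Z :> int by rewrite -addn1 !PoszD; ring.
  by rewrite IH.
have low M : nrm (P (m%:Z - 1)) / 2 <= nrm (P (m%:Z - 1 + M%:Z)).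
  rewrite PM nrmM ler_wpM2l ?nrm_ge0//.
  have h1 : nrm (\prod_(i < M) c (m + i)%N%:Z - 1) <= 2 * (rinv R m - rinv R (m + M)).
    apply: (@prod_near1 R (fun i => c (m + i)%N%:Z) m); first exact: leq_trans m4.
    by move=> i; apply: cpos; rewrite (leq_trans mn0)// leq_addr.
  have := @inv_nat_le R 4 m isT m4; rewrite {2}/rinv => h2; have h3 := inv_nat_ge0 R (m + M).
  move: h1; set X := \prod_(i < M) _ => h1.
  by have := nrm_triangleB X (X - 1); rewrite subKr nrm1; lra.
have pos : 0 < nrm (P (m%:Z - 1)) / 2 by rewrite divr_gt0// nrm_gt0 infprod_neq0.
have p4 : 0 < nrm (P (m%:Z - 1)) / 4 by rewrite divr_gt0// nrm_gt0 infprod_neq0.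
have [N hN] := (cvg_nrmP _ _).1 hinf _ p4.
have := hN (m + N)%N (leq_addl _ _); have := low N.+1.
have -> : m%:Z - 1 + N.+1%:Z = (m + N)%N%:Z :> int by rewrite -addn1 !PoszD; ring.
move=> h1 h2; apply: contraTneq h2 => ->; rewrite subr0 -ltNge; lra.
Qed.

End InfiniteProducts.

(** * Algebra of functions analytic up to the boundary *)

Section AnalyticClosure.
Variable R : realType.
Local Notation C := (Cx R).
Variables A Acl : set C.
Implicit Types f g : C -> C.

Lemma analytic_ext_add f g : analytic_ext A Acl f -> analytic_ext A Acl g ->
  analytic_ext A Acl (fun z => f z + g z).
Proof.
move=> [df cf] [dg cg]; split; first by move=> z Az; exact: (derivable_add (df z Az) (dg z Az)).
apply/within_nrmP => z iz e1 e10.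
have e12 : 0 < e1 / 2 by rewrite divr_gt0.
have [d1 d10 h1] := (within_nrmP _ _).1 cf z iz _ e12.
have [d2 d20 h2] := (within_nrmP _ _).1 cg z iz _ e12.
exists (Num.min d1 d2); first by rewrite lt_min d10.
move=> x ix; rewrite lt_min => /andP[/(h1 x ix) {}h1 /(h2 x ix) {}h2].
move: h1 h2; move: (f x) (f z) (g x) (g z) => a b a' b' h1 h2.
have -> : a + a' - (b + b') = (a - b) + (a' - b') by ring.
by apply: le_trans (nrm_triangle _ _) _; lra.
Qed.

Lemma analytic_ext_mul f g : analytic_ext A Acl f -> analytic_ext A Acl g ->
  analytic_ext A Acl (fun z => f z * g z).
Proof.
move=> [df cf] [dg cg]; split; first by move=> z Az; exact: (derivable_mul (df z Az) (dg z Az)).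
apply/subspace_continuousP => z Az.
have hf := (subspace_continuousP _ _).1 cf z Az.
have hg := (subspace_continuousP _ _).1 cg z Az.
exact: (cvgM hf hg).
Qed.

Lemma analytic_ext_derivable f : A `<=` Acl -> (forall z, Acl z -> derivable f z 1) ->
  analytic_ext A Acl f.
Proof.
move=> AA df; split; first by move=> z /AA; exact: df.
apply/within_nrmP => z Az e e0.
have [d d0 hd] := (continuous_nrmP f z).1 (derivable_cont (df z Az)) e e0.
by exists d => // w _; exact: hd.
Qed.

Lemma analytic_ext_sub f g : analytic_ext A Acl f -> analytic_ext A Acl g ->
  analytic_ext A Acl (fun z => f z - g z).
Proof.
move=> hf hg.
have -> : (fun z => f z - g z) = (fun z => f z + (-1) * g z).
  by apply/funext => z; rewrite mulN1r.
exact: (analytic_ext_add hf (analytic_ext_mul (analytic_ext_cst A Acl (-1)) hg)).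
Qed.

End AnalyticClosure.

(** * Jost solutions do not vanish *)

Section JostNonvanishing.
Variable R : realType.
Local Notation C := (Cx R).
Variables (tau : C -> C) (b11 b12 b21 b22 : nat -> C -> C) (u : nat -> R) (n0 : nat).
Hypothesis u_ge0 : forall n, 0 <= u n.
Hypothesis u_le : forall m n, (n0 <= m)%N -> (m <= n)%N -> u n <= u m.
Hypothesis u_lim : forall e : R, 0 < e -> exists N, forall n, (N <= n)%N -> u n <= e.
Hypothesis tau1 : forall z, inner_cl z -> nrm (tau z) <= 1.
Hypothesis hb : forall n z, (n0 <= n)%N -> inner_cl z ->
  [/\ nrm (b11 n z) <= u n - u n.+1, nrm (b12 n z) <= u n - u n.+1,
      nrm (b21 n z) <= u n - u n.+1 & nrm (b22 n z) <= u n - u n.+1].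
Let an f := analytic_ext (@inner R) (@inner_cl R) f.
Hypothesis an_tau : an tau.
Hypothesis an_b : forall n, [/\ an (b11 n), an (b12 n), an (b21 n) & an (b22 n)].

(** After division by $z^n$ the recursion is $\mathrm{diag}(\tau,1)$ with $|\tau|\le1$, plus a
    perturbation bounded by the increments of [u], whose sums telescope. *)
Let step n z (v : C * C) : C * C :=
  (tau z * v.1 + (b11 n z * v.1 + b12 n z * v.2), v.2 + (b21 n z * v.1 + b22 n z * v.2)).

(* Stands in for the Jost solution, the potentials being cut off beyond [n + d]. *)
Fixpoint approx (d n : nat) (z : C) : C * C :=
  if d is d'.+1 then step n z (approx d' n.+1 z) else (0, 1).

Lemma analytic_approx d n : an (fun z => (approx d n z).1) /\ an (fun z => (approx d n z).2).
Proof.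
elim: d n => [|d IH] n; first by split; exact: analytic_ext_cst.
have [h1 h2] := IH n.+1; have [a11 a12 a21 a22] := an_b n.
split; rewrite /=.
- exact: (analytic_ext_add (analytic_ext_mul an_tau h1)
    (analytic_ext_add (analytic_ext_mul a11 h1) (analytic_ext_mul a12 h2))).
- exact: (analytic_ext_add h2
    (analytic_ext_add (analytic_ext_mul a21 h1) (analytic_ext_mul a22 h2))).
Qed.

Lemma step_le n z v M : (n0 <= n)%N -> inner_cl z -> nrm v.1 + nrm v.2 <= M ->
  nrm (b11 n z * v.1 + b12 n z * v.2) + nrm (b21 n z * v.1 + b22 n z * v.2) <=
  2 * (u n - u n.+1) * M.
Proof.
move=> nn iz hv; have [h11 h12 h21 h22] := hb nn iz.
have n1 := nrm_ge0 v.1; have n2 := nrm_ge0 v.2.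
have k0 : 0 <= u n - u n.+1 by rewrite subr_ge0 u_le.
have t1 := nrm_triangle (b11 n z * v.1) (b12 n z * v.2).
have t2 := nrm_triangle (b21 n z * v.1) (b22 n z * v.2).
rewrite !nrmM in t1 t2.
have p11 := ler_wpM2r n1 h11; have p12 := ler_wpM2r n2 h12.
have p21 := ler_wpM2r n1 h21; have p22 := ler_wpM2r n2 h22.
have := ler_wpM2l k0 hv; lra.
Qed.

Variable n1 : nat.
Hypothesis n01 : (n0 <= n1)%N.
Hypothesis hn1 : 6 * u n1 <= 2^-1.

Let ur_le n : (n1 <= n)%N -> u n <= u n1.
Proof. by move=> nn; exact: u_le. Qed.

(** The bound for [n.+1] and [6 * u n1 <= 2^-1] give the a priori bound 3 for the vector; a step
    then adds at most twice 3 times the increment of [u], whence the constant 6. *)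
Lemma approx_near d n z : (n1 <= n)%N -> inner_cl z ->
  nrm (approx d n z).1 + nrm ((approx d n z).2 - 1) <=
  6 * (u n - u (n + d)%N).
Proof.
move=> + iz; elim: d n => [|d IH] n nn; first by rewrite /= addn0 !subrr nrm0 addr0 mulr0.
have := IH n.+1 (leqW nn); rewrite addSnnS /=.
move: (approx d n.+1 z) => v hv.
have kr := ur_le nn; have kr' := ur_le (leqW nn).
have kd := u_ge0 (n + d.+1)%N.
have v3 : nrm v.1 + nrm v.2 <= 3.
  have := nrm_triangle (v.2 - 1) 1; rewrite subrK nrm1.
  by have h := hn1; lra.
have s := step_le (leq_trans n01 nn) iz v3.
have t1 := nrm_triangle (tau z * v.1) (b11 n z * v.1 + b12 n z * v.2).
have t2 := nrm_triangle (v.2 - 1) (b21 n z * v.1 + b22 n z * v.2).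
rewrite (addrAC v.2); rewrite nrmM in t1.
have := ler_wpM2r (nrm_ge0 v.1) (tau1 iz); rewrite mul1r.
by have h := hn1; lra.
Qed.

Variables x y : nat -> C -> C.
Hypothesis hxy : forall n z, inner_cl z -> (x n z, y n z) = step n z (x n.+1 z, y n.+1 z).
Hypothesis an_y : forall n, an (y n).
Hypothesis limx : forall z, nrm z = 1 -> (fun n => x n z) @ \oo --> (0 : C).
Hypothesis limy : forall z, nrm z = 1 -> (fun n => y n z) @ \oo --> (1 : C).

Let diff d n z := nrm (x n z - (approx d n z).1) + nrm (y n z - (approx d n z).2).

(** A discrete Gronwall inequality. In place of a product of growth factors it has a linear factor
    $\alpha\le1$ on the left, for which $\alpha(1+2\kappa)\le\alpha+2\kappa$, so the increments
    telescope again. *)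
Lemma approx_diff d n z : (n1 <= n)%N -> inner_cl z ->
  diff d n z * (1 - 2 * (u n - u (n + d)%N)) <=
  nrm (x (n + d)%N z) + nrm (y (n + d)%N z - 1).
Proof.
move=> + iz; elim: d n => [|d IH] n nn.
  by rewrite /diff /= addn0 subr0 subrr mulr0 subr0 mulr1.
have := IH n.+1 (leqW nn); rewrite addSnnS; apply: le_trans.
have kr := ur_le nn; have kr' := ur_le (leqW nn).
have kd := u_ge0 (n + d.+1)%N.
have kw : 0 <= u n - u n.+1 by rewrite subr_ge0 u_le// (leq_trans n01).
have [hx hy] : x n z = (step n z (x n.+1 z, y n.+1 z)).1 /\
    y n z = (step n z (x n.+1 z, y n.+1 z)).2.
  by rewrite -hxy.
have D1 : diff d.+1 n z <= diff d n.+1 z * (1 + 2 * (u n - u n.+1)).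
  rewrite /diff hx hy /=; move: (approx d n.+1 z) (x n.+1 z) (y n.+1 z) => v a b.
  have s := @step_le n z (a - v.1, b - v.2) _ (leq_trans n01 nn) iz (lexx _).
  rewrite /= in s.
  set p := (X in nrm X + _); set r := (X in _ + nrm X).
  have -> : p = tau z * (a - v.1) + (b11 n z * (a - v.1) + b12 n z * (b - v.2)) by rewrite /p; ring.
  have -> : r = (b - v.2) + (b21 n z * (a - v.1) + b22 n z * (b - v.2)) by rewrite /r; ring.
  apply: le_trans (lerD (nrm_triangle _ _) (nrm_triangle _ _)) _.
  rewrite nrmM; have := ler_wpM2r (nrm_ge0 (a - v.1)) (tau1 iz); rewrite mul1r.
  lra.
have d0 : 0 <= diff d n.+1 z by rewrite addr_ge0 ?nrm_ge0.
set al := 1 - 2 * (u n - u (n + d.+1)%N).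
have al0 : 0 <= al by have h := hn1; rewrite /al; lra.
have E : 1 - 2 * (u n.+1 - u (n + d.+1)%N) = al + 2 * (u n - u n.+1).
  by rewrite /al; ring.
rewrite E; apply: le_trans (ler_wpM2r al0 D1) _.
rewrite -mulrA; apply: ler_wpM2l => //.
have : 0 <= (u n - u n.+1) * (1 - al).
  rewrite mulr_ge0// /al opprB addrC subrK mulr_ge0// subr_ge0 u_le ?leq_addr//.
  exact: leq_trans nn.
lra.
Qed.

Lemma approx_diff2 d n z : (n1 <= n)%N -> inner_cl z ->
  diff d n z <= 2 * (nrm (x (n + d)%N z) + nrm (y (n + d)%N z - 1)).
Proof.
move=> nn iz; have := approx_diff d nn iz.
have kr := ur_le nn.
have kd := u_ge0 (n + d)%N.
have d0 : 0 <= diff d n z by rewrite addr_ge0 ?nrm_ge0.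
have h2 : 2^-1 <= 1 - 2 * (u n - u (n + d)%N).
  by have h := hn1; lra.
have := ler_wpM2l d0 h2; lra.
Qed.

(** On the unit circle the right-hand side of [approx_diff2] tends to 0 as [d] grows; inside the
    disc no such asymptotics are at hand. *)
Lemma boundary_near n z : (n1 <= n)%N -> nrm z = 1 ->
  nrm (x n z) + nrm (y n z - 1) <= 6 * u n.
Proof.
move=> nn z1; apply/ler_addgt0Pr => e e0.
have iz : inner_cl z by apply/inner_clP; rewrite z1 ltr01 lexx.
have e4 : 0 < e / 4 by rewrite divr_gt0.
have [N1 h1] := (cvg_nrmP _ _).1 (@limx z z1) _ e4.
have [N2 h2] := (cvg_nrmP _ _).1 (@limy z z1) _ e4.
pose d := maxn N1 N2.
have := h1 (n + d)%N; rewrite (leq_trans (leq_maxl N1 N2) (leq_addl _ _)) subr0 => /(_ isT) {}h1.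
have := h2 (n + d)%N; rewrite (leq_trans (leq_maxr N1 N2) (leq_addl _ _)) => /(_ isT) {}h2.
have := approx_diff2 d nn iz; have := approx_near d nn iz; rewrite /diff.
have kd := u_ge0 (n + d)%N.
move: (approx d n z) => v g1 g2.
have := nrm_triangle (x n z - v.1) v.1; rewrite subrK.
have := nrm_triangle (y n z - v.2) (v.2 - 1).
have -> : y n z - v.2 + (v.2 - 1) = y n z - 1 by ring.
lra.
Qed.

Lemma jost_nonvanishing z : inner z -> y n1 z != 0.
Proof.
move=> iz.
have gB N w : inner_cl w -> nrm ((approx N n1 w).2 - 1) <= 2^-1.
  move=> iw; have := approx_near N (leqnn n1) iw.
  have := nrm_ge0 (approx N n1 w).1.
  by have kd := u_ge0 (n1 + N)%N; have kn := u_ge0 n1; have h := hn1; lra.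
have fg (e : R) : 0 < e -> exists N, forall w, nrm w = 1 -> nrm (y n1 w - (approx N n1 w).2) <= e.
  move=> e0.
  (* 12 is the factor 2 of [approx_diff2] times the factor 6 of [boundary_near], whose bound does
     not depend on the point of the circle. *)
  have k1 : 0 < e / 12 by rewrite divr_gt0.
  have [N hN] := u_lim k1; exists N => w w1.
  have iw : inner_cl w by apply/inner_clP; rewrite w1 ltr01 lexx.
  have := approx_diff2 N (leqnn n1) iw; rewrite /diff.
  have := boundary_near (leq_addr N n1) w1.
  have := hN (n1 + N)%N (leq_addl _ _).
  have := nrm_ge0 (x n1 w - (approx N n1 w).1).
  lra.
have h := @inner_approx R (y n1) (fun N z => (approx N n1 z).2) 1 2^-1 (an_y n1)
  (fun N => (analytic_approx N n1).2) gB fg z iz.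
apply: contraTneq h => ->; rewrite sub0r nrmN nrm1 -ltNge; lra.
Qed.

End JostNonvanishing.

(** * System (Q) in perturbative form *)

Section JostQ.
Variable R : realType.
Local Notation C := (Cx R).
Implicit Types (z w : C) (q r : int -> C).

Lemma limit0_mul (u v : nat -> C) : u @ \oo --> (0 : C) -> (forall n, nrm (v n) = 1) ->
  (fun n => u n * v n) @ \oo --> (0 : C).
Proof.
move=> /cvg_nrmP hu hv; apply/cvg_nrmP => e e0; have [N hN] := hu e e0.
by exists N => n /hN; rewrite !subr0 nrmM hv mulr1.
Qed.

Lemma exprzN_nat z (n : nat) : z ^ (- n%:Z) = z^-1 ^+ n.
Proof. by rewrite -exprnN exprVn. Qed.

Lemma nrm_unit_exp z n : nrm z = 1 -> nrm (z ^+ n) = 1.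
Proof. by move=> z1; rewrite nrmX z1 expr1n. Qed.

Lemma nrm_unit_inv z : nrm z = 1 -> nrm z^-1 = 1.
Proof. by move=> z1; rewrite nrmV z1 invr1. Qed.

Lemma nrm_unit_expz z (n : int) : nrm z = 1 -> nrm (z ^ n) = 1.
Proof.
move=> z1; case: n => n; first exact: nrm_unit_exp.
by rewrite NegzE exprzN_nat nrm_unit_exp// nrm_unit_inv.
Qed.

Lemma rinv2_lim (e : R) : 0 < e -> exists N, forall n, (N <= n)%N -> 2 * rinv R n <= e.
Proof.
move=> e0; have e2 : 0 < e / 2 by rewrite divr_gt0.
have [N N0 hN] := exists_inv_le e2; exists N => n /hN h.
by lra.
Qed.

Lemma analytic_ext_derivable_inner (f : C -> C) : (forall z, z != 0 -> derivable f z 1) ->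
  analytic_ext (@inner R) (@inner_cl R) f.
Proof.
move=> df; apply: analytic_ext_derivable => [z /innerP/andP[z0 z1]|z /inner_clP/andP[z0 _]].
  by apply/inner_clP; rewrite z0 ltW.
by apply: df; rewrite -nrm_gt0.
Qed.

Lemma analytic_ext_derivable_outer (f : C -> C) : (forall z, z != 0 -> derivable f z 1) ->
  analytic_ext (@outer R) (@outer_cl R) f.
Proof.
move=> df; apply: analytic_ext_derivable => [z /outerP z1|z /outer_clP z1].
  by apply/outer_clP; rewrite ltW.
by apply: df; rewrite -nrm_gt0; lra.
Qed.

Lemma derivable_invexp n z : z != 0 -> derivable (fun x : C => x^-1 ^+ n) z 1.
Proof.
move=> z0; have d1 := is_derivable (is_derive_inv z0 (is_derive_idfun z)).
exact: (derivable_comp d1 (@derivable_exp R n z^-1)).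
Qed.

Section Decaying.
Variables q r : int -> C.
Hypotheses (hq : rapid_decay q) (hr : rapid_decay r).

Let data : exists2 n0 : nat, (0 < n0)%N & forall n, (n0 <= n)%N ->
  nrm (q n%:Z) <= wt R n /\ nrm (r n%:Z) <= wt R n.
Proof.
have [n1 n10 h1] := rapid_decay_wt hq; have [n2 n20 h2] := rapid_decay_wt hr.
exists (maxn n1 n2); first by rewrite leq_max n10.
by move=> n; rewrite geq_max => /andP[/h1[? _] /h2[? _]].
Qed.

Lemma system_nonvanishing (x y : nat -> C -> C) (b11 b12 b21 b22 : nat -> C -> C) :
  (forall n, [/\ analytic_ext (@inner R) (@inner_cl R) (b11 n),
     analytic_ext (@inner R) (@inner_cl R) (b12 n),
     analytic_ext (@inner R) (@inner_cl R) (b21 n) &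
     analytic_ext (@inner R) (@inner_cl R) (b22 n)]) ->
  (forall n z, nrm (q n%:Z) <= wt R n -> nrm (r n%:Z) <= wt R n -> (0 < n)%N -> inner_cl z ->
    [/\ nrm (b11 n z) <= 2 * wt R n, nrm (b12 n z) <= 2 * wt R n,
        nrm (b21 n z) <= 2 * wt R n & nrm (b22 n z) <= 2 * wt R n]) ->
  (forall n z, inner_cl z ->
    (x n z, y n z) = (z ^+ 2 * x n.+1 z + (b11 n z * x n.+1 z + b12 n z * y n.+1 z),
      y n.+1 z + (b21 n z * x n.+1 z + b22 n z * y n.+1 z))) ->
  (forall n, analytic_ext (@inner R) (@inner_cl R) (y n)) ->
  (forall z, nrm z = 1 -> (fun n => x n z) @ \oo --> (0 : C)) ->
  (forall z, nrm z = 1 -> (fun n => y n z) @ \oo --> (1 : C)) ->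
  forall z, inner z -> exists n, y n z != 0.
Proof.
move=> ab hb hxy ay lx ly z iz; have [n0 n00 h0] := data.
(* The threshold 1/12 for [2 * rinv R n] yields the bound 1/2 needed after multiplication by 6. *)
have [N hN] := rinv2_lim (divr_gt0 ltr01 (ltr0Sn R 11)).
exists (maxn n0 N).
apply: (@jost_nonvanishing R (fun z => z ^+ 2) b11 b12 b21 b22 (fun n => 2 * rinv R n) n0
  _ _ _ _ _ _ ab _ _ _ x y hxy ay lx ly z iz).
- by move=> n; rewrite mulr_ge0// inv_nat_ge0.
- move=> m n nm mn; rewrite ler_wpM2l//; apply: inv_nat_le => //.
  exact: leq_trans nm.
- exact: rinv2_lim.
- by move=> w /inner_clP/andP[w0 w1]; rewrite nrmX exprn_ile1// nrm_ge0.
- move=> n w nn iw; rewrite -mulrBr; have [k1 k2] := h0 n nn.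
  by apply: hb => //; exact: leq_trans nn.
- apply: analytic_ext_derivable_inner => w _; exact: (@derivable_exp R 2 w).
- exact: leq_maxl.
- have := hN _ (leq_maxr n0 N); lra.
Qed.

Let an f := analytic_ext (@inner R) (@inner_cl R) f.

Let an_sq1 : an (fun z => z ^+ 2 - 1).
Proof.
apply: analytic_ext_derivable_inner => w _.
exact: (derivable_sub (@derivable_exp R 2 w) (@derivable_cstf R 1 w)).
Qed.

Let an_sq : an (fun z => z ^+ 2).
Proof. by apply: analytic_ext_derivable_inner => w _; exact: (@derivable_exp R 2 w). Qed.

Let nrm_sq1 z : inner_cl z -> nrm (z ^+ 2 - 1) <= 2.
Proof.
move=> /inner_clP/andP[z0 z1]; apply: le_trans (nrm_triangleB _ _) _.
rewrite nrm1 nrmX; have : nrm z ^+ 2 <= 1 by rewrite exprn_ile1// nrm_ge0.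
lra.
Qed.

Let nrm_qr n : (0 < n)%N -> nrm (q n%:Z) <= wt R n -> nrm (r n%:Z) <= wt R n ->
  nrm (q n%:Z * r n%:Z) <= wt R n.
Proof.
move=> n0 h1 h2; rewrite nrmM -[leRHS]mulr1; apply: ler_pM; rewrite ?nrm_ge0//.
exact: le_trans h2 (wt_le1 R n0).
Qed.

(** Multiplication by $z^{-n}$ makes the second component tend to 1 on the circle and leaves only
    nonnegative powers of [z] in the coefficients, which are then bounded on the closed disc. *)
Lemma psi_nonvanishing (psi : C -> int -> C * C) :
  (forall z, inner_cl z -> solves (sysQ q r) z (psi z)) ->
  (forall n, analytic_ext (@inner R) (@inner_cl R) (fun z => (psi z n).2)) ->
  (forall z, nrm z = 1 -> to_pinfty (fun n => (psi z n).1) 0) ->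
  (forall z, nrm z = 1 -> to_pinfty (fun n => (psi z n).2 * z ^ (- n)) 1) ->
  forall z, inner z -> exists n, (psi z n).2 != 0.
Proof.
move=> spsi apsi l1 l2 z iz.
pose x (n : nat) z := (psi z n%:Z).1 * z^-1 ^+ n.
pose y (n : nat) z := (psi z n%:Z).2 * z^-1 ^+ n.
pose b11 (n : nat) (z : C) : C := 0.
pose b12 (n : nat) (z : C) := (z ^+ 2 - 1) * q n%:Z.
pose b21 (n : nat) (z : C) := z ^+ 2 * r n%:Z.
pose b22 (n : nat) (z : C) := (z ^+ 2 - 1) * (q n%:Z * r n%:Z).
have [||||||n hn] := @system_nonvanishing x y b11 b12 b21 b22 _ _ _ _ _ _ z iz.
- move=> n; split.
  + exact: analytic_ext_cst.
  + exact: (analytic_ext_mul an_sq1 (analytic_ext_cst _ _ _)).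
  + exact: (analytic_ext_mul an_sq (analytic_ext_cst _ _ _)).
  + exact: (analytic_ext_mul an_sq1 (analytic_ext_cst _ _ _)).
- move=> n w h1 h2 n0 iw; have s1 := nrm_sq1 iw.
  have w0 : 0 <= wt R n by rewrite wt_ge0.
  have s2 : nrm (w ^+ 2) <= 1.
    by rewrite nrmX; case/inner_clP/andP: iw => ? ?; rewrite exprn_ile1// nrm_ge0.
  split; rewrite /b11 /b12 /b21 /b22.
  + by rewrite nrm0 mulr_ge0.
  + by rewrite nrmM ler_pM ?nrm_ge0.
  + rewrite nrmM; apply: ler_pM; rewrite ?nrm_ge0//; lra.
  + by rewrite nrmM; apply: ler_pM; rewrite ?nrm_ge0// nrm_qr.
- move=> n w /[dup] /spsi/(_ n%:Z) + /inner_clP/andP[w0 _].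
  have -> : n%:Z + 1 = n.+1%:Z :> int by rewrite -addn1 PoszD.
  rewrite /x /y /b11 /b12 /b21 /b22 => ->; rewrite /sysQ /= (exprSr _ n).
  have wn0 : w != 0 by rewrite -nrm_gt0.
  by move: (w^-1 ^+ n) => t; congr pair; field.
- move=> n; apply: (analytic_ext_mul (apsi n%:Z)).
  by apply: analytic_ext_derivable_inner => w w0; exact: derivable_invexp.
- move=> w w1; apply: (limit0_mul (l1 w w1)) => n.
  by rewrite nrm_unit_exp// nrm_unit_inv.
- move=> w w1; have := l2 w w1; rewrite /to_pinfty.
  by under eq_fun do rewrite exprzN_nat.
exists n%:Z; apply: contraNneq hn => h0; by rewrite /y h0 mul0r.
Qed.

(** Under $z\mapsto z^{-1}$ and exchange of the components, the exterior problem takes the same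
    perturbative form in the disc. *)
Lemma psib_nonvanishing (psib : C -> int -> C * C) :
  (forall z, outer_cl z -> solves (sysQ q r) z (psib z)) ->
  (forall n, analytic_ext (@outer R) (@outer_cl R) (fun z => (psib z n).1)) ->
  (forall z, nrm z = 1 -> to_pinfty (fun n => (psib z n).1 * z ^ n) 1) ->
  (forall z, nrm z = 1 -> to_pinfty (fun n => (psib z n).2) 0) ->
  forall z, outer z -> exists n, (psib z n).1 != 0.
Proof.
move=> spsi apsi l1 l2 z oz.
pose x (n : nat) z := (psib z^-1 n%:Z).2 * z^-1 ^+ n.
pose y (n : nat) z := (psib z^-1 n%:Z).1 * z^-1 ^+ n.
pose b11 (n : nat) (z : C) := (-1) * ((z ^+ 2 - 1) * (q n%:Z * r n%:Z)).
pose b12 (n : nat) (z : C) := r n%:Z.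
pose b21 (n : nat) (z : C) := (-1) * ((z ^+ 2 - 1) * q n%:Z).
pose b22 (n : nat) (z : C) : C := 0.
have iz : inner z^-1.
  move/outerP: oz => oz; apply/innerP; rewrite nrmV invf_lt1 ?oz ?invr_gt0 ?andbT; lra.
have [||||||n hn] := @system_nonvanishing x y b11 b12 b21 b22 _ _ _ _ _ _ z^-1 iz.
- move=> n; split.
  + exact: (analytic_ext_mul (analytic_ext_cst _ _ _)
      (analytic_ext_mul an_sq1 (analytic_ext_cst _ _ _))).
  + exact: analytic_ext_cst.
  + exact: (analytic_ext_mul (analytic_ext_cst _ _ _)
      (analytic_ext_mul an_sq1 (analytic_ext_cst _ _ _))).
  + exact: analytic_ext_cst.
- move=> n w h1 h2 n0 iw; have s1 := nrm_sq1 iw.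
  have w0 : 0 <= wt R n by rewrite wt_ge0.
  split; rewrite /b11 /b12 /b21 /b22 ?mulN1r ?nrmN.
  + by rewrite nrmM; apply: ler_pM; rewrite ?nrm_ge0// nrm_qr.
  + lra.
  + by rewrite nrmM ler_pM ?nrm_ge0.
  + by rewrite nrm0 mulr_ge0.
- move=> n w /inner_clP/andP[w0 w1].
  have ow : outer_cl w^-1 by apply/outer_clP; rewrite nrmV invf_ge1.
  have := spsi _ ow n%:Z.
  have -> : n%:Z + 1 = n.+1%:Z :> int by rewrite -addn1 PoszD.
  rewrite /x /y /b11 /b12 /b21 /b22 => ->; rewrite /sysQ /= (exprSr _ n) invrK.
  have wn0 : w != 0 by rewrite -nrm_gt0.
  by move: (w^-1 ^+ n) => t; congr pair; field.
- move=> n; apply: (analytic_ext_mul (analytic_ext_inv (apsi n%:Z))).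
  by apply: analytic_ext_derivable_inner => w w0; exact: derivable_invexp.
- move=> w w1; apply: (limit0_mul (l2 _ (nrm_unit_inv w1))) => n.
  by rewrite nrm_unit_exp// nrm_unit_inv.
- by move=> w w1; have := l1 _ (nrm_unit_inv w1).
exists n%:Z; apply: contraNneq hn; rewrite /y invrK => ->; by rewrite mul0r.
Qed.

End Decaying.

End JostQ.

(** * Wronskians and gauge transformations *)

Section Wronskian.
Variable R : realType.
Local Notation C := (Cx R).
Variables a b c d w : int -> C.
Hypothesis w0 : forall n, w n != 0.
Hypothesis hdet : forall n, a n * d n - b n * c n = w n / w (n + 1).

Definition linsol (Y : int -> C * C) := forall n : int,
  Y n = (a n * (Y (n + 1)).1 + b n * (Y (n + 1)).2, c n * (Y (n + 1)).1 + d n * (Y (n + 1)).2).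

Definition wronskian (Y X : int -> C * C) n := (Y n).1 * (X n).2 - (Y n).2 * (X n).1.

Lemma int_constant (f : int -> C) : (forall n, f n = f (n + 1)) -> forall n, f n = f 0.
Proof.
move=> hf; elim/int_ind => [//|n IH|n IH].
  by rewrite -addn1 PoszD -hf IH.
by rewrite hf -IH; congr f; rewrite -addn1 PoszD; ring.
Qed.

Lemma wronskian_constant Y X : linsol Y -> linsol X -> forall n,
  wronskian Y X n = wronskian Y X 0 / w 0 * w n.
Proof.
move=> sY sX n.
have h : forall n, wronskian Y X n / w n = wronskian Y X 0 / w 0.
  apply: int_constant => k; rewrite /wronskian (sY k) (sX k) /=.
  set y := Y (k + 1); set x := X (k + 1).
  transitivity ((a k * d k - b k * c k) * (y.1 * x.2 - y.2 * x.1) / w k); first by ring.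
  by rewrite hdet; field; rewrite !w0.
by rewrite -(h n) divfK.
Qed.

(** The sequence [e] is $n$ or $-n$, so both ends share one definition; [U] holds the unimodular
    factors $z^{\pm n}$, which need not converge. *)
Definition asymp (e : nat -> int) (U : nat -> C) (Y : int -> C * C) (A B : C) :=
  [/\ (forall n, nrm (U n) = 1), (fun n => (Y (e n)).1 * U n) @ \oo --> A &
      (fun n => (Y (e n)).2 * U n) @ \oo --> B].

Lemma asymp_wronskian e U V Y X A B A' B' : asymp e U Y A B -> asymp e V X A' B' ->
  (fun n => wronskian Y X (e n) * (U n * V n)) @ \oo --> A * B' - B * A'.
Proof.
move=> [_ y1 y2] [_ x1 x2].
have h := limitB (cvgM y1 x2) (cvgM y2 x1).
have -> : (fun n => wronskian Y X (e n) * (U n * V n)) =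
  (fun n => (Y (e n)).1 * U n * ((X (e n)).2 * V n) - (Y (e n)).2 * U n * ((X (e n)).1 * V n)).
  by apply/funext => n; rewrite /wronskian; ring.
exact: h.
Qed.

Lemma limit_unit_eq0 (u v : nat -> C) (l : C) : u @ \oo --> l -> (forall n, nrm (v n) = 1) ->
  (fun n => u n * v n) @ \oo --> (0 : C) -> l = 0.
Proof.
move=> ul hv /cvg_nrmP h0.
have h : u @ \oo --> (0 : C).
  apply/cvg_nrmP => e /h0[N hN]; exists N => n /hN.
  by rewrite !subr0 nrmM hv mulr1.
exact: (cvg_unique _ ul h).
Qed.

(** The Wronskian of [Y] with [X1] or [X2] is a constant times [w], and it tends to 0 while [w] does
    not, so it vanishes. That of [X1] and [X2] has modulus tending to 1, so they are independent and
    Cramer's rule gives [Y = 0]. *)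
Lemma asymp_unique e winf U V1 V2 Y X1 X2 : (fun n => w (e n)) @ \oo --> winf -> winf != 0 ->
  linsol Y -> linsol X1 -> linsol X2 -> asymp e U Y 0 0 -> asymp e V1 X1 1 0 ->
  asymp e V2 X2 0 1 -> forall n, Y n = (0, 0).
Proof.
move=> wl winf0 sY s1 s2 aY a1 a2 n.
have U1 : forall n, nrm (U n) = 1 by case: aY.
have zero X V A B : linsol X -> asymp e V X A B -> wronskian Y X n = 0.
  move=> sX aX; have V1' : forall n, nrm (V n) = 1 by case: aX.
  have := asymp_wronskian aY aX; rewrite !mul0r subrr => h.
  have h2 := @limitZ R _ _ (wronskian Y X 0 / w 0) wl.
  rewrite (wronskian_constant sY sX).
  have E : (fun n => wronskian Y X (e n) * (U n * V n)) =
      (fun n => wronskian Y X 0 / w 0 * w (e n) * (U n * V n)).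
    by apply/funext => k; rewrite (wronskian_constant sY sX (e k)).
  rewrite E in h.
  have UV k : nrm (U k * V k) = 1 by rewrite nrmM U1 V1' mul1r.
  have /eqP : wronskian Y X 0 / w 0 * winf = 0.
    exact: (limit_unit_eq0 (v := fun n => U n * V n) h2 UV h).
  by rewrite mulf_eq0 (negbTE winf0) orbF => /eqP ->; rewrite mul0r.
have z1 := zero _ _ _ _ s1 a1; have z2 := zero _ _ _ _ s2 a2.
have nz : wronskian X1 X2 n != 0.
  apply/eqP => h; have : wronskian X1 X2 0 / w 0 = 0.
    apply/eqP; move: h; rewrite (wronskian_constant s1 s2) => /eqP.
    by rewrite mulf_eq0 (negbTE (w0 n)) orbF.
  move=> k0; have := asymp_wronskian a1 a2; rewrite !mulr1 mulr0 subr0.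
  have -> : (fun n => wronskian X1 X2 (e n) * (V1 n * V2 n)) = (fun=> 0).
    by apply/funext => k; rewrite (wronskian_constant s1 s2) k0 !mul0r.
  move=> /cvg_nrmP/(_ (1 / 2)); rewrite divr_gt0// => -[]// N hN.
  by have := hN N (leqnn N); rewrite sub0r nrmN nrm1; lra.
have e1 : (Y n).1 * wronskian X1 X2 n = 0.
  have -> : (Y n).1 * wronskian X1 X2 n =
    (X1 n).1 * wronskian Y X2 n - (X2 n).1 * wronskian Y X1 n by rewrite /wronskian; ring.
  by rewrite z1 z2 !mulr0 subrr.
have e2 : (Y n).2 * wronskian X1 X2 n = 0.
  have -> : (Y n).2 * wronskian X1 X2 n =
    (X1 n).2 * wronskian Y X2 n - (X2 n).2 * wronskian Y X1 n by rewrite /wronskian; ring.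
  by rewrite z1 z2 !mulr0 subrr.
move/eqP: e1; rewrite mulf_eq0 (negbTE nz) orbF => /eqP e1.
move/eqP: e2; rewrite mulf_eq0 (negbTE nz) orbF => /eqP e2.
by rewrite [Y n]surjective_pairing e1 e2.
Qed.

End Wronskian.

Section Gauge.
Variable R : realType.
Local Notation C := (Cx R).
Variables q r a b kap : int -> C.
Variables (g11 g12 g21 g22 : C -> int -> C) (iota : C -> C) (km kp Ep Dp : C).
Hypotheses (hq : rapid_decay q) (hr : rapid_decay r).
Hypothesis kap0 : forall n, kap n != 0.
Hypothesis hdet : forall n, 1 - a n * b n = kap n / kap (n + 1).
Hypotheses (kap_m : to_minfty kap km) (kap_p : to_pinfty kap kp).
Hypotheses (km0 : km != 0) (kp0 : kp != 0).
Hypothesis hiota : forall z : C, z != 0 -> derivable iota z 1.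
Hypothesis hg : forall z n, z != 0 ->
  [/\ derivable (g11^~ n) z 1, derivable (g12^~ n) z 1,
      derivable (g21^~ n) z 1 & derivable (g22^~ n) z 1].

Definition gauge z (Y : int -> C * C) : int -> C * C := fun n =>
  (g11 z n * (Y n).1 + g12 z n * (Y n).2, g21 z n * (Y n).1 + g22 z n * (Y n).2).

Hypothesis gauge_sol : forall z Y, z != 0 -> solves (sysQ q r) z Y ->
  solves (sysU a b) z (gauge z Y).
Hypothesis gauge_p : forall z, nrm z = 1 ->
  [/\ to_pinfty (g11 z) Ep, to_pinfty (g12 z) 0, to_pinfty (g21 z) 0 &
      to_pinfty (g22 z) (Dp * iota z)].
Hypothesis gauge_m : forall z, nrm z = 1 ->
  [/\ to_minfty (g11 z) 1, to_minfty (g12 z) 0, to_minfty (g21 z) 0 &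
      to_minfty (g22 z) (iota z)].
Hypothesis gauge_det : forall z n, nrm z != 1 -> z != 0 ->
  g11 z n * g22 z n - g12 z n * g21 z n != 0.

Variables psiQ psibQ phiQ phibQ : C -> int -> C * C.
Hypothesis jQ : is_jost (sysQ q r) psiQ psibQ phiQ phibQ.
Variables psiU psibU phiU phibU : C -> int -> C * C.
Hypothesis jU : is_jost (sysU a b) psiU psibU phiU phibU.

Lemma unit_neq0 (z : C) : nrm z = 1 -> z != 0.
Proof. by move=> z1; rewrite -nrm_gt0 z1 ltr01. Qed.

Lemma unit_inner_cl (z : C) : nrm z = 1 -> inner_cl z.
Proof. by move=> z1; apply/inner_clP; rewrite z1 ltr01 lexx. Qed.

Lemma unit_outer_cl (z : C) : nrm z = 1 -> outer_cl z.
Proof. by move=> z1; apply/outer_clP; rewrite z1. Qed.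

Lemma inner_neq0 (z : C) : inner z -> z != 0.
Proof. by move=> /innerP/andP[z0 _]; rewrite -nrm_gt0. Qed.

Lemma outer_neq0 (z : C) : outer z -> z != 0.
Proof. by move=> /outerP z1; rewrite -nrm_gt0; lra. Qed.

Let lin z Y := linsol (fun=> z) (fun n => z * a n) (fun n => z^-1 * b n) (fun=> z^-1) Y.

Let lin_det z : z != 0 -> forall n, z * z^-1 - z * a n * (z^-1 * b n) = kap n / kap (n + 1).
Proof. by move=> z0 n; rewrite -hdet; field. Qed.

Lemma jost_asymp S psi psib phi phib z : @is_jost R S psi psib phi phib -> nrm z = 1 ->
  [/\ asymp (fun n => n%:Z) (fun n => z ^ (- n%:Z)) (psi z) 0 1,
      asymp (fun n => n%:Z) (fun n => z ^ n%:Z) (psib z) 1 0,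
      asymp (fun n => - n%:Z) (fun n => z ^ (- n%:Z)) (phi z) 1 0 &
      asymp (fun n => - n%:Z) (fun n => z ^ (- - n%:Z)) (phib z) 0 1].
Proof.
move=> [_ _ _ _ h5] z1; have : `|z| = 1 by rewrite normE z1 toC1.
move=> /h5[[p1 p2 p3 p4] [m1 m2 m3 m4]].
split; split.
- by move=> n; exact: nrm_unit_expz.
- exact: (@limit0_mul R _ (fun n : nat => z ^ (- n%:Z)) p1 (fun n => nrm_unit_expz (- n%:Z) z1)).
- exact: p2.
- by move=> n; exact: nrm_unit_expz.
- exact: p3.
- exact: (@limit0_mul R _ (fun n : nat => z ^ (n%:Z)) p4 (fun n => nrm_unit_expz (n%:Z) z1)).
- by move=> n; exact: nrm_unit_expz.
- exact: m1.
- exact: (@limit0_mul R _ (fun n : nat => z ^ (- n%:Z)) m2 (fun n => nrm_unit_expz (- n%:Z) z1)).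
- by move=> n; exact: nrm_unit_expz.
- exact: (@limit0_mul R _ (fun n : nat => z ^ (- - n%:Z)) m3
    (fun n => nrm_unit_expz (- - n%:Z) z1)).
- exact: m4.
Qed.

Lemma limit_comb (g h u v : nat -> C) (G A B : C) : g @ \oo --> G -> h @ \oo --> (0 : C) ->
  u @ \oo --> A -> v @ \oo --> B -> (fun n => g n * u n + h n * v n) @ \oo --> G * A.
Proof.
move=> hg' hh hu hv.
have h1 : (fun n => g n * u n) @ \oo --> G * A by exact: (cvgM hg' hu).
have h2 : (fun n => h n * v n) @ \oo --> 0 * B by exact: (cvgM hh hv).
have h3 : (fun n => g n * u n + h n * v n) @ \oo --> G * A + 0 * B by exact: (cvgD h1 h2).
by rewrite mul0r addr0 in h3.
Qed.

Lemma gauge_asymp e U z Y (al be A B : C) :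
  (fun n => g11 z (e n)) @ \oo --> al -> (fun n => g12 z (e n)) @ \oo --> (0 : C) ->
  (fun n => g21 z (e n)) @ \oo --> (0 : C) -> (fun n => g22 z (e n)) @ \oo --> be ->
  asymp e U Y A B -> asymp e U (gauge z Y) (al * A) (be * B).
Proof.
move=> l11 l12 l21 l22 [u1 y1 y2]; split; first exact: u1.
- have h := limit_comb l11 l12 y1 y2.
  have -> : (fun n => (gauge z Y (e n)).1 * U n) =
    (fun n => g11 z (e n) * ((Y (e n)).1 * U n) + g12 z (e n) * ((Y (e n)).2 * U n)).
    by apply/funext => n; rewrite /gauge /=; ring.
  exact: h.
- have h := limit_comb l22 l21 y2 y1.
  have -> : (fun n => (gauge z Y (e n)).2 * U n) =
    (fun n => g22 z (e n) * ((Y (e n)).2 * U n) + g21 z (e n) * ((Y (e n)).1 * U n)).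
    by apply/funext => n; rewrite /gauge /=; ring.
  exact: h.
Qed.

(** The difference of the gauge image and [c] times [X] has vanishing leading terms at one end, so
    [asymp_unique] applies. The two conditions on [c] allow [A] or [B] to be 0, the situation of
    each Jost solution. *)
Lemma gauge_unique e winf U V1 V2 z Y X X1 X2 (al be c A B : C) : nrm z = 1 ->
  (fun n => kap (e n)) @ \oo --> winf -> winf != 0 ->
  (fun n => g11 z (e n)) @ \oo --> al -> (fun n => g12 z (e n)) @ \oo --> (0 : C) ->
  (fun n => g21 z (e n)) @ \oo --> (0 : C) -> (fun n => g22 z (e n)) @ \oo --> be ->
  solves (sysQ q r) z Y -> solves (sysU a b) z X ->
  solves (sysU a b) z X1 -> solves (sysU a b) z X2 ->
  asymp e U Y A B -> asymp e U X A B -> asymp e V1 X1 1 0 -> asymp e V2 X2 0 1 ->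
  al * A = c * A -> be * B = c * B ->
  forall n, (gauge z Y n).1 = c * (X n).1 /\ (gauge z Y n).2 = c * (X n).2.
Proof.
move=> z1 kl w0 l11 l12 l21 l22 sY sX s1 s2 aY aX a1 a2 eA eB n.
have z0 := unit_neq0 z1.
pose Dl n := ((gauge z Y n).1 - c * (X n).1, (gauge z Y n).2 - c * (X n).2).
have sG := gauge_sol z0 sY.
have sD : lin z Dl.
  move=> k; rewrite /Dl (sG k) (sX k) /sysU /=.
  by congr pair; ring.
have [u1 h1 h2] := gauge_asymp l11 l12 l21 l22 aY.
have [_ h3 h4] := aX.
have aD : asymp e U Dl 0 0.
  split; first exact: u1.
  - have h := limitB h1 (@limitZ R _ _ c h3).
    rewrite eA subrr in h.
    have -> : (fun n => (Dl (e n)).1 * U n) =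
      (fun n => (gauge z Y (e n)).1 * U n - c * ((X (e n)).1 * U n)).
      by apply/funext => k; rewrite /Dl /=; ring.
    exact: h.
  - have h := limitB h2 (@limitZ R _ _ c h4).
    rewrite eB subrr in h.
    have -> : (fun n => (Dl (e n)).2 * U n) =
      (fun n => (gauge z Y (e n)).2 * U n - c * ((X (e n)).2 * U n)).
      by apply/funext => k; rewrite /Dl /=; ring.
    exact: h.
have := asymp_unique kap0 (lin_det z0) kl w0 sD s1 s2 aD a1 a2 n.
rewrite /Dl => -[/eqP + /eqP].
by rewrite !subr_eq0 => /eqP e1 /eqP e2; split; [exact: e1|exact: e2].
Qed.

Lemma gauge_boundary z : nrm z = 1 ->
  [/\ (forall n, (gauge z (phiQ z) n).1 = 1 * (phiU z n).1 /\
                 (gauge z (phiQ z) n).2 = 1 * (phiU z n).2),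
      (forall n, (gauge z (psiQ z) n).1 = Dp * iota z * (psiU z n).1 /\
                 (gauge z (psiQ z) n).2 = Dp * iota z * (psiU z n).2),
      (forall n, (gauge z (phibQ z) n).1 = iota z * (phibU z n).1 /\
                 (gauge z (phibQ z) n).2 = iota z * (phibU z n).2) &
      (forall n, (gauge z (psibQ z) n).1 = Ep * (psibU z n).1 /\
                 (gauge z (psibQ z) n).2 = Ep * (psibU z n).2)].
Proof.
move=> z1.
have [q1 q2 q3 q4] := jost_asymp jQ z1; have [u1 u2 u3 u4] := jost_asymp jU z1.
have [sQi sQo _ _ _] := jQ; have [sUi sUo _ _ _] := jU.
have [sq1 sq3] := sQi _ (unit_inner_cl z1); have [sq2 sq4] := sQo _ (unit_outer_cl z1).
have [su1 su3] := sUi _ (unit_inner_cl z1); have [su2 su4] := sUo _ (unit_outer_cl z1).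
have [p11 p12 p21 p22] := gauge_p z1; have [m11 m12 m21 m22] := gauge_m z1.
split.
- by apply: (gauge_unique z1 kap_m km0 m11 m12 m21 m22 sq3 su3 su3 su4 q3 u3 u3 u4); rewrite ?mulr0.
- by apply: (gauge_unique z1 kap_p kp0 p11 p12 p21 p22 sq1 su1 su2 su1 q1 u1 u2 u1); rewrite ?mulr0.
- by apply: (gauge_unique z1 kap_m km0 m11 m12 m21 m22 sq4 su4 su3 su4 q4 u4 u3 u4); rewrite ?mulr0.
- by apply: (gauge_unique z1 kap_p kp0 p11 p12 p21 p22 sq2 su2 su2 su1 q2 u2 u2 u1); rewrite ?mulr0.
Qed.

Lemma comb_inner (f1 f2 X h1 h2 c : C -> C) :
  let an f := analytic_ext (@inner R) (@inner_cl R) f in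
  an f1 -> an f2 -> an X -> an h1 -> an h2 -> an c ->
  (forall z, nrm z = 1 -> h1 z * f1 z + h2 z * f2 z = c z * X z) ->
  forall z, inner z -> c z * X z = h1 z * f1 z + h2 z * f2 z.
Proof.
move=> an a1 a2 aX b1 b2 ac h z iz.
have aF := analytic_ext_sub (analytic_ext_add (analytic_ext_mul b1 a1) (analytic_ext_mul b2 a2))
  (analytic_ext_mul ac aX).
have := inner_zero aF _ iz => /(_ _)/eqP; rewrite subr_eq0 => /(_ _)/eqP -> //.
by move=> w /h ->; rewrite subrr.
Qed.

Lemma comb_outer (f1 f2 X h1 h2 c : C -> C) :
  let an f := analytic_ext (@outer R) (@outer_cl R) f in
  an f1 -> an f2 -> an X -> an h1 -> an h2 -> an c ->
  (forall z, nrm z = 1 -> h1 z * f1 z + h2 z * f2 z = c z * X z) ->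
  forall z, outer z -> c z * X z = h1 z * f1 z + h2 z * f2 z.
Proof.
move=> an a1 a2 aX b1 b2 ac h z iz.
have aF := analytic_ext_sub (analytic_ext_add (analytic_ext_mul b1 a1) (analytic_ext_mul b2 a2))
  (analytic_ext_mul ac aX).
have := outer_zero aF _ iz => /(_ _)/eqP; rewrite subr_eq0 => /(_ _)/eqP -> //.
by move=> w /h ->; rewrite subrr.
Qed.

(** The unit circle is excluded since, for [(u, v)], the determinant has the factor [iota_U z],
    which vanishes at 1 and -1. *)
Lemma gauge_invertible z n (y1 y2 : C) : nrm z != 1 -> z != 0 ->
  g11 z n * y1 + g12 z n * y2 = 0 -> g21 z n * y1 + g22 z n * y2 = 0 -> y1 = 0 /\ y2 = 0.
Proof.
move=> z1 z0 h1 h2; have dn := gauge_det n z1 z0.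
set dt := _ - _ in dn.
have e1 : dt * y1 = g22 z n * (g11 z n * y1 + g12 z n * y2) -
  g12 z n * (g21 z n * y1 + g22 z n * y2) by rewrite /dt; ring.
have e2 : dt * y2 = g11 z n * (g21 z n * y1 + g22 z n * y2) -
  g21 z n * (g11 z n * y1 + g12 z n * y2) by rewrite /dt; ring.
rewrite h1 h2 !mulr0 subrr in e1 e2.
by split; apply/eqP; [move/eqP: e1|move/eqP: e2]; rewrite mulf_eq0 (negbTE dn).
Qed.

Let hA_in := @inner_annulus R.
Let hA_out := @outer_annulus R.

(** The gauge identities are needed on all of [inner], not just at [z0], because derivatives are
    compared. The multiplier of [psiU] depends on [z], so it enters through its jet. *)
Lemma gauge_dep_inner z0 m gQ gU : inner z0 -> (0 < m)%N ->
  dep_consts phiQ psiQ z0 m gQ -> dep_consts phiU psiU z0 m gU ->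
  eqm m (jet m (fun=> 1) z0 * egf m gU) (egf m gQ * jet m (fun z => Dp * iota z) z0).
Proof.
move=> iz m0 dQ dU.
have z00 := inner_neq0 iz.
have z01 : nrm z0 != 1 by rewrite lt_eqF//; case/innerP/andP: iz.
have [sQi _ aQi _ _] := jQ; have [_ _ aUi _ _] := jU.
have ag n : [/\ analytic_ext (@inner R) (@inner_cl R) (g11^~ n),
   analytic_ext (@inner R) (@inner_cl R) (g12^~ n),
   analytic_ext (@inner R) (@inner_cl R) (g21^~ n) &
   analytic_ext (@inner R) (@inner_cl R) (g22^~ n)].
  split; apply: analytic_ext_derivable_inner => z zn0; have [d1 d2 d3 d4] := hg n zn0.
  - exact: d1.
  - exact: d2.
  - exact: d3.
  - exact: d4.
have aio : analytic_ext (@inner R) (@inner_cl R) (fun z => Dp * iota z).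
  exact: (analytic_ext_mul (analytic_ext_cst _ _ Dp) (analytic_ext_derivable_inner hiota)).
have a1 : analytic_ext (@inner R) (@inner_cl R) (fun=> 1) by exact: analytic_ext_cst.
have phiE n z : inner z ->
    1 * (phiU z n).1 = g11 z n * (phiQ z n).1 + g12 z n * (phiQ z n).2 /\
    1 * (phiU z n).2 = g21 z n * (phiQ z n).1 + g22 z n * (phiQ z n).2.
  have [b11 b12 b21 b22] := ag n; have [_ _ k1 k2] := aQi n; have [_ _ k3 k4] := aUi n.
  move=> iz'; split.
    apply: (comb_inner k1 k2 k3 b11 b12 a1 _ iz') => w w1.
    by have [h _ _ _] := gauge_boundary w1; have [] := h n.
  apply: (comb_inner k1 k2 k4 b21 b22 a1 _ iz') => w w1.
  by have [h _ _ _] := gauge_boundary w1; have [] := h n.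
have psiE n z : inner z ->
    Dp * iota z * (psiU z n).1 = g11 z n * (psiQ z n).1 + g12 z n * (psiQ z n).2 /\
    Dp * iota z * (psiU z n).2 = g21 z n * (psiQ z n).1 + g22 z n * (psiQ z n).2.
  have [b11 b12 b21 b22] := ag n; have [k1 k2 _ _] := aQi n; have [k3 k4 _ _] := aUi n.
  move=> iz'; split.
    apply: (comb_inner k1 k2 k3 b11 b12 aio _ iz') => w w1.
    by have [_ h _ _] := gauge_boundary w1; have [] := h n.
  apply: (comb_inner k1 k2 k4 b21 b22 aio _ iz') => w w1.
  by have [_ h _ _] := gauge_boundary w1; have [] := h n.
have [n hn] : exists n, (psiQ z0 n).2 != 0.
  apply: (psi_nonvanishing hq hr _ _ _ _ iz).
  - by move=> z /sQi[].
  - by move=> n; have [] := aQi n.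
  - by move=> z z1; have [_ h _] := jost_asymp jQ z1; case: jQ => _ _ _ _ /(_ z);
      rewrite normE z1 toC1 => /(_ erefl)[[]].
  - by move=> z z1; have [[_ _ h] _ _ _] := jost_asymp jQ z1.
have [e1 e2] := dep_eqm dQ n; have [f1 f2] := dep_eqm dU n.
have [b11 b12 b21 b22] := ag n.
have [k1 k2 k3 k4] := aQi n; have [l1 l2 l3 l4] := aUi n.
have [x1|x1] := eqVneq (psiU z0 n).1 0; last first.
  exact: (dep_transfer hA_in m0 iz a1.1 aio.1 b11.1 b12.1 k3.1 k4.1 k1.1 k2.1 l3.1 l1.1
    (fun z iz => (phiE n z iz).1) (fun z iz => (psiE n z iz).1) e1 e2 f1 x1).
have [x2|x2] := eqVneq (psiU z0 n).2 0; last first.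
  exact: (dep_transfer hA_in m0 iz a1.1 aio.1 b21.1 b22.1 k3.1 k4.1 k1.1 k2.1 l4.1 l2.1
    (fun z iz => (phiE n z iz).2) (fun z iz => (psiE n z iz).2) e1 e2 f2 x2).
(* If both components of [psiU] vanished at [z0], so would the gauge image of [psiQ], and then
   [psiQ] itself, against the choice of [n]. *)
have [h1 h2] := psiE n z0 iz; rewrite x1 x2 !mulr0 in h1 h2.
have [_ h] := gauge_invertible z01 z00 (esym h1) (esym h2).
case/eqP: hn; exact: h.
Qed.

Lemma gauge_dep_outer z0 m gQ gU : outer z0 -> (0 < m)%N ->
  dep_consts phibQ psibQ z0 m gQ -> dep_consts phibU psibU z0 m gU ->
  eqm m (jet m iota z0 * egf m gU) (egf m gQ * jet m (fun=> Ep) z0).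
Proof.
move=> iz m0 dQ dU.
have z00 := outer_neq0 iz.
have z01 : nrm z0 != 1 by rewrite gt_eqF//; exact/outerP.
have [_ sQo _ aQo _] := jQ; have [_ _ _ aUo _] := jU.
have ag n : [/\ analytic_ext (@outer R) (@outer_cl R) (g11^~ n),
   analytic_ext (@outer R) (@outer_cl R) (g12^~ n),
   analytic_ext (@outer R) (@outer_cl R) (g21^~ n) &
   analytic_ext (@outer R) (@outer_cl R) (g22^~ n)].
  split; apply: analytic_ext_derivable_outer => z zn0; have [d1 d2 d3 d4] := hg n zn0.
  - exact: d1.
  - exact: d2.
  - exact: d3.
  - exact: d4.
have aio : analytic_ext (@outer R) (@outer_cl R) iota.
  exact: (analytic_ext_derivable_outer hiota).
have a1 : analytic_ext (@outer R) (@outer_cl R) (fun=> Ep) by exact: analytic_ext_cst.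
have phiE n z : outer z ->
    iota z * (phibU z n).1 = g11 z n * (phibQ z n).1 + g12 z n * (phibQ z n).2 /\
    iota z * (phibU z n).2 = g21 z n * (phibQ z n).1 + g22 z n * (phibQ z n).2.
  have [b11 b12 b21 b22] := ag n; have [_ _ k1 k2] := aQo n; have [_ _ k3 k4] := aUo n.
  move=> iz'; split.
    apply: (comb_outer k1 k2 k3 b11 b12 aio _ iz') => w w1.
    by have [_ _ h _] := gauge_boundary w1; have [] := h n.
  apply: (comb_outer k1 k2 k4 b21 b22 aio _ iz') => w w1.
  by have [_ _ h _] := gauge_boundary w1; have [] := h n.
have psiE n z : outer z ->
    Ep * (psibU z n).1 = g11 z n * (psibQ z n).1 + g12 z n * (psibQ z n).2 /\
    Ep * (psibU z n).2 = g21 z n * (psibQ z n).1 + g22 z n * (psibQ z n).2.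
  have [b11 b12 b21 b22] := ag n; have [k1 k2 _ _] := aQo n; have [k3 k4 _ _] := aUo n.
  move=> iz'; split.
    apply: (comb_outer k1 k2 k3 b11 b12 a1 _ iz') => w w1.
    by have [_ _ _ h] := gauge_boundary w1; have [] := h n.
  apply: (comb_outer k1 k2 k4 b21 b22 a1 _ iz') => w w1.
  by have [_ _ _ h] := gauge_boundary w1; have [] := h n.
have [n hn] : exists n, (psibQ z0 n).1 != 0.
  apply: (psib_nonvanishing hq hr _ _ _ _ iz).
  - by move=> z /sQo[].
  - by move=> n; have [] := aQo n.
  - by move=> z z1; have [_ [_ h _] _ _] := jost_asymp jQ z1.
  - by move=> z z1; case: jQ => _ _ _ _ /(_ z); rewrite normE z1 toC1 => /(_ erefl)[[]].
have [e1 e2] := dep_eqm dQ n; have [f1 f2] := dep_eqm dU n.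
have [b11 b12 b21 b22] := ag n.
have [k1 k2 k3 k4] := aQo n; have [l1 l2 l3 l4] := aUo n.
have [x1|x1] := eqVneq (psibU z0 n).1 0; last first.
  exact: (dep_transfer hA_out m0 iz aio.1 a1.1 b11.1 b12.1 k3.1 k4.1 k1.1 k2.1 l3.1 l1.1
    (fun z iz => (phiE n z iz).1) (fun z iz => (psiE n z iz).1) e1 e2 f1 x1).
have [x2|x2] := eqVneq (psibU z0 n).2 0; last first.
  exact: (dep_transfer hA_out m0 iz aio.1 a1.1 b21.1 b22.1 k3.1 k4.1 k1.1 k2.1 l4.1 l2.1
    (fun z iz => (phiE n z iz).2) (fun z iz => (psiE n z iz).2) e1 e2 f2 x2).
have [h1 h2] := psiE n z0 iz; rewrite x1 x2 !mulr0 in h1 h2.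
have [h _] := gauge_invertible z01 z00 (esym h1) (esym h2).
case/eqP: hn; exact: h.
Qed.

End Gauge.

(** * The gauges leading to [(p, s)] and [(u, v)] *)

Section Transformations.
Variable R : realType.
Local Notation C := (Cx R).
Variables q r D E : int -> C.
Variables Dinf Einf : C.
Hypotheses (hq : rapid_decay q) (hr : rapid_decay r).
Hypothesis hqr : forall n : int, 1 - q n * r n != 0.
Hypothesis hqr1 : forall n : int, 1 + q n * r (n + 1) != 0.
Hypotheses (hD : is_Dseq q r D) (hE : is_Eseq q r E).
Hypotheses (hDinf : to_pinfty D Dinf) (hEinf : to_pinfty E Einf).

Lemma decay_bounds : exists2 n0 : nat, (0 < n0)%N & forall n, (n0 <= n)%N ->
  [/\ nrm (q n%:Z) <= wt R n, nrm (q (- n%:Z)) <= wt R n, nrm (r n%:Z) <= wt R n &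
      nrm (r (- n%:Z)) <= wt R n].
Proof.
have [n1 n10 h1] := rapid_decay_wt hq; have [n2 n20 h2] := rapid_decay_wt hr.
exists (maxn n1 n2); first by rewrite leq_max n10.
by move=> n; rewrite geq_max => /andP[/h1[? ?] /h2[? ?]].
Qed.

Lemma nrm_mul_wt (x y : C) n : nrm x <= wt R n -> nrm y <= 1 -> nrm (x * y) <= wt R n.
Proof.
by move=> hx hy; rewrite nrmM -[leRHS]mulr1 ler_pM ?nrm_ge0.
Qed.

Lemma product_D : [/\ forall n, D n = (1 - q n * r n) * D (n - 1), to_minfty D 1,
  forall n, D n != 0 & Dinf != 0].
Proof.
have [n0 n00 h] := decay_bounds.
have c1 n : (n0 <= n)%N -> nrm ((1 - q n%:Z * r n%:Z) - 1) <= wt R n.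
  move=> nn; have [h1 _ h2 _] := h n nn.
  rewrite addrC addKr nrmN; apply: nrm_mul_wt => //.
  by apply: le_trans h2 (wt_le1 R _); exact: leq_trans nn.
have c2 n : (n0 <= n)%N -> nrm ((1 - q (- n%:Z) * r (- n%:Z)) - 1) <= wt R n.
  move=> nn; have [_ h1 _ h2] := h n nn.
  rewrite addrC addKr nrmN; apply: nrm_mul_wt => //.
  by apply: le_trans h2 (wt_le1 R _); exact: leq_trans nn.
pose c n := 1 - q n * r n.
split.
- exact: (@infprod_rec R c D hD).
- exact: (@infprod_minfty R c D n0 c2 hD).
- by move=> n; exact: (@infprod_neq0 R c D n0 hqr c2 hD n).
- exact: (@infprod_lim_neq0 R c D n0 hqr c1 c2 hD Dinf hDinf).
Qed.

Lemma product_E : [/\ forall n, E n = (1 + q n * r (n + 1)) * E (n - 1), to_minfty E 1,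
  forall n, E n != 0 & Einf != 0].
Proof.
have [n0 n00 h] := decay_bounds.
have c1 n : (n0.+1 <= n)%N -> nrm ((1 + q n%:Z * r (n%:Z + 1)) - 1) <= wt R n.
  move=> nn; have [h1 _ _ _] := h n (ltnW nn); have [_ _ h2 _] := h n.+1 (leqW (ltnW nn)).
  rewrite addrC addKr; apply: nrm_mul_wt => //.
  have -> : n%:Z + 1 = n.+1%:Z :> int by rewrite -addn1 PoszD.
  exact: le_trans h2 (wt_le1 R _).
(* The factor at [-n] involves [r] at [-(n-1)], one step closer to 0; hence the threshold
   [n0.+1]. *)
have c2 n : (n0.+1 <= n)%N -> nrm ((1 + q (- n%:Z) * r (- n%:Z + 1)) - 1) <= wt R n.
  case: n => [//|n] nn; have [_ h1 _ _] := h n.+1 (ltnW nn); have [_ _ _ h2] := h n nn.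
  rewrite addrC addKr; apply: nrm_mul_wt => //.
  have -> : - n.+1%:Z + 1 = - n%:Z :> int by rewrite -addn1 PoszD; ring.
  by apply: le_trans h2 (wt_le1 R _); exact: leq_trans n00 nn.
pose c n := 1 + q n * r (n + 1).
split.
- exact: (@infprod_rec R c E hE).
- exact: (@infprod_minfty R c E n0.+1 c2 hE).
- by move=> n; exact: (@infprod_neq0 R c E n0.+1 hqr1 c2 hE n).
- exact: (@infprod_lim_neq0 R c E n0.+1 hqr1 c1 c2 hE Einf hEinf).
Qed.

Lemma to_pinfty_pred (f : int -> C) l : to_pinfty f l -> to_pinfty (fun n => f (n - 1)) l.
Proof.
move=> /cvg_nrmP h; apply/cvg_nrmP => e /h[N hN]; exists N.+1 => -[//|n] Nn.
have -> : n.+1%:Z - 1 = n%:Z :> int by rewrite -addn1 PoszD; ring.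
exact: hN.
Qed.

Lemma to_minfty_pred (f : int -> C) l : to_minfty f l -> to_minfty (fun n => f (n - 1)) l.
Proof.
move=> /cvg_nrmP h; apply/cvg_nrmP => e /h[N hN]; exists N => n Nn.
have -> : - n%:Z - 1 = - n.+1%:Z :> int by rewrite -addn1 PoszD; ring.
by apply: hN; exact: leqW.
Qed.

Lemma rapid_decay_lim (f : int -> C) : rapid_decay f -> to_pinfty f 0 /\ to_minfty f 0.
Proof.
move=> /(_ 0%N)[/cvg_nrmP h1 /cvg_nrmP h2]; split; apply/cvg_nrmP => e e0.
  have [N hN] := h1 e e0; exists N => n /hN.
  by rewrite expr0 mul1r !subr0 normE nrm_toC ger0_norm ?nrm_ge0.
have [N hN] := h2 e e0; exists N => n /hN.
by rewrite expr0 mul1r !subr0 normE nrm_toC ger0_norm ?nrm_ge0.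
Qed.

Lemma limitM (u v : nat -> C) (l m : C) : u @ \oo --> l -> v @ \oo --> m ->
  (fun n => u n * v n) @ \oo --> l * m.
Proof. by move=> hu hv; exact: (cvgM hu hv). Qed.

Lemma limit_cst (l : C) : (fun _ : nat => l) @ \oo --> l.
Proof. exact: cvg_cst. Qed.

(* The reciprocal of [sigma], without its poles at 1 and -1. *)
Definition iota_U (z : C) : C := 1 - (z ^+ 2)^-1.

Lemma derivable_iota_U (z : C) : z != 0 -> derivable iota_U z 1.
Proof.
move=> z0; have z20 : z ^+ 2 != 0 by rewrite expf_neq0.
have d2 := derivable_is (@derivable_exp R 2 z).
change (derivable (fun x : C => 1 - (x ^+ 2)^-1) z 1).
have d3 := is_derivable (@is_derive_inv R (fun x => x ^+ 2) z _ z20 d2).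
exact: (derivable_sub (@derivable_cstf R 1 z) d3).
Qed.

Lemma iota_U_neq0 z : nrm z != 1 -> z != 0 -> iota_U z != 0.
Proof.
move=> z1 z0; rewrite /iota_U subr_eq0 eq_sym; apply: contra z1 => /eqP h.
have : nrm (z ^+ 2)^-1 = 1 by rewrite h nrm1.
rewrite nrmV nrmX => /(congr1 GRing.inv); rewrite invrK invr1 => /eqP.
by rewrite sqrf_eq1 => /orP[//|/eqP hz]; have := nrm_ge0 z; rewrite hz; lra.
Qed.

Lemma derivable_cst_mul (c : C) (f : C -> C) z : derivable f z 1 ->
  derivable (fun x => c * f x) z 1.
Proof. by move=> hf; exact: (derivable_mul (@derivable_cstf R c z) hf). Qed.

Section GaugeP.
Variables psiQ psibQ phiQ phibQ psiP psibP phiP phibP : C -> int -> C * C.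
Hypothesis jQ : is_jost (sysQ q r) psiQ psibQ phiQ phibQ.
Hypothesis jP : is_jost (sysU (p_of q r D E) (s_of q r D E)) psiP psibP phiP phibP.

Let g11 (z : C) n := E (n - 1) * (1 - q n * r n).
Let g12 (z : C) n := E (n - 1) * q n.
Let g21 (z : C) n := -1 * D n * r n.
Let g22 (z : C) n := D n.
(** The determinant of the gauge. The matrix of (Q) has determinant 1, so that of (U) must be
    [kap n / kap (n + 1)]. *)
Let kap n := E (n - 1) * D n.

Lemma dep_P :
  (forall z0 m gQ gU, inner z0 -> (0 < m)%N ->
    dep_consts phiQ psiQ z0 m gQ -> dep_consts phiP psiP z0 m gU ->
    eqm m (jet m (fun=> 1) z0 * egf m gU) (egf m gQ * jet m (fun z => Dinf * 1) z0)) /\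
  (forall z0 m gQ gU, outer z0 -> (0 < m)%N ->
    dep_consts phibQ psibQ z0 m gQ -> dep_consts phibP psibP z0 m gU ->
    eqm m (jet m (fun=> 1) z0 * egf m gU) (egf m gQ * jet m (fun=> Einf) z0)).
Proof.
have [recD D1 D0 Di0] := product_D; have [recE E1 E0 Ei0] := product_E.
have recE' n : E n = (1 + q n * r (n + 1)) * E (n - 1) := recE n.
have recD' n : D (n + 1) = (1 - q (n + 1) * r (n + 1)) * D n by rewrite recD addrK.
have [qp qm] := rapid_decay_lim hq; have [rp rm] := rapid_decay_lim hr.
have Ep := to_pinfty_pred hEinf; have Em := to_minfty_pred E1.
have kap0 n : kap n != 0 by rewrite mulf_neq0.
have hdet n : 1 - p_of q r D E n * s_of q r D E n = kap n / kap (n + 1).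
  rewrite /p_of /s_of /kap addrK (recE' n) (recD' n).
  by field; rewrite E0 D0 hqr hqr1.
have kap_m : to_minfty kap 1.
  have h1 := limitM Em D1; rewrite mulr1 in h1; exact: h1.
have kap_p : to_pinfty kap (Einf * Dinf) := limitM Ep hDinf.
have kp0 : Einf * Dinf != 0 by rewrite mulf_neq0.
have hiota (z : C) : z != 0 -> derivable (fun=> 1 : C) z 1.
  by move=> _; exact: (@derivable_cstf R 1 z).
have hg (z : C) (n : int) : z != 0 ->
  [/\ derivable (g11^~ n) z 1, derivable (g12^~ n) z 1,
      derivable (g21^~ n) z 1 & derivable (g22^~ n) z 1].
  by move=> _; split; exact: (@derivable_cstf R _ z).
have gauge_sol z Y : z != 0 -> solves (sysQ q r) z Y ->
    solves (sysU (p_of q r D E) (s_of q r D E)) z (gauge g11 g12 g21 g22 z Y).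
  move=> z0 sY n; rewrite /gauge /g11 /g12 /g21 /g22 /sysU (sY n) /sysQ /= addrK.
  rewrite /p_of /s_of (recE' n) (recD' n).
  by congr pair; field; rewrite z0 ?E0 ?D0 ?hqr ?hqr1.
have l1 (f : nat -> C) : f @ \oo --> (0 : C) -> (fun n => 1 - f n) @ \oo --> (1 : C).
  move=> hf; have h1 := limitB (@limit_cst 1) hf; rewrite subr0 in h1; exact: h1.
have gauge_p z : nrm z = 1 -> [/\ to_pinfty (g11 z) Einf, to_pinfty (g12 z) 0,
    to_pinfty (g21 z) 0 & to_pinfty (g22 z) (Dinf * 1)].
  move=> _; split.
  - have h := limitM qp rp; rewrite mulr0 in h.
    have h1 := limitM Ep (l1 _ h); rewrite mulr1 in h1; exact: h1.
  - have h1 := limitM Ep qp; rewrite mulr0 in h1; exact: h1.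
  - have h1 := limitM (@limitZ R _ _ (-1) hDinf) rp; rewrite mulr0 in h1; exact: h1.
  - rewrite mulr1; exact: hDinf.
have gauge_m z : nrm z = 1 -> [/\ to_minfty (g11 z) 1, to_minfty (g12 z) 0,
    to_minfty (g21 z) 0 & to_minfty (g22 z) 1].
  move=> _; split.
  - have h := limitM qm rm; rewrite mulr0 in h.
    have h1 := limitM Em (l1 _ h); rewrite mulr1 in h1; exact: h1.
  - have h1 := limitM Em qm; rewrite mulr0 in h1; exact: h1.
  - have h1 := limitM (@limitZ R _ _ (-1) D1) rm; rewrite mulr0 in h1; exact: h1.
  - exact: D1.
have gauge_det z n : nrm z != 1 -> z != 0 ->
    g11 z n * g22 z n - g12 z n * g21 z n != 0.
  move=> _ _; have -> : g11 z n * g22 z n - g12 z n * g21 z n = E (n - 1) * D n.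
    by rewrite /g11 /g12 /g21 /g22; ring.
  by rewrite mulf_neq0.
split=> z0 m gQ gU iz m0 dQ dU.
- exact: (@gauge_dep_inner R q r _ _ kap g11 g12 g21 g22 (fun=> 1) 1 (Einf * Dinf) Einf Dinf
    hq hr kap0 hdet kap_m kap_p (oner_neq0 _) kp0 hiota hg gauge_sol gauge_p gauge_m gauge_det
    psiQ psibQ phiQ phibQ jQ psiP psibP phiP phibP jP z0 m gQ gU iz m0 dQ dU).
- exact: (@gauge_dep_outer R q r _ _ kap g11 g12 g21 g22 (fun=> 1) 1 (Einf * Dinf) Einf Dinf
    hq hr kap0 hdet kap_m kap_p (oner_neq0 _) kp0 hiota hg gauge_sol gauge_p gauge_m gauge_det
    psiQ psibQ phiQ phibQ jQ psiP psibP phiP phibP jP z0 m gQ gU iz m0 dQ dU).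
Qed.

End GaugeP.

Section GaugeU.
Variables psiQ psibQ phiQ phibQ psiU psibU phiU phibU : C -> int -> C * C.
Hypothesis jQ : is_jost (sysQ q r) psiQ psibQ phiQ phibQ.
Hypothesis jU : is_jost (sysU (u_of q r D E) (v_of q r D E)) psiU psibU phiU phibU.

Let g11 (z : C) n := E (n - 1).
Let g12 (z : C) (n : int) : C := 0.
Let g21 (z : C) n := -1 * D (n - 1) * r n.
Let g22 (z : C) n := D (n - 1) * iota_U z.
(** The determinant of the gauge up to [iota_U z], which is independent of [n] and drops out of the
    quotients. *)
Let kap n := E (n - 1) * D (n - 1).

(** The factor [iota_U] goes with the Jost solutions whose leading component is the second: [psi]
    inside the disc, [phib] outside. It therefore appears on opposite sides of the two congruences,
    and [sigma] acts on the constants of (U) inside but on those of (Q) outside. *)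
Lemma dep_U :
  (forall z0 m gQ gU, inner z0 -> (0 < m)%N ->
    dep_consts phiQ psiQ z0 m gQ -> dep_consts phiU psiU z0 m gU ->
    eqm m (jet m (fun=> 1) z0 * egf m gU) (egf m gQ * jet m (fun z => Dinf * iota_U z) z0)) /\
  (forall z0 m gQ gU, outer z0 -> (0 < m)%N ->
    dep_consts phibQ psibQ z0 m gQ -> dep_consts phibU psibU z0 m gU ->
    eqm m (jet m iota_U z0 * egf m gU) (egf m gQ * jet m (fun=> Einf) z0)).
Proof.
have [recD D1 D0 Di0] := product_D; have [recE E1 E0 Ei0] := product_E.
have [qp qm] := rapid_decay_lim hq; have [rp rm] := rapid_decay_lim hr.
have Ep := to_pinfty_pred hEinf; have Em := to_minfty_pred E1.
have Dp := to_pinfty_pred hDinf; have Dm := to_minfty_pred D1.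
have kap0 n : kap n != 0 by rewrite mulf_neq0.
have hdet n : 1 - u_of q r D E n * v_of q r D E n = kap n / kap (n + 1).
  rewrite /u_of /v_of /kap addrK (recE n) (recD n).
  by field; rewrite E0 D0 hqr hqr1.
have kap_m : to_minfty kap 1.
  have h1 := limitM Em Dm; rewrite mulr1 in h1; exact: h1.
have kap_p : to_pinfty kap (Einf * Dinf) := limitM Ep Dp.
have kp0 : Einf * Dinf != 0 by rewrite mulf_neq0.
have hg (z : C) (n : int) : z != 0 ->
  [/\ derivable (g11^~ n) z 1, derivable (g12^~ n) z 1,
      derivable (g21^~ n) z 1 & derivable (g22^~ n) z 1].
  move=> z0; split; [exact: (@derivable_cstf R _ z)..|].
  change (derivable (fun x : C => D (n - 1) * iota_U x) z 1).
  exact: (@derivable_cst_mul (D (n - 1)) (@iota_U) z (derivable_iota_U z0)).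
have gauge_sol z Y : z != 0 -> solves (sysQ q r) z Y ->
    solves (sysU (u_of q r D E) (v_of q r D E)) z (gauge g11 g12 g21 g22 z Y).
  move=> z0 sY n; rewrite /gauge /g11 /g12 /g21 /g22 /sysU (sY n) /sysQ /= addrK.
  rewrite /u_of /v_of /iota_U (recE n) (recD n).
  by congr pair; field; rewrite z0 ?E0 ?D0 ?hqr ?hqr1.
have gauge_p z : nrm z = 1 -> [/\ to_pinfty (g11 z) Einf, to_pinfty (g12 z) 0,
    to_pinfty (g21 z) 0 & to_pinfty (g22 z) (Dinf * iota_U z)].
  move=> _; split.
  - exact: Ep.
  - exact: (@limit_cst 0).
  - have h1 := limitM (@limitZ R _ _ (-1) Dp) rp; rewrite mulr0 in h1; exact: h1.
  - exact: (limitM Dp (@limit_cst _)).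
have gauge_m z : nrm z = 1 -> [/\ to_minfty (g11 z) 1, to_minfty (g12 z) 0,
    to_minfty (g21 z) 0 & to_minfty (g22 z) (iota_U z)].
  move=> _; split.
  - exact: Em.
  - exact: (@limit_cst 0).
  - have h1 := limitM (@limitZ R _ _ (-1) Dm) rm; rewrite mulr0 in h1; exact: h1.
  - have h1 := limitM Dm (@limit_cst (iota_U z)); rewrite mul1r in h1; exact: h1.
have gauge_det z n : nrm z != 1 -> z != 0 ->
    g11 z n * g22 z n - g12 z n * g21 z n != 0.
  move=> z1 z0; rewrite /g11 /g12 /g22 mul0r subr0.
  by rewrite !mulf_neq0// iota_U_neq0.
split=> z0 m gQ gU iz m0 dQ dU.
- exact: (@gauge_dep_inner R q r _ _ kap g11 g12 g21 g22 iota_U 1 (Einf * Dinf) Einf Dinf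
    hq hr kap0 hdet kap_m kap_p (oner_neq0 _) kp0 derivable_iota_U hg gauge_sol gauge_p gauge_m
    gauge_det psiQ psibQ phiQ phibQ jQ psiU psibU phiU phibU jU z0 m gQ gU iz m0 dQ dU).
- exact: (@gauge_dep_outer R q r _ _ kap g11 g12 g21 g22 iota_U 1 (Einf * Dinf) Einf Dinf
    hq hr kap0 hdet kap_m kap_p (oner_neq0 _) kp0 derivable_iota_U hg gauge_sol gauge_p gauge_m
    gauge_det psiQ psibQ phiQ phibQ jQ psiU psibU phiU phibU jU z0 m gQ gU iz m0 dQ dU).
Qed.

End GaugeU.

End Transformations.

(** * From congruences of jets to the formulas with [sigma] *)

Section SigmaJet.
Variable R : realType.
Local Notation C := (Cx R).

Lemma egfZ m (c : C) (a : nat -> C) : egf m (fun k => c * a k) = c%:P * egf m a.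
Proof.
by apply/polyP => k; rewrite coefCM !coef_poly; case: ltnP; rewrite ?mulr0// mulrA.
Qed.

Lemma derivable_sigma (z : C) : nrm z != 1 -> z != 0 -> derivable (@sigma R) z 1.
Proof.
move=> z1 z0.
have d := derivable_is (derivable_iota_U z0).
exact: (is_derivable (is_derive_inv (iota_U_neq0 z1 z0) d)).
Qed.

Lemma jet_sigma_iota (A : set C) m (c z : C) :
  (forall w, A w -> exists s1 s2, expR s1 < nrm w < expR s2 /\
     forall z, expR s1 <= nrm z <= expR s2 -> A z) ->
  (forall w, A w -> nrm w != 1 /\ w != 0) -> A z ->
  eqm m (jet m (fun w => c * @iota_U R w) z * jet m (@sigma R) z) c%:P.
Proof.
move=> hA A1 Az.
have hi : holo A (fun w => c * @iota_U R w).
  by move=> w /A1[w1 w0]; exact: (@derivable_cst_mul R c (@iota_U R) w (derivable_iota_U w0)).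
have hs : holo A (@sigma R) by move=> w /A1[w1 w0]; exact: derivable_sigma.
apply: eqm_trans (eqm_sym (jetM (m := m) hA hi hs Az)) _.
have E w : A w -> c * iota_U w * sigma w = c.
  by move=> /A1[w1 w0]; rewrite /sigma -/(iota_U w) mulfK// iota_U_neq0.
have -> := jet_eq hA m E Az.
exact: jet_cst.
Qed.

Lemma eqm_jet1 m (z : C) (p : {poly C}) : eqm m (jet m (fun=> 1) z * p) p.
Proof.
rewrite -[X in eqm _ _ X]mul1r; apply: eqm_mul; last by [].
exact: (@jet_cst R m 1 z).
Qed.

Lemma eqm_jet_cst m (c z : C) (p : {poly C}) : eqm m (p * jet m (fun=> c) z) (c%:P * p).
Proof. by rewrite mulrC; apply: eqm_mul; last by []; exact: jet_cst. Qed.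

Lemma dep_proportional m (z c : C) (gQ gU : nat -> C) :
  eqm m (jet m (fun=> 1) z * egf m gU) (egf m gQ * jet m (fun=> c) z) ->
  forall k, (k < m)%N -> gU k = c * gQ k.
Proof.
move=> h; apply: (@eqm_egf _ m gU (fun k => c * gQ k)); rewrite egfZ.
apply: (@eqm_trans _ m (jet m (fun=> 1) z * egf m gU)).
  exact: eqm_sym (@eqm_jet1 m z (egf m gU)).
apply: eqm_trans h _; exact: eqm_jet_cst.
Qed.

Lemma sum_jet m (f : C -> C) (z : C) (g : nat -> C) k : (k < m)%N ->
  \sum_(l < k.+1) 'C(k, l)%:R * derive1n l f z * g (k - l)%N =
  (egf m g * jet m f z)`_k * (k`!)%:R.
Proof.
move=> km; rewrite -coef_egfM//; apply: eq_bigr => l _; exact: mulrAC.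
Qed.

(** Multiplying the congruence by the jet of [sigma] removes [iota_U] and leaves [c]; the sum to be
    found is a coefficient of the resulting product. *)
Lemma dep_sigma_left m (z c : C) (gQ gU : nat -> C) :
  eqm m (jet m (fun=> 1) z * egf m gU) (egf m gQ * jet m (fun w => c * @iota_U R w) z) ->
  eqm m (jet m (fun w => c * @iota_U R w) z * jet m (@sigma R) z) c%:P ->
  forall k, (k < m)%N ->
    c * gQ k = \sum_(l < k.+1) 'C(k, l)%:R * derive1n l (@sigma R) z * gU (k - l)%N.
Proof.
move=> h hs k km; rewrite (@sum_jet m (@sigma R) z _ k km).
rewrite (@coef_egf _ m (fun k => c * gQ k) k km) egfZ; congr (_ * _).
suff key : eqm m (c%:P * egf m gQ) (egf m gU * jet m (@sigma R) z) by exact: key.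
apply: (@eqm_trans _ m (egf m gQ * (jet m (fun w => c * @iota_U R w) z * jet m (@sigma R) z))).
  by rewrite mulrC; apply: eqm_mul; [|exact: eqm_sym].
rewrite mulrA; apply: eqm_mul; last by [].
exact: eqm_trans (eqm_sym h) (@eqm_jet1 m z (egf m gU)).
Qed.

Lemma dep_sigma_right m (z c : C) (gQ gU : nat -> C) :
  eqm m (jet m (@iota_U R) z * egf m gU) (egf m gQ * jet m (fun=> c) z) ->
  eqm m (jet m (fun w => 1 * @iota_U R w) z * jet m (@sigma R) z) 1%:P ->
  forall k, (k < m)%N ->
    gU k = c * \sum_(l < k.+1) 'C(k, l)%:R * derive1n l (@sigma R) z * gQ (k - l)%N.
Proof.
move=> h hs k km; rewrite (@sum_jet m (@sigma R) z _ k km) mulrA -coefCM.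
rewrite (@coef_egf _ m gU k km); congr (_ * _).
have E : (fun w => 1 * @iota_U R w) = @iota_U R by apply/funext => w; rewrite mul1r.
rewrite E in hs.
suff key : eqm m (egf m gU) (c%:P * (egf m gQ * jet m (@sigma R) z)) by exact: key.
apply: (@eqm_trans _ m (jet m (@iota_U R) z * jet m (@sigma R) z * egf m gU)).
  by rewrite -[X in eqm _ X _]mul1r; apply: eqm_mul; [exact: eqm_sym|].
rewrite mulrAC mulrA; apply: eqm_mul; last by [].
exact: eqm_trans h (@eqm_jet_cst m c z (egf m gQ)).
Qed.

End SigmaJet.

Theorem theorem4p2 (R : realType) (q r : int -> Cx R)
  (hq : rapid_decay q) (hr : rapid_decay r)
  (hqr : forall n : int, 1 - q n * r n != 0)
  (hqr1 : forall n : int, 1 + q n * r (n + 1) != 0)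
  (D E : int -> Cx R) (Dinf Einf : Cx R)
  (hD : is_Dseq q r D) (hE : is_Eseq q r E)
  (hDinf : to_pinfty D Dinf) (hEinf : to_pinfty E Einf)
  (* Jost solutions and 1/T, 1/Tbar for (Q) with (q,r) *)
  (psiQ psibQ phiQ phibQ : Cx R -> int -> Cx R * Cx R) (aQ abQ : Cx R -> Cx R)
  (jQ : is_jost (sysQ q r) psiQ psibQ phiQ phibQ)
  (tQ : inv_transmission phiQ aQ) (tbQ : inv_transmission_bar phibQ abQ)
  (* Jost solutions and 1/T_r, 1/Tbar_r for (U) with (u,v) *)
  (psiU psibU phiU phibU : Cx R -> int -> Cx R * Cx R) (aU abU : Cx R -> Cx R)
  (jU : is_jost (sysU (u_of q r D E) (v_of q r D E)) psiU psibU phiU phibU)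
  (tU : inv_transmission phiU aU) (tbU : inv_transmission_bar phibU abU)
  (* Jost solutions and 1/T_r, 1/Tbar_r for (U) with (p,s) *)
  (psiP psibP phiP phibP : Cx R -> int -> Cx R * Cx R) (aP abP : Cx R -> Cx R)
  (jP : is_jost (sysU (p_of q r D E) (s_of q r D E)) psiP psibP phiP phibP)
  (tP : inv_transmission phiP aP) (tbP : inv_transmission_bar phibP abP)
  (* common pole z_j of multiplicity m_j in 0<|z|<1 *)
  (zj : Cx R) (mj : nat) (hzj : inner zj)
  (pQ : pole_of_order (fun z => (aQ z)^-1) zj mj)
  (pU : pole_of_order (fun z => (aU z)^-1) zj mj)
  (pP : pole_of_order (fun z => (aP z)^-1) zj mj)
  (* common pole zbar_j of multiplicity mbar_j in |z|>1 *)
  (zbj : Cx R) (mbj : nat) (hzbj : outer zbj)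
  (pbQ : pole_of_order (fun z => (abQ z)^-1) zbj mbj)
  (pbU : pole_of_order (fun z => (abU z)^-1) zbj mbj)
  (pbP : pole_of_order (fun z => (abP z)^-1) zbj mbj)
  (* dependency constants *)
  (gQ gU gP gbQ gbU gbP : nat -> Cx R)
  (dQ : dep_consts phiQ psiQ zj mj gQ)
  (dU : dep_consts phiU psiU zj mj gU)
  (dP : dep_consts phiP psiP zj mj gP)
  (dbQ : dep_consts phibQ psibQ zbj mbj gbQ)
  (dbU : dep_consts phibU psibU zbj mbj gbU)
  (dbP : dep_consts phibP psibP zbj mbj gbP) :
  (forall k : nat, (k < mj)%N ->
     Dinf * gQ k = gP k /\
     Dinf * gQ k = \sum_(l < k.+1) 'C(k, l)%:R * derive1n l (@sigma R) zj * gU (k - l)%N)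
  /\
  (forall k : nat, (k < mbj)%N ->
     gbP k = Einf * gbQ k /\
     gbU k = Einf * \sum_(l < k.+1) 'C(k, l)%:R * derive1n l (@sigma R) zbj * gbQ (k - l)%N).
Proof.
have [P1 P2] := dep_P hq hr hqr hqr1 hD hE hDinf hEinf jQ jP.
have [U1 U2] := dep_U hq hr hqr hqr1 hD hE hDinf hEinf jQ jU.
have in_1 (w : Cx R) : inner w -> nrm w != 1 /\ w != 0.
  by move=> iw; split; [rewrite lt_eqF//; case/innerP/andP: iw|exact: inner_neq0].
have out_1 (w : Cx R) : outer w -> nrm w != 1 /\ w != 0.
  by move=> ow; split; [rewrite gt_eqF//; exact/outerP|exact: outer_neq0].
split=> k km.
- have m0 : (0 < mj)%N by exact: leq_ltn_trans km.
  have e1 := P1 _ _ _ _ hzj m0 dQ dP; have e2 := U1 _ _ _ _ hzj m0 dQ dU.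
  rewrite mulr1 in e1; split; first by rewrite (dep_proportional e1 km).
  have S := @jet_sigma_iota R _ mj Dinf zj (@inner_annulus R) in_1 hzj.
  exact: (dep_sigma_left e2 S km).
- have m0 : (0 < mbj)%N by exact: leq_ltn_trans km.
  have e1 := P2 _ _ _ _ hzbj m0 dbQ dbP; have e2 := U2 _ _ _ _ hzbj m0 dbQ dbU.
  split; first exact: (dep_proportional e1 km).
  have S := @jet_sigma_iota R _ mbj 1 zbj (@outer_annulus R) out_1 hzbj.
  exact: (dep_sigma_right e2 S km).
Qed.
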